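(* Suppose $\varepsilon\ge0$ and $k>0$. Then for given initial data $u_0^k,v_0^k$, there is at most one weak solution $(u^k,v^k)$ of the whole-line problem $$u_t=\phi(u)_{xx}-kuv,\quad v_t=\varepsilon\phi(v)_{xx}-kuv\ \text{ in }\mathbb{R}\times(0,T),\qquad u(x,0)=u_0^k(x),\ v(x,0)=v_0^k(x)\ \text{ for }x\in\mathbb{R}.$$
   Context: Fix $T>0$ and constants $U_0,V_0>0$. Write $Q_T=\mathbb{R}\times(0,T)$ and $\mathbb{R}^+=[0,\infty)$. The function $\phi\in C^2(\mathbb{R})$ is strictly increasing, $\phi'$ is strictly increasing on $[0,\infty)$, $\phi(s)>0$ for $s>0$, and $\phi(0)=\phi'(0)=0$. Initial data: let $u_0^\infty(x)=U_0$ for $x<0$, $u_0^\infty(x)=0$ for $x>0$; $v_0^\infty(x)=0$ for $x<0$, $v_0^\infty(x)=V_0$ for $x>0$. For each $k>0$ the data $u_0^k,v_0^k$ satisfy: (i) $u_0^k,v_0^k\in C^2(\mathbb{R})$; (ii) $0\le u_0^k\le U_0$, $0\le v_0^k\le V_0$; (iii) $u_0^k-u_0^\infty\to0$ and $v_0^k-v_0^\infty\to0$ in $L^1(\mathbb{R})$ as $k\to\infty$; (iv) there is a continuous $\omega:\mathbb{R}^+\to\mathbb{R}^+$ with $\omega(\mu)\to0$ as $\mu\to0$ and $\|u_0^k(\cdot+\delta)-u_0^k\|_{L^1(\mathbb{R})}+\|v_0^k(\cdot+\delta)-v_0^k\|_{L^1(\mathbb{R})}\le\omega(|\delta|)$ for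 all $k>0$, $\delta\in\mathbb{R}$. $\hat{\mathcal{F}}_T$ is the set of $\Psi\in C^1(\mathbb{R}\times[0,T])$ with $\Psi(\cdot,T)=0$ and $\mathrm{supp}\,\Psi\subset[-J,J]\times[0,T]$ for some $J>0$. A weak solution is a pair $(u^k,v^k)\in(L^\infty(Q_T))^2$ such that for each $J>0$, $\phi(u^k)\in L^2(0,T;W^{1,2}((-J,J)))$ and, if $\varepsilon>0$, $\phi(v^k)\in L^2(0,T;W^{1,2}((-J,J)))$, and for all $\Psi\in\hat{\mathcal{F}}_T$ $$\int_{\mathbb{R}}u_0^k\Psi(x,0)\,dx+\iint_{Q_T}u^k\Psi_t\,dx\,dt=\iint_{Q_T}\phi(u^k)_x\Psi_x\,dx\,dt+k\iint_{Q_T}\Psi u^kv^k\,dx\,dt,$$ $$\int_{\mathbb{R}}v_0^k\Psi(x,0)\,dx+\iint_{Q_T}v^k\Psi_t\,dx\,dt=\varepsilon\iint_{Q_T}\phi(v^k)_x\Psi_x\,dx\,dt+k\iint_{Q_T}\Psi u^kv^k\,dx\,dt$$ (when $\varepsilon=0$ the term with factor $\varepsilon$ is absent). *)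

(* Defs.v *)
From HB Require Import structures.
From mathcomp Require Import all_boot all_order all_algebra.
From mathcomp Require Import all_classical all_reals all_analysis.

Set Implicit Arguments.
Unset Strict Implicit.
Unset Printing Implicit Defensive.

Import Order.TTheory GRing.Theory Num.Theory.
Import numFieldNormedType.Exports.

Local Open Scope classical_set_scope.
Local Open Scope ring_scope.

Section Domain.
Context {R : realType}.

Definition leb : {measure set (measurableTypeR R) -> \bar R} :=
  @lebesgue_measure R.

Definition leb2 :
    {measure set (measurableTypeR R * measurableTypeR R)%type -> \bar R} :=
  (leb \x leb)%E.

(* A point of the plane is (x, t): space first, time second. *)
Definition QT (T : R) : set (R * R) := setT `*` `]0, T[.

Definition strip (T : R) : set (R * R) := setT `*` `[0, T].

Definition dx (f : R * R -> R) (z : R * R) : R :=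
  derive1 (fun x => f (x, z.2)) z.1.

Definition dt (f : R * R -> R) (z : R * R) : R :=
  derive1 (fun t => f (z.1, t)) z.2.

(* L^p(D); outside D the function f plays no role. *)
Definition Lp_on d (X : measurableType d) (mu : {measure set X -> \bar R})
    (p : \bar R) (D : set X) (f : X -> R) : Prop :=
  f \_ D \in Lfun mu p.

End Domain.

Arguments leb {R}.
Arguments leb2 {R}.

Section FunctionSpaces.
Context {R : realType}.

Definition Cn (n : nat) (f : R -> R) : Prop :=
  (forall m, (m < n)%N -> forall x, derivable (derive1n m f) x 1) /\
  continuous (derive1n n f).

Definition C1c (J : R) (z : R -> R) : Prop :=
  Cn 1 z /\ closure [set x | z x != 0] `<=` `]- J, J[.

(* h is in W^{1,2}((-J,J)) and g is its weak derivative; as is usual in one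
   space dimension, the test functions are the C^1 ones with compact support
   in (-J,J). *)
Definition W12 (J : R) (h g : R -> R) : Prop :=
  [/\ Lp_on leb 2%:E `]- J, J[ h,
      Lp_on leb 2%:E `]- J, J[ g &
      forall z, C1c J z ->
        \int[leb]_(x in `]- J, J[) (h x * derive1 z x) =
        - \int[leb]_(x in `]- J, J[) (g x * z x)].

(* f is in L^2(0,T; W^{1,2}((-J,J))) and g is its weak x-derivative.
   Elements of this space of vector-valued functions are represented by
   functions of (x,t); as W^{1,2}((-J,J)) is separable, strong measurability
   of t |-> f(.,t) amounts to joint measurability of f and g. *)
Definition L2W12 (T J : R) (f g : R * R -> R) : Prop :=
  [/\ measurable_fun (`]- J, J[ `*` `]0, T[) f,
      measurable_fun (`]- J, J[ `*` `]0, T[) g,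
      {ae leb, forall t, t \in `]0, T[ ->
        W12 J (fun x => f (x, t)) (fun x => g (x, t))} &
      (\int[leb]_(t in `]0%R, T[%classic)
       \int[leb]_(x in `](- J)%R, J[%classic)
         (f (x, t) ^+ 2 + g (x, t) ^+ 2)%:E < +oo)%E].

(* C^1(R x [0,T]): the first order partial derivatives exist in the open strip
   and extend continuously to the closed one. *)
Definition C1_strip (T : R) (Psi : R * R -> R) : Prop :=
  [/\ {within strip T, continuous Psi},
      (forall z, QT T z -> derivable (fun x => Psi (x, z.2)) z.1 1 /\
                           derivable (fun t => Psi (z.1, t)) z.2 1) &
      exists Psix Psit : R * R -> R,
        [/\ {within strip T, continuous Psix},
            {within strip T, continuous Psit} &
            forall z, QT T z -> Psix z = dx Psi z /\ Psit z = dt Psi z]].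

Definition test_fun (T : R) (Psi : R * R -> R) : Prop :=
  [/\ C1_strip T Psi,
      forall x, Psi (x, T) = 0 &
      exists2 J : R, 0 < J &
        closure [set z | strip T z /\ Psi z != 0] `<=`
          `[- J, J] `*` `[0, T]].

End FunctionSpaces.

Section Problem.
Context {R : realType}.

Definition phi_assumption (phi : R -> R) : Prop :=
  [/\ Cn 2 phi,
      {homo phi : x y / x < y},
      {in `[0, +oo[ &, {homo derive1 phi : x y / x < y}},
      (forall s, 0 < s -> 0 < phi s) &
      phi 0 = 0 /\ derive1 phi 0 = 0].

(* The values at x = 0 are immaterial. *)
Definition u0_infty (U0 x : R) : R := if x < 0 then U0 else 0.

Definition v0_infty (V0 x : R) : R := if 0 < x then V0 else 0.

Definition L1norm (f : R -> R) : \bar R := Lnorm leb 1%:E (EFin \o f).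

Definition L1_cvg (f : R -> R -> R) (l : R -> R) : Prop :=
  (forall k, 0 < k -> Lp_on leb 1%:E setT (f k \- l)) /\
  L1norm (f k \- l) @[k --> +oo] --> 0%E.

Definition shift_diff (f : R -> R) (delta x : R) : R := f (x + delta) - f x.

Definition initial_data (U0 V0 : R) (u0 v0 : R -> R -> R) : Prop :=
  [/\ forall k, 0 < k -> Cn 2 (u0 k) /\ Cn 2 (v0 k),
      forall k, 0 < k -> forall x,
        0 <= u0 k x <= U0 /\ 0 <= v0 k x <= V0,
      L1_cvg u0 (u0_infty U0) /\ L1_cvg v0 (v0_infty V0) &
      exists omega : R -> R,
        [/\ {within `[0, +oo[, continuous omega},
            forall m, 0 <= m -> 0 <= omega m,
            omega m @[m --> 0^'+] --> (0 : R) &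
            forall k delta : R, 0 < k ->
              (L1norm (shift_diff (u0 k) delta) +
               L1norm (shift_diff (v0 k) delta) <=
               (omega `|delta|)%:E)%E]].

(* p and q stand for phi(u)_x and phi(v)_x; for eps = 0 nothing is required
   of q, and the term containing it vanishes. *)
Definition weak_solution (phi : R -> R) (T eps k : R) (u0 v0 : R -> R)
    (u v : R * R -> R) : Prop :=
  [/\ Lp_on leb2 +oo%E (QT T) u,
      Lp_on leb2 +oo%E (QT T) v &
      exists p q : R * R -> R,
        [/\ forall J, 0 < J -> L2W12 T J (phi \o u) p,
            0 < eps -> forall J, 0 < J -> L2W12 T J (phi \o v) q &
            forall Psi, test_fun T Psi ->
              \int[leb]_x (u0 x * Psi (x, 0))
              + \int[leb2]_(z in QT T) (u z * dt Psi z)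
              = \int[leb2]_(z in QT T) (p z * dx Psi z)
                + k * \int[leb2]_(z in QT T) (Psi z * u z * v z)
              /\
              \int[leb]_x (v0 x * Psi (x, 0))
              + \int[leb2]_(z in QT T) (v z * dt Psi z)
              = eps * \int[leb2]_(z in QT T) (q z * dx Psi z)
                + k * \int[leb2]_(z in QT T) (Psi z * u z * v z)]].

End Problem.

(* Main.v *)
(* For two solutions put w = u1 - u2. Then w_t = (a w)_xx - f weakly, where a is the difference
   quotient of phi, so that 0 <= a <= L, and f = k (u1 v1 - u2 v2); v1 - v2 solves the same
   equation with a multiplied by eps. Uniqueness follows by duality, and both the
   regularisation and the dual problem can be taken discrete. Testing with translates of the
   cubic B-spline of width h turns the second derivative into a second difference of step h
   (the second derivative of the cubic spline is the second difference of the tent), so the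
   smoothed equation is an ODE in t with bounded right-hand side. Solving the dual problem
   backwards by explicit Euler with diffusivity a + nu and a time step of order h^2 keeps the
   maximum principle; psi x = 1 / (1 + x^2) serves as a barrier, and a discrete energy estimate
   absorbs the error made by replacing the smoothing of a w with a times the smoothing of w.
   Letting h and then nu tend to 0 gives, with a constant C,
     int |w(., tau)| psi <= C int_0^tau int |f| psi   for almost every tau,
   and |f| <= C' (|u1 - u2| + |v1 - v2|) lets Gronwall's lemma conclude. *)

(* The coefficient [a] is only bounded and measurable and may vanish on large sets (everywhere, for
   the second component when [eps = 0]), so no regularity of a dual solution can be expected: each
   estimate has to come from the bounds on [a] alone. The extra [nu] bounds the dissipation from
   below. As [h] tends to 0 the consistency error tends to [- nu * w]; Young's inequality divides
   its square by [nu], which leaves a loss of order [nu]. The energy of the final datum is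
   multiplied by a free parameter [mm]. The order of the choices is forced. The number of time steps
   comes after [h], because the bound on the time derivative of the smoothed solution grows like
   [h ^- 2]; [h] comes after [mm], [J] and [nu]; and [nu] comes after [mm] and the window [J],
   because the loss is proportional to [nu * J / mm]. The dual problem lives on the bounded window
   [[-J, J)]. A hat function vanishing just beyond its ends is a second barrier: it controls the
   flux through the ends, at a cost proportional to [1 / (J - J0)] if the final datum lives in
   [[-J0, J0)]. *)
Require Import Defs.
From HB Require Import structures.
From mathcomp Require Import all_boot all_order all_algebra.
From mathcomp Require Import all_classical all_reals all_analysis.
From mathcomp Require Import measurable_realfun ess_sup_inf ring lra.
Import Order.TTheory GRing.Theory Num.Theory.
Import numFieldNormedType.Exports.
Local Open Scope classical_set_scope.
Local Open Scope ring_scope.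
Set Implicit Arguments.
Unset Strict Implicit.
Unset Printing Implicit Defensive.

(** * Integrals of real-valued functions *)

Section Integrals.
Context d (X : measurableType d) (R : realType).
Variable mu : {measure set X -> \bar R}.
Implicit Types f g : X -> R.

Definition itg f := mu.-integrable setT (EFin \o f).
(** The bound holds at every point rather than almost everywhere, so it passes to slices, translates
    and compositions without null sets. *)
Definition bmf f := measurable_fun setT f /\ exists C, forall x, `|f x| <= C.
Definition Int f := Rintegral mu setT f.

Lemma itg_meas f : itg f -> measurable_fun setT f.
Proof. by move=> /measurable_int/measurable_EFinP. Qed.

Lemma itg_fin f : itg f -> (\int[mu]_x (f x)%:E)%E \is a fin_num.
Proof. exact: integrable_fin_num. Qed.

Lemma EFin_Int f : itg f -> (Int f)%:E = (\int[mu]_x (f x)%:E)%E.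
Proof. by move=> itf; rewrite fineK// itg_fin. Qed.

Lemma eq_Int f g : f =1 g -> Int f = Int g.
Proof. by move=> fg; congr Int; apply/funext. Qed.

Lemma eq_itg f g : f =1 g -> itg f -> itg g.
Proof. by move=> /funext ->. Qed.

Lemma itg_le f g : measurable_fun setT g -> (forall x, `|g x| <= f x) ->
  itg f -> itg g.
Proof.
move=> mg gf itf; apply: (le_integrable measurableT _ _ itf).
  exact/measurable_EFinP.
by move=> x _ /=; rewrite lee_fin (le_trans (gf x))// ler_norm.
Qed.

Lemma itgD f g : itg f -> itg g -> itg (fun x => f x + g x).
Proof. by move=> itf itg'; apply: (integrableD measurableT itf itg'). Qed.

Lemma itgZ (r : R) f : itg f -> itg (fun x => r * f x).
Proof. by move=> itf; apply: (integrableZl measurableT r itf). Qed.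

Lemma itgN f : itg f -> itg (fun x => - f x).
Proof.
by move=> /(itgZ (-1)) h; apply: eq_integrable h => //= x _; rewrite mulN1r.
Qed.

Lemma itgB f g : itg f -> itg g -> itg (fun x => f x - g x).
Proof. by move=> itf /itgN; apply: itgD. Qed.

Lemma itg_abs f : itg f -> itg (fun x => `|f x|).
Proof. by move=> itf; apply: (integrable_abse itf). Qed.

Lemma itgM f g : itg f -> bmf g -> itg (fun x => f x * g x).
Proof.
move=> itf [mg [C gC]].
apply: (@itg_le (fun x => C * `|f x|)); last exact/itgZ/itg_abs.
  by apply: measurable_funM => //; exact: itg_meas.
by move=> x; rewrite normrM mulrC ler_wpM2r.
Qed.

Lemma itgMl f g : itg f -> bmf g -> itg (fun x => g x * f x).
Proof.
by move=> itf bg; apply: eq_integrable (itgM itf bg) => //= x _; rewrite mulrC.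
Qed.

Lemma IntD f g : itg f -> itg g -> Int (fun x => f x + g x) = Int f + Int g.
Proof. by move=> *; exact: RintegralD. Qed.

Lemma IntB f g : itg f -> itg g -> Int (fun x => f x - g x) = Int f - Int g.
Proof. by move=> *; exact: RintegralB. Qed.

Lemma IntZ r f : itg f -> Int (fun x => r * f x) = r * Int f.
Proof. by move=> *; exact: RintegralZl. Qed.

Lemma IntN f : itg f -> Int (fun x => - f x) = - Int f.
Proof.
by move=> /(IntZ (-1)); rewrite mulN1r => <-; apply: eq_Int => x; rewrite mulN1r.
Qed.

Lemma ler_Int f g : itg f -> itg g -> (forall x, f x <= g x) -> Int f <= Int g.
Proof. by move=> itf itg' fg; apply: le_Rintegral => // x _. Qed.

Lemma Int_abs f : itg f -> `|Int f| <= Int (fun x => `|f x|).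
Proof. by move=> itf; apply: le_normr_Rintegral. Qed.

Lemma Int_ge0 f : (forall x, 0 <= f x) -> 0 <= Int f.
Proof. by move=> f0; apply: Rintegral_ge0. Qed.

Lemma Int0 : Int (fun=> 0) = 0.
Proof. by rewrite /Int /Rintegral integral0. Qed.

Lemma Int_eq0 f : itg f -> Int (fun x => `|f x|) = 0 -> {ae mu, forall x, f x = 0}.
Proof.
move=> itf I0.
have mf := itg_meas itf.
have fin := integrable_fin_num measurableT (itg_abs itf).
have : (\int[mu]_x `|(EFin \o f) x| = 0)%E.
  by rewrite -[LHS](fineK fin); congr EFin; exact: I0.
move/(ae_eq_integral_abs _ measurableT) => h.
have {h} : ae_eq mu setT (EFin \o f) (cst 0%E).
  by apply: h; exact/measurable_EFinP.
by apply: filterS => x /= /(_ I) [].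
Qed.

Lemma Int_cvg (F : nat -> X -> R) f g :
  (forall n, measurable_fun setT (F n)) -> itg g ->
  (forall n x, `|F n x| <= g x) ->
  measurable_fun setT f ->
  {ae mu, forall x, F n x @[n --> \oo] --> f x} ->
  Int (F n) @[n --> \oo] --> Int f.
Proof.
move=> mF itgg Fg mf Ff.
have [|||||itf _] := @dominated_convergence _ X R mu setT measurableT
  (fun n => EFin \o F n) (EFin \o f) (EFin \o g).
- by move=> n; apply/measurable_EFinP.
- exact/measurable_EFinP.
- apply: filterS Ff => x /= h _; apply: cvg_EFin; [exact: nearW|exact: h].
- by [].
- by apply: nearW => x n _ /=; rewrite lee_fin.
rewrite -[in X in _ --> X -> _](fineK (integrable_fin_num measurableT itf)).
by move/fine_cvg.
Qed.

Lemma ae_imp (P Q : X -> Prop) : (forall x, P x -> Q x) ->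
  {ae mu, forall x, P x} -> {ae mu, forall x, Q x}.
Proof. by move=> PQ; apply: filterS. Qed.

Lemma ae_and (P Q : X -> Prop) : {ae mu, forall x, P x} ->
  {ae mu, forall x, Q x} -> {ae mu, forall x, P x /\ Q x}.
Proof. by move=> p q; apply: filterS2 p q => x; split. Qed.

Lemma ae_all (P : nat -> X -> Prop) : (forall n, {ae mu, forall x, P n x}) ->
  {ae mu, forall x n, P n x}.
Proof. by move=> p; apply/ae_foralln. Qed.

End Integrals.

(** * Closure properties of bounded measurable functions *)

Section BoundedMeasurable.
Context d (X : measurableType d) (R : realType).
Implicit Types f g : X -> R.

Lemma measurable_bool (p : X -> bool) : measurable_fun setT p ->
  measurable_fun setT (fun x => (p x)%:R : R).
Proof.
move=> mp; rewrite (_ : (fun x => _) = fun x => if p x then 1 else 0 : R).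
  by apply: measurable_fun_ifT.
by apply/funext => x; case: (p x).
Qed.

Lemma bmf_cst (c : R) : bmf (fun _ : X => c).
Proof. by split; [exact: measurable_cst | exists `|c|]. Qed.

Lemma bmfD f g : bmf f -> bmf g -> bmf (fun x => f x + g x).
Proof.
move=> [mf [C fC]] [mg [D gD]]; split; first exact: measurable_funD.
by exists (C + D) => x; rewrite (le_trans (ler_normD _ _))// lerD.
Qed.

Lemma bmfN f : bmf f -> bmf (fun x => - f x).
Proof.
move=> [mf [C fC]]; split; first exact: measurableT_comp.
by exists C => x; rewrite normrN.
Qed.

Lemma bmfB f g : bmf f -> bmf g -> bmf (fun x => f x - g x).
Proof. by move=> bf bg; apply: bmfD => //; exact: bmfN. Qed.

Lemma bmfM f g : bmf f -> bmf g -> bmf (fun x => f x * g x).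
Proof.
move=> [mf [C fC]] [mg [D gD]]; split; first exact: measurable_funM.
by exists (C * D) => x; rewrite normrM ler_pM.
Qed.

Lemma bmf_abs f : bmf f -> bmf (fun x => `|f x|).
Proof.
move=> [mf [C fC]]; split; first exact: measurableT_comp.
by exists C => x; rewrite normr_id.
Qed.

Lemma bmfX f n : bmf f -> bmf (fun x => f x ^+ n).
Proof.
move=> bf; elim: n => [|n IH]; first exact: bmf_cst.
rewrite (_ : (fun x => _) = fun x => f x * f x ^+ n); first exact: bmfM.
by apply/funext => x; rewrite exprS.
Qed.

Lemma bmf_comp d' (Y : measurableType d') f (g : Y -> X) : bmf f ->
  measurable_fun setT g -> bmf (fun y => f (g y)).
Proof.
move=> [mf [C fC]] mg; split; first exact: measurableT_comp.
by exists C.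
Qed.

End BoundedMeasurable.

(** * Fubini and Tonelli for real-valued integrals *)

Section Slices.
Context d1 d2 (X : measurableType d1) (Y : measurableType d2) (R : realType).
Variables (m1 : {sigma_finite_measure set X -> \bar R})
  (m2 : {sigma_finite_measure set Y -> \bar R}).
Implicit Types g : X * Y -> R.

(** Tonelli gives measurability for the positive and the negative part; [fine] assigns a real value
    to the slices whose integral is infinite, so measurability of [g] suffices. *)
Lemma measurable_Int1 g : measurable_fun setT g ->
  measurable_fun setT (fun x => Int m2 (fun y => g (x, y))).
Proof.
move=> mg.
have mE : measurable_fun setT (EFin \o g) by exact/measurable_EFinP.
rewrite (_ : (fun x => _) = fine \o (fun x =>
    \int[m2]_y ((EFin \o g)^\+ (x, y)) - \int[m2]_y ((EFin \o g)^\- (x, y)))%E);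
  last first.
  apply/funext => x.
  rewrite /Int /Rintegral integralE.
  rewrite /comp; congr fine; congr adde; first by apply: eq_integral => z _; rewrite !funeposE.
  by congr oppe; apply: eq_integral => z _; rewrite !funenegE.
apply: measurableT_comp => //; apply: emeasurable_funB.
- rewrite (_ : (fun x => _) = fubini_F m2 ((EFin \o g)^\+)%E).
    by apply: measurable_fun_fubini_tonelli_F => //; exact: measurable_funepos.
  by apply/funext => x; rewrite /fubini_F.
- rewrite (_ : (fun x => _) = fubini_F m2 ((EFin \o g)^\-)%E).
    by apply: measurable_fun_fubini_tonelli_F => //; exact: measurable_funeneg.
  by apply/funext => x; rewrite /fubini_F.
Qed.

Lemma measurable_Int2 g : measurable_fun setT g ->
  measurable_fun setT (fun y => Int m1 (fun x => g (x, y))).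
Proof.
move=> mg.
have mE : measurable_fun setT (EFin \o g) by exact/measurable_EFinP.
rewrite (_ : (fun y => _) = fine \o (fun y =>
    \int[m1]_x ((EFin \o g)^\+ (x, y)) - \int[m1]_x ((EFin \o g)^\- (x, y)))%E);
  last first.
  apply/funext => y.
  rewrite /Int /Rintegral integralE.
  rewrite /comp; congr fine; congr adde; first by apply: eq_integral => z _; rewrite !funeposE.
  by congr oppe; apply: eq_integral => z _; rewrite !funenegE.
apply: measurableT_comp => //; apply: emeasurable_funB.
- rewrite (_ : (fun x => _) = fubini_G m1 ((EFin \o g)^\+)%E).
    by apply: measurable_fun_fubini_tonelli_G => //; exact: measurable_funepos.
  by apply/funext => x; rewrite /fubini_G.
- rewrite (_ : (fun x => _) = fubini_G m1 ((EFin \o g)^\-)%E).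
    by apply: measurable_fun_fubini_tonelli_G => //; exact: measurable_funeneg.
  by apply/funext => x; rewrite /fubini_G.
Qed.

(** Integrability of every slice makes the real inner integral agree pointwise with the extended
    one, so the extended Fubini theorem transfers directly. *)
Lemma fubini_iter1 g : itg (m1 \x m2)%E g ->
  (forall x, itg m2 (fun y => g (x, y))) ->
  itg m1 (fun x => Int m2 (fun y => g (x, y))) /\
  Int m1 (fun x => Int m2 (fun y => g (x, y))) = Int (m1 \x m2)%E g.
Proof.
move=> ig ig1.
have E : EFin \o (fun x => Int m2 (fun y => g (x, y)))
    = fubini_F m2 (EFin \o g).
  by apply/funext => x /=; rewrite EFin_Int.
split; first by rewrite /itg E; exact: integrable_fubini_F.
rewrite {1}/Int /Rintegral; congr fine.
rewrite -integral12_prod_meas1//; congr integral; exact: E.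
Qed.

Lemma fubini_iter2 g : itg (m1 \x m2)%E g ->
  (forall y, itg m1 (fun x => g (x, y))) ->
  itg m2 (fun y => Int m1 (fun x => g (x, y))) /\
  Int m2 (fun y => Int m1 (fun x => g (x, y))) = Int (m1 \x m2)%E g.
Proof.
move=> ig ig1.
have E : EFin \o (fun y => Int m1 (fun x => g (x, y)))
    = fubini_G m1 (EFin \o g).
  by apply/funext => x /=; rewrite EFin_Int.
have mE : measurable_fun setT (EFin \o g) by exact: measurable_int ig.
split.
  rewrite /itg E; apply/integrableP; split; first exact: (measurable_fubini_G ig).
  have lty := (@integrable21ltyP _ _ _ _ _ m1 m2 _ mE).1 ig.
  apply: (le_lt_trans _ lty).
  apply: ge0_le_integral => //.
  - by apply: measurableT_comp => //; exact: (measurable_fubini_G ig).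
  - apply: (@measurable_fun_fubini_tonelli_G _ _ _ _ _ m1 (abse \o (EFin \o g))) => //=.
    exact: measurableT_comp.
  - move=> y _; apply: le_abse_integral => //.
    exact: (measurableT_comp mE (pair2_measurable y)).
rewrite {1}/Int /Rintegral; congr fine.
rewrite -integral21_prod_meas1//; congr integral; exact: E.
Qed.

(** By Tonelli, the iterated integral of the absolute value is at most the product of two
    one-variable integrals. *)
Lemma itg_prod (a : X -> R) (b : Y -> R) g : measurable_fun setT g ->
  itg m1 a -> itg m2 b -> (forall z, `|g z| <= a z.1 * b z.2) ->
  itg (m1 \x m2)%E g.
Proof.
move=> mg ia ib gab.
have mE : measurable_fun setT (EFin \o g) by exact/measurable_EFinP.
apply: (@integrable12ltyP _ _ _ _ _ m1 m2 _ mE).2.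
apply: (@le_lt_trans _ _ (\int[m1]_x (`|a x| * Int m2 (fun y => `|b y|))%:E)%E).
  apply: ge0_le_integral => //.
  - by move=> x _; apply: integral_ge0.
  - apply: (@measurable_fun_fubini_tonelli_F _ _ _ _ _ m2 (abse \o (EFin \o g))) => //=.
    exact: measurableT_comp.
  - apply/measurable_EFinP; apply: measurable_funM => //.
    by apply: measurableT_comp => //; exact: itg_meas ia.
  move=> x _.
  have ib' := itgZ `|a x| (itg_abs ib).
  rewrite -IntZ; last exact: itg_abs.
  rewrite EFin_Int//.
  apply: ge0_le_integral => //.
  - by do 2 apply: measurableT_comp => //; exact: pair1_measurable.
  - exact: (measurable_int _ ib').
  move=> y _; rewrite lee_fin (le_trans (gab (x, y)))//= -normrM.
  exact: ler_norm.
have ia' := itgM (itg_abs ia) (bmf_cst X (Int m2 (fun y => `|b y|))).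
move/integrableP : ia' => [_].
apply: le_lt_trans; apply: ge0_le_integral => //.
- by move=> x _; rewrite lee_fin mulr_ge0// Int_ge0.
- apply/measurable_EFinP; apply: measurable_funM => //.
  by apply: measurableT_comp => //; exact: itg_meas ia.
- apply: measurableT_comp => //; apply/measurable_EFinP.
  apply: measurable_funM => //.
  by apply: measurableT_comp => //; exact: itg_meas ia.
by move=> x _ /=; rewrite lee_fin ler_norm.
Qed.

End Slices.

(** * Half-open intervals and translations on the real line *)

Section Line.
Context (R : realType).
Local Notation mu := (@lebesgue_measure R).
Local Notation I := (Int (@lebesgue_measure R)).
Implicit Types f g : R -> R.

(** Half-open, so that adjacent cells tile the line and splitting an integral over them is an
    identity at every point. *)
Definition seg (c d x : R) : R := ((c <= x) && (x < d))%:R.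

Lemma measurable_seg c d : measurable_fun setT (seg c d).
Proof.
apply: measurable_bool; apply: measurable_and.
  by apply: measurable_fun_ler.
by apply: measurable_fun_ltr.
Qed.

Lemma bmf_seg c d : bmf (seg c d).
Proof.
split; first exact: measurable_seg.
by exists 1 => x; rewrite /seg; case: (_ && _); rewrite ?normr1 ?normr0.
Qed.

Lemma seg_ge0 c d x : 0 <= seg c d x.
Proof. by rewrite /seg; case: (_ && _). Qed.

Lemma seg_le1 c d x : seg c d x <= 1.
Proof. by rewrite /seg; case: (_ && _). Qed.

Lemma segE c d : seg c d = \1_(`[c, d[%classic).
Proof.
apply/funext => x; rewrite /seg indicE; congr ((nat_of_bool _)%:R).
by apply/idP/idP; rewrite inE /= in_itv.
Qed.

Lemma itg_seg c d : itg mu (seg c d).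
Proof.
rewrite segE; exact: integrable_indic_itv.
Qed.

Lemma Int_seg c d : c <= d -> I (seg c d) = d - c.
Proof.
move=> cd; rewrite segE /Int /Rintegral integral_indic//= setIT.
rewrite lebesgue_measure_itv; case: ifPn => //=.
by rewrite lte_fin -leNgt => dc; apply/eqP; rewrite eq_sym subr_eq0 eq_le dc.
Qed.

Lemma itg_seg_bmf c d f : bmf f -> itg mu (fun x => seg c d x * f x).
Proof. by move=> bf; apply: itgM => //; exact: itg_seg. Qed.

Lemma seg_split a b c x : a <= b -> b <= c ->
  seg a c x = seg a b x + seg b c x.
Proof.
move=> ab bc; rewrite /seg; case: (leP a x) => ax; case: (ltP x c) => xc;
  case: (ltP x b) => xb; case: (leP b x) => bx /=; rewrite ?addr0 ?add0r //; lra.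
Qed.

(** The image of Lebesgue measure under a translation gives half-open intervals their length, so
    uniqueness identifies it with Lebesgue measure. *)
Lemma integral_shift (f : R -> \bar R) h : measurable_fun setT f ->
  (\int[mu]_x f (x + h)%R = \int[mu]_x f x)%E.
Proof.
move=> mf.
pose sh : measurableTypeR R -> measurableTypeR R := fun x : R => x + h.
have mh : measurable_fun setT sh.
  by apply: (@measurable_funD _ (measurableTypeR R) R setT id (cst h)).
pose nu : {measure set (measurableTypeR R) -> \bar R} :=
  measure_function_pushforward__canonical__measure_function_Measure mu mh.
have E (F : R -> \bar R) : (\int[nu]_x F x
    = \int[mu]_x F x)%E.
  apply: (@eq_measure_integral _ _ _ setT mu nu) => A mA _; apply: esym.
  apply: lebesgue_measure_unique => //.
  move=> _ [[a b] _ <-] /=; rewrite /pushforward.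
  rewrite (_ : _ @^-1` _ = `]a - h, b - h]%classic); last first.
    by apply/seteqP; split => x /=; rewrite !in_itv/= ltrBlDr lerBrDr.
  rewrite !lebesgue_measure_itv/= !lte_fin ltrD2r; case: ifP => // _.
  by rewrite -!EFinD; congr EFin; ring.
rewrite -[RHS]E.
rewrite [LHS]integralE [RHS]integralE.
rewrite !(ge0_integral_pushforward mh)//.
- rewrite preimage_setT; congr adde.
    apply: eq_integral => x _.
    by rewrite /= !funeposE.
  by congr oppe; apply: eq_integral => x _; rewrite /= !funenegE.
- exact: (measurable_funeneg mf).
- exact: (measurable_funepos mf).
Qed.

Lemma itg_shift f h : itg mu f -> itg mu (fun x => f (x + h)).
Proof.
move=> itf; have mf := itg_meas itf.
have mh : measurable_fun setT (fun x : R => x + h) by apply: measurable_funD.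
apply/integrableP; split.
  by apply/measurable_EFinP; exact: (measurableT_comp mf mh).
move/integrableP: itf => [_].
rewrite -(@integral_shift (fun x => `|(f x)%:E|%E) h)//.
by apply: measurableT_comp => //; exact/measurable_EFinP.
Qed.

Lemma Int_shift f h : measurable_fun setT f -> I (fun x => f (x + h)) = I f.
Proof.
move=> mf; rewrite /Int /Rintegral.
rewrite -(@integral_shift (fun x => (f x)%:E) h)//.
exact/measurable_EFinP.
Qed.

Lemma bmf_shift (h : R) f : bmf f -> bmf (fun x : R => f (x + h)).
Proof. by move=> bf; apply: bmf_comp => //; apply: measurable_funD. Qed.

End Line.

(** * The discrete dual problem *)

Section Discrete.
Context (R : realType).
Local Notation mu := (@lebesgue_measure R).
Local Notation I := (Int (@lebesgue_measure R)).
Implicit Types f g : R -> R.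

(** Unscaled: the factor [h ^- 2] is put into the diffusivity, and the stability condition becomes
    [al <= 4^-1]. *)
Definition lap (h : R) f (x : R) : R := f (x + h) + f (x - h) - 2 * f x.

Definition energy (h : R) f : R := I (fun x => (f (x + h) - f x) ^+ 2).

Definition vanish_off (J : R) f := forall x, ~~ (-J <= x < J) -> f x = 0.

Lemma vanish_off_seg J f x : vanish_off J f -> seg (-J) J x * f x = f x.
Proof.
rewrite /seg => sf; case: (boolP (- J <= x < J)) => [_|h]; first by rewrite mul1r.
by rewrite (sf _ h) mulr0.
Qed.

Lemma vanish_offM J f g : vanish_off J g -> vanish_off J (fun x => f x * g x).
Proof. by move=> sg x hx; rewrite sg// mulr0. Qed.

Lemma itg_vanish J f : bmf f -> vanish_off J f -> itg mu f.
Proof.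
move=> bf sf; apply: eq_itg (itg_seg_bmf (-J) J bf) => x.
exact: vanish_off_seg.
Qed.

Lemma bmf_lap h f : bmf f -> bmf (lap h f).
Proof.
move=> bf; apply: bmfB; last by apply: bmfM => //; exact: bmf_cst.
by apply: bmfD; apply: bmf_shift.
Qed.

Lemma itg_lap h J f : bmf f -> vanish_off J f -> itg mu (lap h f).
Proof.
move=> bf sf; have itf := itg_vanish bf sf.
by apply: itgB; [apply: itgD; apply: itg_shift|apply: itgZ].
Qed.

Lemma Int_lap_sym h J f g : bmf f -> bmf g -> vanish_off J g ->
  I (fun x => lap h f x * g x) = I (fun x => f x * lap h g x).
Proof.
move=> bf bg sg; have ig := itg_vanish bg sg.
have sh (a : R) : I (fun x => f (x + a) * g x) = I (fun x => f x * g (x - a)).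
  rewrite -[RHS](@Int_shift _ _ a).
    by apply: eq_Int => x; rewrite addrK.
  apply: measurable_funM; first exact: bf.1.
  exact: (bmf_shift (-a) bg).1.
have i1 (a : R) : itg mu (fun x => f (x + a) * g x).
  by apply: itgMl => //; exact: bmf_shift.
have i2 (a : R) : itg mu (fun x => f x * g (x + a)).
  by apply: itgMl => //; exact: itg_shift.
have i0 : itg mu (fun x => 2 * (f x * g x)) by apply: itgZ; exact: itgMl.
transitivity (I (fun x => f (x + h) * g x + f (x - h) * g x - 2 * (f x * g x))).
  by apply: eq_Int => x; rewrite /lap; ring.
rewrite IntB//; last exact: itgD.
rewrite IntD// !sh.
transitivity (I (fun x => f x * g (x - h) + f x * g (x + h) - 2 * (f x * g x))).
  rewrite IntB//; last exact: itgD.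
  by rewrite IntD// opprK.
by apply: eq_Int => x; rewrite /lap; ring.
Qed.

(** Expand the square. Summation by parts turns the cross term into minus twice the dissipation
    [I (al * (lap h f)^2)]. The square of the increment costs at most four times the integral of
    [al^2 * (lap h f)^2], hence one dissipation since [al <= 4^-1]. One dissipation is left over. *)
Lemma energy_step h J f (al : R -> R) : bmf f -> vanish_off J f -> bmf al ->
  (forall x, 0 <= al x <= 4^-1) ->
  energy h (fun x => f x + al x * lap h f x) + I (fun x => al x * lap h f x ^+ 2)
  <= energy h f.
Proof.
move=> bf sf bal al4; pose d x := al x * lap h f x.
have bl := bmf_lap h bf.
have bd : bmf d by exact: bmfM.
have il := itg_lap h bf sf.
have id : itg mu d by exact: itgMl.
have id2 : itg mu (fun x => d x ^+ 2).
  by apply: eq_itg (itgM id bd) => x; rewrite expr2.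
have ial : itg mu (fun x => al x * lap h f x ^+ 2).
  by apply: eq_itg (itgM id bl) => x; rewrite /d expr2 mulrA.
have itf := itg_vanish bf sf.
have is2 (u : R -> R) : itg mu u -> bmf u -> itg mu (fun x => (u (x + h) - u x) ^+ 2).
  move=> iu bu.
  have i := itgM (itgB (itg_shift h iu) iu) (bmfB (bmf_shift h bu) bu).
  by apply: eq_itg i => x; rewrite expr2.
have ix : itg mu (fun x => (f (x + h) - f x) * (d (x + h) - d x)).
  apply: itgM; first by apply: itgB => //; exact: itg_shift.
  by apply: bmfB => //; exact: bmf_shift.
have X : I (fun x => (f (x + h) - f x) * (d (x + h) - d x)) =
    - I (fun x => al x * lap h f x ^+ 2).
  transitivity (I (fun x => (f (x + h) * d (x + h) + f x * d x)
      - (f x * d (x + h) + f (x + h) * d x))).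
    by apply: eq_Int => x; ring.
  have i1 : itg mu (fun x => f x * d x) by exact: itgM.
  have i2 : itg mu (fun x => f (x + h) * d x).
    by apply: itgMl => //; exact: bmf_shift.
  have i3 : itg mu (fun x => f (x - h) * d x).
    by apply: itgMl => //; exact: bmf_shift.
  have i4 : itg mu (fun x => f x * d (x + h)).
    by apply: itgMl => //; exact: itg_shift.
  rewrite IntB; [|apply: itgD => //; exact: (itg_shift h i1)|exact: itgD].
  rewrite IntD//; last exact: (itg_shift h i1).
  rewrite IntD// (@Int_shift _ (fun x => f x * d x)); last exact: itg_meas i1.
  have -> : I (fun x => f x * d (x + h)) = I (fun x => f (x - h) * d x).
    rewrite -(@Int_shift _ (fun x => f (x - h) * d x) h); last exact: itg_meas i3.
    by apply: eq_Int => x; rewrite addrK.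
  transitivity (- (I (fun x => f (x + h) * d x + f (x - h) * d x - 2 * (f x * d x)))).
    rewrite IntB; [|exact: itgD|exact: itgZ].
    rewrite IntD// IntZ//; ring.
  by congr (- _); apply: eq_Int => x; rewrite /d /lap; ring.
have Y : I (fun x => (d (x + h) - d x) ^+ 2) <= I (fun x => al x * lap h f x ^+ 2).
  apply: (@le_trans _ _ (I (fun x => 2 * d (x + h) ^+ 2 + 2 * d x ^+ 2))).
    apply: ler_Int; first exact: is2.
      by apply: itgD; apply: itgZ => //; exact: (itg_shift h id2).
    by move=> x; have := sqr_ge0 (d (x + h) + d x); nra.
  rewrite IntD; [|apply: itgZ; exact: (itg_shift h id2)|exact: itgZ].
  rewrite !IntZ//; last exact: (itg_shift h id2).
  rewrite (@Int_shift _ (fun x => d x ^+ 2)); last exact: itg_meas id2.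
  rewrite -mulrDl -IntZ//; apply: ler_Int => //; first exact: itgZ.
  move=> x; rewrite /d exprMn mulrA; apply: ler_wpM2r; first exact: sqr_ge0.
  have /andP[] := al4 x; nra.
rewrite (_ : energy h _ = I (fun x => ((f (x + h) - f x) ^+ 2
   + 2 * ((f (x + h) - f x) * (d (x + h) - d x))) + (d (x + h) - d x) ^+ 2)); last first.
  by apply: eq_Int => x; rewrite /d; ring.
rewrite IntD; [|apply: itgD; [exact: is2|exact: itgZ]|exact: is2].
rewrite IntD; [|exact: is2|exact: itgZ].
rewrite IntZ// X /energy; lra.
Qed.

End Discrete.

(** * Barriers for the dual scheme and the duality estimate *)

Section Discrete2.
Context (R : realType).
Local Notation mu := (@lebesgue_measure R).
Local Notation I := (Int (@lebesgue_measure R)).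
Implicit Types f g : R -> R.

(** Discrete maximum principle: as [2 * al <= 1], the new value is a convex combination of three old
    ones. The weight need only be a supersolution up to the growth factor [1 + k']. *)
Lemma dual_step_le (al f psi : R -> R) h m k' :
  (forall x, 0 <= al x <= 4^-1) -> 0 <= m ->
  (forall x, al x * lap h psi x <= k' * psi x) ->
  (forall x, `|f x| <= m * psi x) ->
  forall x, `|f x + al x * lap h f x| <= m * (1 + k') * psi x.
Proof.
move=> al4 m0 alpsi fpsi x.
have /andP[a0 a4] := al4 x.
have := alpsi x; rewrite /lap => ap.
have f1 := fpsi x; have f2 := fpsi (x + h); have f3 := fpsi (x - h).
have -> : f x + al x * (f (x + h) + f (x - h) - 2 * f x) =
  (1 - 2 * al x) * f x + (al x * f (x + h) + al x * f (x - h)) by ring.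
apply: (@le_trans _ _ ((1 - 2 * al x) * (m * psi x) +
   (al x * (m * psi (x + h)) + al x * (m * psi (x - h))))).
  rewrite (le_trans (ler_normD _ _))// lerD//.
    by rewrite normrM ger0_norm ?ler_wpM2l//; lra.
  by rewrite (le_trans (ler_normD _ _))// lerD// normrM (ger0_norm a0) ler_wpM2l.
have := ler_wpM2l m0 ap; lra.
Qed.

(** The hat is concave, hence an exact supersolution, and its bound does not grow from step to step.
    Outside the window [al] vanishes and nothing changes. *)
Lemma dual_step_hat (al f : R -> R) h J c :
  0 < h -> 0 <= c ->
  (forall x, 0 <= al x <= 4^-1) -> vanish_off J al ->
  (forall x, `|x| <= J + h -> `|f x| <= c * (J + h - `|x|)) ->
  forall x, `|x| <= J + h -> `|f x + al x * lap h f x| <= c * (J + h - `|x|).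
Proof.
move=> h0 c0 al4 aloff fc x xJ.
case: (boolP (-J <= x < J)) => [/andP[x1 x2]|xo]; last first.
  by rewrite aloff// mul0r addr0 fc.
have /andP[a0 a4] := al4 x; rewrite /lap.
have f1 := fc x xJ.
have xJ' : `|x| <= J by rewrite ler_norml x1 ltW.
have f2 : `|f (x + h)| <= c * (J + h - `|x + h|).
  by apply: fc; rewrite (le_trans (ler_normD _ _))// (gtr0_norm h0) lerD2r.
have f3 : `|f (x - h)| <= c * (J + h - `|x - h|).
  by apply: fc; rewrite (le_trans (ler_normB _ _))// (gtr0_norm h0) lerD2r.
have tri : 2 * `|x| <= `|x + h| + `|x - h|.
  rewrite -[X in X * `|x|]gtr0_norm// -normrM.
  rewrite (_ : 2 * x = (x + h) + (x - h)); [exact: ler_normD|ring].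
have -> : f x + al x * (f (x + h) + f (x - h) - 2 * f x) =
  (1 - 2 * al x) * f x + (al x * f (x + h) + al x * f (x - h)) by ring.
apply: (@le_trans _ _ ((1 - 2 * al x) * (c * (J + h - `|x|)) +
   (al x * (c * (J + h - `|x + h|)) + al x * (c * (J + h - `|x - h|))))).
  rewrite (le_trans (ler_normD _ _))// lerD//.
    by rewrite normrM ger0_norm ?ler_wpM2l//; lra.
  by rewrite (le_trans (ler_normD _ _))// lerD// normrM (ger0_norm a0) ler_wpM2l.
have := ler_wpM2l (mulr_ge0 a0 c0) tri; lra.
Qed.

(** At a point off the window only a neighbour inside it can contribute, and that neighbour is
    within [h] of an end, where the hat is at most [2 * h * c]. *)
Lemma lap_exterior (f : R -> R) h J c : 0 < h -> h <= J -> 0 <= c ->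
  vanish_off J f ->
  (forall x, `|x| <= J + h -> `|f x| <= c * (J + h - `|x|)) ->
  forall x, ~~ (- J <= x < J) ->
  `|lap h f x| <= 2 * h * c * (seg (- J - h) (- J) x + seg J (J + h) x).
Proof.
move=> h0 hJ c0 foff fc x xo.
rewrite /lap (foff x xo) mulr0 subr0.
have s0 (a b y : R) : 0 <= 2 * h * c * seg a b y.
  by apply: mulr_ge0; [apply: mulr_ge0 => //; lra|exact: seg_ge0].
move: xo; rewrite negb_and -ltNge -leNgt => /orP[xJ|xJ].
  rewrite [X in _ + X]foff ?addr0; last by rewrite negb_and -ltNge; apply/orP; left; lra.
  case: (ltP x (- J - h)) => xJh.
    rewrite foff ?normr0; last by rewrite negb_and -ltNge; apply/orP; left; lra.
    by rewrite mulrDr addr_ge0.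
  rewrite (_ : seg (- J - h) (- J) x = 1); last by rewrite /seg xJh xJ.
  rewrite mulrDr -[leLHS]addr0 lerD// mulr1.
  have n1 : `|x + h| <= J by rewrite ler_norml; apply/andP; split; lra.
  apply: le_trans (fc _ _) _; first lra.
  rewrite mulrC; apply: ler_wpM2r => //.
  have : J - h <= `|x + h| by rewrite ler_normr; apply/orP; right; lra.
  lra.
rewrite [X in X + _]foff ?add0r; last by rewrite negb_and -leNgt; apply/orP; right; lra.
case: (ltP x (J + h)) => xJh; last first.
  rewrite foff ?normr0; last by rewrite negb_and -leNgt; apply/orP; right; lra.
  by rewrite mulrDr addr_ge0.
rewrite (_ : seg J (J + h) x = 1); last by rewrite /seg xJh xJ.
rewrite mulrDr -[leLHS]add0r lerD// mulr1.
have n1 : `|x - h| <= J by rewrite ler_norml; apply/andP; split; lra.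
apply: le_trans (fc _ _) _; first lra.
rewrite mulrC; apply: ler_wpM2r => //.
have : J - h <= `|x - h| by rewrite ler_normr; apply/orP; left; lra.
lra.
Qed.

(* One explicit Euler step of the dual equation turns a pairing at time [N + 1] into
   one at time [N]; the energy lost in the step pays for the consistency error. *)
Lemma discrete_duality (h J gb kap k' : R) (psi : R -> R)
    (W G F E al : nat -> R -> R) :
  0 < h -> h <= J -> 0 <= kap -> 0 <= k' -> 0 <= gb ->
  bmf psi -> (forall x, 0 <= psi x) ->
  (forall j, [/\ bmf (W j), bmf (G j), bmf (F j), bmf (E j) & bmf (al j)]) ->
  (forall x, W 0%N x = 0) ->
  (forall j x, W j.+1 x = W j x + lap h (G j) x - F j x) ->
  (forall j x, 0 <= al j x <= 4^-1) -> (forall j, vanish_off J (al j)) ->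
  (forall j x y, - J <= x < J ->
     `|G j x - al j x * W j x| * `|y| <= E j x + kap * (al j x * y ^+ 2)) ->
  (forall j x, `|G j x| <= gb) ->
  (forall j x, al j x * lap h psi x <= k' * psi x) ->
  forall N f m c, 0 <= m -> 0 <= c -> bmf f -> vanish_off J f ->
  (forall x, `|f x| <= m * psi x) ->
  (forall x, `|x| <= J + h -> `|f x| <= c * (J + h - `|x|)) ->
  `|I (fun x => W N x * f x)| <= kap * energy h f +
    \sum_(j < N) (I (fun x => seg (-J) J x * E j x) + 4 * h ^+ 2 * gb * c
      + m * (1 + k') ^+ N * I (fun x => seg (-J) J x * (`|F j x| * psi x))).
Proof.
move=> h0 hJ kap0 k0 gb0 bpsi psi0 bnd W0 WS al4 aloff young Gb alpsi.
elim=> [|N IH] f m c m0 c0 bf foff fpsi fc.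
  rewrite big_ord0 addr0 (_ : I _ = 0) ?normr0.
    by rewrite mulr_ge0// /energy Int_ge0// => x; exact: sqr_ge0.
  by rewrite -(Int0 mu); apply: eq_Int => x; rewrite W0 mul0r.
have [bW bG bF bE bal] := bnd N.
have bl := bmf_lap h bf; have il := itg_lap h bf foff; have itf := itg_vanish bf foff.
pose f' x := f x + al N x * lap h f x.
have bf' : bmf f' by apply: bmfD => //; exact: bmfM.
have foff' : vanish_off J f' by move=> x xo; rewrite /f' foff// aloff// mul0r addr0.
have fpsi' := dual_step_le (al4 N) m0 (alpsi N) fpsi.
have fc' := dual_step_hat h0 c0 (al4 N) (@aloff N) fc.
have m0' : 0 <= m * (1 + k') by apply: mulr_ge0 => //; lra.
have {IH} := IH f' (m * (1 + k')) c m0' c0 bf' foff' fpsi' fc'.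
have estep := energy_step h bf foff bal (al4 N).
have itf' := itg_vanish bf' foff'.
(* Inside the window [D] is the consistency error, handled by [young]; outside, [al] vanishes and
   [D] is the full flux [G], handled by the hat barrier. *)
pose D x := G N x - al N x * W N x.
have bD : bmf D by apply: bmfB => //; exact: bmfM.
have -> : I (fun x => W N.+1 x * f x) = I (fun x => W N x * f' x) +
    (I (fun x => D x * lap h f x) - I (fun x => F N x * f x)).
  have i1 : itg mu (fun x => W N x * f' x) by exact: itgMl.
  have i2 : itg mu (fun x => D x * lap h f x) by exact: itgMl.
  have i3 : itg mu (fun x => F N x * f x) by exact: itgMl.
  have i4 : itg mu (fun x => lap h (G N) x * f x).
    by apply: itgMl => //; exact: bmf_lap.
  have i5 : itg mu (fun x => W N x * f x) by exact: itgMl.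
  have i6 : itg mu (fun x => G N x * lap h f x) by exact: itgMl.
  rewrite -IntB// -IntD//; last exact: itgB.
  transitivity (I (fun x => (W N x * f x - F N x * f x) + lap h (G N) x * f x)).
    by apply: eq_Int => x; rewrite WS; ring.
  rewrite [LHS]IntD//; last exact: itgB.
  have -> : I (fun x => lap h (G N) x * f x) = I (fun x => G N x * lap h f x).
    exact: Int_lap_sym bG bf foff.
  rewrite -IntD//; last exact: itgB.
  by apply: eq_Int => x; rewrite /D /f'; ring.
have ifa : itg mu (fun x => `|F N x * f x|) by apply/itg_abs/itgMl.
have iDa : itg mu (fun x => `|D x * lap h f x|) by apply/itg_abs/itgMl.
have iE : itg mu (fun x => seg (-J) J x * E N x) by exact: itg_seg_bmf.
have iF : itg mu (fun x => seg (-J) J x * (`|F N x| * psi x)).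
  by apply: itg_seg_bmf; apply: bmfM => //; exact: bmf_abs.
have FB : `|I (fun x => F N x * f x)| <=
    m * I (fun x => seg (-J) J x * (`|F N x| * psi x)).
  rewrite (le_trans (Int_abs (itgMl itf bF)))// -IntZ//.
  apply: ler_Int => //; first exact: itgZ.
  move=> x; rewrite -(vanish_off_seg x foff) !normrM (ger0_norm (seg_ge0 _ _ _)).
  have := ler_wpM2l (mulr_ge0 (seg_ge0 (-J) J x) (normr_ge0 (F N x))) (fpsi x).
  lra.
have ial : itg mu (fun x => al N x * lap h f x ^+ 2).
  by apply: eq_itg (itgM (itgMl il bal) bl) => x; rewrite expr2 mulrA.
(* The only places off the window where [lap h f] can be nonzero: two cells of total length [2 * h].
   With the bound [2 * h * c] they account for [4 * h ^+ 2 * gb * c]. *)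
pose sg x := seg (- J - h) (- J) x + seg J (J + h) x.
have isg : itg mu sg by apply: itgD; exact: itg_seg.
have Isg : I sg = 2 * h by rewrite IntD ?Int_seg; [ring|lra..|exact: itg_seg|exact: itg_seg].
have DB : `|I (fun x => D x * lap h f x)| <= I (fun x => seg (-J) J x * E N x)
   + kap * I (fun x => al N x * lap h f x ^+ 2) + 4 * h ^+ 2 * gb * c.
  rewrite (le_trans (Int_abs (itgMl il bD)))//.
  rewrite (_ : 4 * h ^+ 2 * gb * c = gb * (2 * h * c) * I sg); last by rewrite Isg; ring.
  rewrite -!IntZ// -!IntD//; try exact: itgZ; last by apply: itgD => //; exact: itgZ.
  apply: ler_Int => //; first by do ?[exact: itgZ|apply: itgD|by []].
  move=> x; rewrite normrM; case: (boolP (- J <= x < J)) => xJ.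
    rewrite (_ : seg (-J) J x = 1); last by rewrite /seg xJ.
    rewrite mul1r (le_trans (young N x (lap h f x) xJ))// lerDl.
    apply: mulr_ge0; last by apply: addr_ge0; exact: seg_ge0.
    by apply: mulr_ge0 => //; apply: mulr_ge0 => //; lra.
  rewrite (_ : seg (-J) J x = 0); last by rewrite /seg (negbTE xJ).
  rewrite /D (aloff N x xJ) !mul0r mulr0 !add0r subr0 -mulrA.
  by apply: ler_pM => //; exact: lap_exterior.
have -> : m * (1 + k') * (1 + k') ^+ N = m * (1 + k') ^+ N.+1 by rewrite exprS mulrA.
move=> IH; rewrite big_ord_recr /=.
(* The source of the present step carries only the factor [m]; it is enlarged so that all terms of
   the sum share one factor. *)
have p1 : 1 <= (1 + k') ^+ N.+1 by apply: exprn_ege1; lra.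
have F0 : 0 <= I (fun x => seg (-J) J x * (`|F N x| * psi x)).
  by apply: Int_ge0 => x; rewrite !mulr_ge0 ?seg_ge0.
have FB' : `|I (fun x => F N x * f x)| <= m * (1 + k') ^+ N.+1 *
   I (fun x => seg (-J) J x * (`|F N x| * psi x)).
  by apply: (le_trans FB); apply: ler_wpM2r => //; rewrite ler_peMr.
(* The dissipation released by the energy estimate cancels the [kap] term of [DB]. *)
have ke := ler_wpM2l kap0 estep.
rewrite (le_trans (ler_normD _ _))//.
apply: le_trans (lerD IH (le_trans (ler_normB _ _) (lerD DB FB'))) _.
by rewrite -/f' in ke *; lra.
Qed.

End Discrete2.

(** * Smoothing by spline kernels *)

Section Kernels.
Context (R : realType).
Local Notation mu := (@lebesgue_measure R).
Local Notation I := (Int (@lebesgue_measure R)).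
Implicit Types (g kp : R -> R) (h x y M J : R).

(** The last clause is the partition of unity by integer translates, checked on one period; four
    translates suffice because of the support. It encodes the unit integral in a form that is
    elementary to verify for splines. *)
Definition is_kernel kp := [/\ measurable_fun setT kp,
  forall z, 0 <= kp z <= 1, forall z, 2 <= `|z| -> kp z = 0 &
  forall z, -1 <= z <= 0 -> kp (z - 1) + kp z + kp (z + 1) + kp (z + 2) = 1].

Definition mollify kp (h : R) g (x : R) : R :=
  I (fun y => h^-1 * kp ((x - y) / h) * g y).

Lemma measurable_kernel kp h x : is_kernel kp ->
  measurable_fun setT (fun y : R => h^-1 * kp ((x - y) / h)).
Proof.
move=> [mk _ _ _]; apply: measurable_funM => //.
apply: (measurableT_comp mk); apply: measurable_funM => //.
exact: measurable_funB.
Qed.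

Lemma kernel_le kp h x y : is_kernel kp -> 0 < h ->
  0 <= h^-1 * kp ((x - y) / h) <= h^-1 * seg (x - 2 * h) (x + 2 * h) y.
Proof.
move=> [_ k01 koff _] h0; have /andP[k0 k1] := k01 ((x - y) / h).
have hi : 0 <= h^-1 by rewrite invr_ge0 ltW.
rewrite mulr_ge0//= ler_wpM2l//.
rewrite /seg; case: (boolP (_ && _)) => // xy.
rewrite koff// normrM (ger0_norm hi) ler_pdivlMr//.
move: xy; rewrite negb_and -ltNge -leNgt ler_normr => /orP[xy|xy]; apply/orP.
  by left; lra.
by right; lra.
Qed.

Lemma bmf_kernel kp h x : is_kernel kp -> 0 < h ->
  bmf (fun y : R => h^-1 * kp ((x - y) / h)).
Proof.
move=> kk h0; split; first exact: measurable_kernel.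
exists h^-1 => y; have /andP[k0 k1] := kernel_le x y kk h0.
rewrite ger0_norm// (le_trans k1)// ler_piMr ?seg_le1//.
by rewrite invr_ge0 ltW.
Qed.

Lemma itg_kernel kp h x : is_kernel kp -> 0 < h ->
  itg mu (fun y : R => h^-1 * kp ((x - y) / h)).
Proof.
move=> kk h0.
apply: itg_le (itgZ h^-1 (itg_seg (x - 2 * h) (x + 2 * h))).
  exact: measurable_kernel.
by move=> y; have /andP[k0 k1] := kernel_le x y kk h0; rewrite ger0_norm.
Qed.

(** The support is cut into four cells of length [h], all translated onto [[x, x + h)], where the
    partition of unity applies at [(x - y) / h], a point of [[-1, 0]]. *)
Lemma Int_kernel kp h x : is_kernel kp -> 0 < h ->
  I (fun y : R => h^-1 * kp ((x - y) / h)) = 1.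
Proof.
move=> kk h0; pose k y := h^-1 * kp ((x - y) / h).
have bk : bmf k by exact: bmf_kernel.
have s (a : R) : I (fun y => seg (x + a) (x + a + h) y * k y)
    = I (fun y => seg x (x + h) y * k (y + a)).
  rewrite -(@Int_shift _ (fun y => seg (x + a) (x + a + h) y * k y) a); last first.
    by apply: measurable_funM; [exact: measurable_seg|exact: bk.1].
  by apply: eq_Int => y; rewrite /seg lerD2r addrAC ltrD2r.
have bks (a : R) : bmf (fun y : R => k (y + a)) by exact: bmf_shift.
have i (a b : R) : itg mu (fun y => seg a b y * k y) by exact: itg_seg_bmf.
have j (a : R) : itg mu (fun y => seg x (x + h) y * k (y + a)) by exact: itg_seg_bmf.
transitivity (I (fun y => seg (x + - (2 * h)) (x + - (2 * h) + h) y * k y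
  + seg (x + - h) (x + - h + h) y * k y
  + seg (x + 0) (x + 0 + h) y * k y + seg (x + h) (x + h + h) y * k y)).
  apply: eq_Int => y; rewrite -!mulrDl.
  rewrite (_ : x + - (2 * h) + h = x - h); last ring.
  rewrite (_ : x + - h + h = x + 0); last ring.
  rewrite addr0 -!seg_split; [|lra..].
  rewrite -/(k y); have /andP[k0 k1] := kernel_le x y kk h0.
  rewrite /seg; case: (boolP (_ && _)) => yx; first by rewrite mul1r.
  apply/eqP; rewrite mul0r eq_le k0 andbT (le_trans k1)//.
  rewrite /seg (_ : (_ && _) = false) ?mulr0//.
  by apply/negbTE; apply: contraNN yx => /andP[? ?]; apply/andP; split; lra.
rewrite !IntD//; [|by do ?apply: itgD..].
rewrite !s -!IntD//; [|by do ?apply: itgD..].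
transitivity (I (fun y => h^-1 * seg x (x + h) y)).
  apply: eq_Int => y; rewrite -!mulrDr [RHS]mulrC.
  rewrite /seg; case: (boolP (_ && _)) => [/andP[y1 y2]|_]; last by rewrite !mul0r.
  rewrite !mul1r /k; case: kk => _ _ _ ksum.
  rewrite -[RHS]mulr1; congr (_ * _).
  rewrite -[RHS](ksum ((x - y) / h)); last first.
    rewrite ler_pdivlMr// ler_pdivrMr//; apply/andP; split; lra.
  rewrite (_ : (x - (y - 2 * h)) / h = (x - y) / h + 2); last by field; lra.
  rewrite (_ : (x - (y - h)) / h = (x - y) / h + 1); last by field; lra.
  rewrite (_ : (x - (y + 0)) / h = (x - y) / h); last by rewrite addr0.
  rewrite (_ : (x - (y + h)) / h = (x - y) / h - 1); last by field; lra.
  ring.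
rewrite IntZ ?Int_seg; [|lra|exact: itg_seg].
by rewrite addrC addKr mulVf// gt_eqF.
Qed.

Lemma mollify_bound kp h g M x : is_kernel kp -> 0 < h ->
  measurable_fun setT g -> (forall y, `|g y| <= M) -> `|mollify kp h g x| <= M.
Proof.
move=> kk h0 mg gM; have ik := itg_kernel x kk h0.
have bg : bmf g by split => //; exists M.
rewrite (le_trans (Int_abs (itgM ik bg)))//.
rewrite -[leRHS]mulr1 -(Int_kernel x kk h0) -IntZ//.
apply: ler_Int; [exact/itg_abs/itgM|exact: itgZ|] => y.
have /andP[k0 _] := kernel_le x y kk h0.
by rewrite normrM (ger0_norm k0) mulrC ler_wpM2r.
Qed.

Lemma bmf_mollify2 d (T : measurableType d) kp h (g : R * T -> R) :
  is_kernel kp -> 0 < h -> bmf g ->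
  bmf (fun z : R * T => mollify kp h (fun y => g (y, z.2)) z.1).
Proof.
move=> kk h0 [mg [M gM]]; split; last first.
  exists M => z; apply: mollify_bound => //.
  exact: (measurableT_comp mg (pair2_measurable z.2)).
have [mk _ _ _] := kk.
apply: (@measurable_Int1 _ _ _ _ _ mu
  (fun p : (R * T) * R => h^-1 * kp ((p.1.1 - p.2) / h) * g (p.2, p.1.2))).
apply: measurable_funM.
  apply: measurable_funM => //.
  apply: (measurableT_comp mk); apply: measurable_funM => //.
  apply: measurable_funB => //.
  by apply: (measurableT_comp measurable_fst); exact: measurable_fst.
apply: (measurableT_comp mg); apply: measurable_fun_pair => //.
by apply: (measurableT_comp measurable_snd); exact: measurable_fst.
Qed.

Lemma bmf_mollify kp h g : is_kernel kp -> 0 < h -> bmf g -> bmf (mollify kp h g).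
Proof.
move=> kk h0 bg.
have b2 : bmf (fun z : R * R => g z.1) by apply: bmf_comp => //; exact: measurable_fst.
have := bmf_mollify2 kk h0 b2.
move=> /(fun b => bmf_comp b (pair2_measurable (0 : R))).
exact.
Qed.

Lemma bmf_locally_integrable g : bmf g -> locally_integrable setT g.
Proof.
move=> [mg [M gM]]; split => //; first exact: openT.
move=> K _ cK.
have mK : measurable K by exact: compact_measurable.
apply: (@le_lt_trans _ _ (\int[mu]_(x in K) M%:E)%E).
  apply: ge0_le_integral => //=.
  - by apply/measurable_EFinP; apply: measurableT_comp => //; exact: measurable_funTS.
  - by move=> x _; rewrite lee_fin.
rewrite integral_cst//= lte_mul_pinfty//.
  by rewrite lee_fin (le_trans _ (gM 0)).
exact: compact_finite_measure.
Qed.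

(** True at every Lebesgue point: the kernel is at most [h^-1] and lives on a ball of radius [2 * h]
    and measure [4 * h], so the error is at most four times the mean deviation from [g x]. *)
Lemma mollify_cvg kp g : is_kernel kp -> bmf g ->
  {ae mu, forall x, mollify kp n.+1%:R^-1 g x @[n --> \oo] --> g x}.
Proof.
move=> kk bg; have L := lebesgue_differentiation (bmf_locally_integrable bg).
apply: (ae_imp _ L) => x gx {L}.
have n0 n : 0 < n.+1%:R^-1 :> R by rewrite invr_gt0.
have h2 : davg g x (2 * n.+1%:R^-1) @[n --> \oo] --> 0%E.
  move/cvge_at_rightP: gx; apply; split=> [n|]; first by rewrite mulr_gt0.
  rewrite -[X in _ --> X](mulr0 (2 : R)); apply: cvgMr.
  exact: cvg_harmonic.
have bnd n : (`|mollify kp n.+1%:R^-1 g x - g x|%:E <= 4%:E * davg g x (2 * n.+1%:R^-1))%E.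
  set r := n.+1%:R^-1; have r0 : 0 < r by exact: n0.
  pose k y := r^-1 * kp ((x - y) / r).
  have ik : itg mu k by exact: itg_kernel.
  have bgx : bmf (fun y => g y - g x) by apply: bmfB => //; exact: bmf_cst.
  have -> : mollify kp r g x - g x = I (fun y => k y * (g y - g x)).
    rewrite -[X in _ - X]mulr1 -(Int_kernel x kk r0) -IntZ// -IntB.
    + by apply: eq_Int => y; rewrite /k; ring.
    + exact: itgM.
    + exact: itgZ.
  apply: (@le_trans _ _ (\int[mu]_(y in ball x (2 * r)) (r^-1 * `|g y - g x|)%:E)%E).
    rewrite (le_trans (y := (I (fun y => `|k y * (g y - g x)|))%:E))//.
      by rewrite lee_fin; apply: Int_abs; exact: itgM.
    rewrite EFin_Int; last by apply: itg_abs; exact: itgM.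
    rewrite [leRHS]integral_mkcond; apply: ge0_le_integral => //.
    - apply/measurable_EFinP; apply: (itg_meas (mu := mu)); apply: itg_abs; exact: itgM.
    - apply/(measurable_restrictT _ _).1; first exact: measurable_ball.
      apply: measurable_funTS; apply/measurable_EFinP; apply: measurable_funM => //.
      by apply: measurableT_comp => //; exact: bgx.1.
    - move=> y _; have /andP[k0 k1] := kernel_le x y kk r0.
      rewrite patchE; case: ifPn => yb.
        rewrite lee_fin normrM (ger0_norm k0) ler_wpM2r// (le_trans k1)//.
        by rewrite ler_piMr ?seg_le1 ?invr_ge0 ?ltW.
      rewrite (_ : k y = 0) ?mul0r ?normr0//.
      rewrite /k; case: kk => _ _ koff _; rewrite koff ?mulr0//.
      rewrite normrM (gtr0_norm (x := r^-1)) ?invr_gt0// ler_pdivlMr//.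
      by rewrite leNgt; apply: contra yb => xy; rewrite inE.
  rewrite /davg /iavg lebesgue_measure_ball; last by rewrite mulr_ge0 ?ltW.
  rewrite inver mulrn_eq0/= gt_eqF ?mulr_gt0//.
  under eq_integral do rewrite EFinM.
  rewrite ge0_integralZl//.
  - rewrite muleA -EFinM (_ : 4 * _ = r^-1)//.
    by field; lra.
  - exact: measurable_ball.
  - apply: measurable_funTS; apply/measurable_EFinP.
    by apply: measurableT_comp => //; exact: bgx.1.
  - by rewrite lee_fin invr_ge0 ltW.
have h3 : (`|mollify kp n.+1%:R^-1 g x - g x|%:E) @[n --> \oo] --> 0%E.
  apply: (@squeeze_cvge _ _ _ _ (cst 0%E) _
    (fun n => 4%:E * davg g x (2 * n.+1%:R^-1))%E).
  - by apply: nearW => n; rewrite bnd andbT lee_fin.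
  - exact: cvg_cst.
  - by rewrite -(mule0 4%:E); apply: cvgeZl.
move/fine_cvg: h3 => h3.
apply/cvgrPdist_le => e e0; move/cvgr0Pnorm_le: h3 => /(_ _ e0).
by apply: filterS => n /=; rewrite normr_id distrC.
Qed.

Lemma mollify_cvg_L1 kp g J : is_kernel kp -> bmf g ->
  I (fun x => seg (-J) J x * `|mollify kp n.+1%:R^-1 g x - g x|) @[n --> \oo] --> 0.
Proof.
move=> kk bg; have [mg [M gM]] := bg.
have n0 n : 0 < n.+1%:R^-1 :> R by rewrite invr_gt0.
have bc n : bmf (mollify kp n.+1%:R^-1 g) by exact: bmf_mollify.
rewrite -[X in _ --> X](Int0 mu).
apply: (@Int_cvg _ (measurableTypeR R) R mu _ _ (fun x : R => 2 * M * seg (-J) J x)).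
- move=> n; apply: measurable_funM; first exact: measurable_seg.
  by apply: measurableT_comp => //; exact: (bmfB (bc n) bg).1.
- by apply: itgZ; exact: itg_seg.
- move=> n x; rewrite normrM normr_id (ger0_norm (seg_ge0 _ _ _)) mulrC.
  apply: ler_wpM2r; first exact: seg_ge0.
  rewrite (le_trans (ler_normB _ _))// mulr2n mulrDl mul1r lerD//.
  exact: mollify_bound.
- exact: measurable_cst.
- apply: ae_imp (mollify_cvg kk bg) => x cx.
  rewrite -[X in _ --> X](mulr0 (seg (-J) J x)); apply: cvgMr.
  apply/cvgr0Pnorm_le => e e0; move/cvgrPdist_le: cx => /(_ _ e0).
  by apply: filterS => n; rewrite normr_id distrC.
Qed.

Lemma mollify_cvg_L1_2 kp (g : R * R -> R) J tau : is_kernel kp -> bmf g ->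
  I (fun t => seg 0 tau t * I (fun x => seg (-J) J x *
    `|mollify kp n.+1%:R^-1 (fun y => g (y, t)) x - g (x, t)|)) @[n --> \oo] --> 0.
Proof.
move=> kk bg; have [mg [M gM]] := bg.
have n0 n : 0 < n.+1%:R^-1 :> R by rewrite invr_gt0.
have bgt t : bmf (fun y => g (y, t)).
  by apply: (bmf_comp bg); exact: pair2_measurable.
have bc n : bmf (fun z => mollify kp n.+1%:R^-1 (fun y => g (y, z.2)) z.1).
  exact: bmf_mollify2.
have bd n : bmf (fun z => seg (-J) J z.1 *
    `|mollify kp n.+1%:R^-1 (fun y => g (y, z.2)) z.1 - g z|).
  apply: bmfM; last by apply: bmf_abs; exact: bmfB.
  by apply: bmf_comp; [exact: bmf_seg|exact: measurable_fst].
have dB n x t : `|seg (-J) J x * `|mollify kp n.+1%:R^-1 (fun y => g (y, t)) x - g (x, t)| |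
    <= 2 * M * seg (-J) J x.
  rewrite normrM normr_id (ger0_norm (seg_ge0 _ _ _)) mulrC.
  apply: ler_wpM2r; first exact: seg_ge0.
  rewrite (le_trans (ler_normB _ _))// mulr2n mulrDl mul1r lerD//.
  by apply: mollify_bound => //; exact: (bgt t).1.
have iS : itg mu (fun x => 2 * M * seg (-J) J x) by apply: itgZ; exact: itg_seg.
rewrite -[X in _ --> X](Int0 mu).
apply: (@Int_cvg _ (measurableTypeR R) R mu _ _
  (fun t => seg 0 tau t * I (fun x => 2 * M * seg (-J) J x))).
- move=> n; apply: measurable_funM; first exact: measurable_seg.
  exact: (@measurable_Int2 _ _ _ _ _ mu _ (bd n).1).
- by apply: itg_seg_bmf; exact: bmf_cst.
- move=> n t; rewrite normrM (ger0_norm (seg_ge0 _ _ _)).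
  apply: ler_wpM2l; first exact: seg_ge0.
  have id : itg mu (fun x => seg (-J) J x *
      `|mollify kp n.+1%:R^-1 (fun y => g (y, t)) x - g (x, t)|).
    apply: (itg_le _ _ iS); last by move=> x; exact: dB.
    exact: (measurableT_comp (bd n).1 (pair2_measurable t)).
  rewrite (le_trans (Int_abs id))//; apply: ler_Int => //; first exact: itg_abs.
- exact: measurable_cst.
- apply: nearW => t.
  rewrite -[X in _ --> X](mulr0 (seg 0 tau t)); apply: cvgMr.
  exact: mollify_cvg_L1.
Qed.

End Kernels.

(** * Truncated powers and B-splines *)

Section Splines.
Context (R : realType).
Implicit Types (x y z h : R).

(** A quadratic remainder bound treats knots and smooth points of truncated powers alike, so
    derivatives reduce to polynomial inequalities in each sign case. *)
Lemma is_derive_quad (f : R -> R) x (d C : R) :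
  (forall h, `|h| <= 1 -> `|f (x + h) - f x - h * d| <= C * h ^+ 2) ->
  is_derive x 1 f d.
Proof.
move=> H.
have C0 : 0 <= C.
  by have := H 1; rewrite normr1 => /(_ (lexx _)); rewrite expr1n mulr1; apply: le_trans.
have cv : h^-1 *: (f (h *: 1 + x) - f x) @[h --> 0^'] --> d.
  apply/cvgrPdist_le => e e0.
  near=> h.
  have h0 : h != 0 by near: h; exact: nbhs_dnbhs_neq.
  have h1 : `|h| <= 1 by near: h; apply: dnbhs0_le.
  have h2 : `|h| <= e / (C + 1) by near: h; apply: dnbhs0_le; rewrite divr_gt0// ltr_wpDl.
  rewrite /GRing.scale /= mulr1 (addrC h) distrC.
  have -> : h^-1 * (f (x + h) - f x) - d = h^-1 * (f (x + h) - f x - h * d) by field.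
  rewrite normrM normfV ler_pdivrMl ?normr_gt0//.
  rewrite (le_trans (H h h1))// -real_normK ?num_real// expr2 mulrCA ler_wpM2l//.
  rewrite (le_trans (ler_wpM2l C0 h2))// mulrCA ler_piMr ?(ltW e0)//.
  by rewrite ler_pdivrMr ?mul1r ?lerDl// ltr_wpDl.
by split; [apply/cvg_ex; exists d|exact: cvg_lim].
Unshelve. all: by end_near. Qed.

Definition pos x : R := Num.max x 0.

Lemma pos_ge x : 0 <= x -> pos x = x.
Proof. by move=> x0; rewrite /pos; apply/max_idPl. Qed.

Lemma pos_le x : x <= 0 -> pos x = 0.
Proof. by move=> x0; rewrite /pos; apply/max_idPr. Qed.

(** [tent] and [cub] are the linear and the cubic B-spline, written as differences of truncated
    powers (second difference of [pos], fourth difference of [pos ^+ 3 / 3!]), so that they can be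
    differentiated term by term. *)
Definition tent z := pos (z + 1) - 2 * pos z + pos (z - 1).

Definition cub z := (pos (z + 2) ^+ 3 - 4 * pos (z + 1) ^+ 3 + 6 * pos z ^+ 3
  - 4 * pos (z - 1) ^+ 3 + pos (z - 2) ^+ 3) / 6.

Definition cub1 z := (pos (z + 2) ^+ 2 - 4 * pos (z + 1) ^+ 2 + 6 * pos z ^+ 2
  - 4 * pos (z - 1) ^+ 2 + pos (z - 2) ^+ 2) / 2.

Lemma is_derive_pos2 x : is_derive x 1 (fun y => pos y ^+ 2) (2 * pos x).
Proof.
apply: (@is_derive_quad _ _ _ 1) => h _.
rewrite ler_norml; case: (leP 0 x) => x0; case: (leP 0 (x + h)) => xh.
- by rewrite !pos_ge//; nra.
- by rewrite (pos_ge x0) (pos_le (ltW xh)); nra.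
- by rewrite (pos_ge xh) (pos_le (ltW x0)); nra.
- by rewrite (pos_le (ltW xh)) (pos_le (ltW x0)); nra.
Qed.

Lemma is_derive_pos3 x : is_derive x 1 (fun y => pos y ^+ 3) (3 * pos x ^+ 2).
Proof.
apply: (@is_derive_quad _ _ _ (3 * `|x| + 1)) => h; rewrite ler_norml => /andP[h1 h2].
have hh1 : 0 <= h ^+ 2 * (h + 1) by rewrite mulr_ge0 ?sqr_ge0//; lra.
have hh2 : 0 <= h ^+ 2 * (1 - h) by rewrite mulr_ge0 ?sqr_ge0//; lra.
rewrite ler_norml; case: (leP 0 x) => x0; case: (leP 0 (x + h)) => xh.
- rewrite !pos_ge// ger0_norm//.
  have -> : (x + h) ^+ 3 - x ^+ 3 - h * (3 * x ^+ 2) = h ^+ 2 * (3 * x + h) by ring.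
  have := mulr_ge0 (sqr_ge0 h) x0; nra.
- rewrite (pos_ge x0) (pos_le (ltW xh)) ger0_norm// expr0n/=.
  have -> : 0 - x ^+ 3 - h * (3 * x ^+ 2) = x ^+ 2 * (- x - 3 * h) by ring.
  have hx : x <= - h by lra.
  have nh : 0 <= - h by lra.
  have hx' : 0 <= - h - x by lra.
  have a1 := mulr_ge0 (mulr_ge0 x0 nh) hx'.
  have a2 := mulr_ge0 (sqr_ge0 x) hx'.
  have a3 := mulr_ge0 x0 (sqr_ge0 h).
  have a4 := mulr_ge0 (sqr_ge0 x) nh.
  have a5 := mulr_ge0 (sqr_ge0 x) x0.
  have a6 := sqr_ge0 h.
  by apply/andP; split; lra.
- rewrite (pos_ge xh) (pos_le (ltW x0)) !expr0n/= !mulr0 !subr0 ltr0_norm//.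
  have h0 : 0 <= h by lra.
  have nx : 0 <= - x by lra.
  have sh : 0 <= 1 - (x + h) by lra.
  have a1 := mulr_ge0 (sqr_ge0 (x + h)) sh.
  have a2 : 0 <= (- x) * (x + 2 * h) by apply: mulr_ge0 => //; lra.
  have a3 := mulr_ge0 nx (sqr_ge0 h).
  have a4 := mulr_ge0 (sqr_ge0 (x + h)) xh.
  have a5 := sqr_ge0 h.
  by apply/andP; split; lra.
- rewrite (pos_le (ltW xh)) (pos_le (ltW x0)) !expr0n/= !mulr0 !subr0.
  by have := sqr_ge0 h; have := normr_ge0 x; nra.
Qed.

Lemma is_derive_affine (f : R -> R) (x a b d : R) :
  is_derive (b * x + a) 1 f d -> is_derive x 1 (fun y => f (b * y + a)) (d * b).
Proof.
move=> fd; apply: (@is_derive1_comp _ f (fun y : R => b * y + a)) => //.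
rewrite -[X in is_derive _ _ _ X]addr0; apply: is_deriveD.
rewrite -[X in is_derive _ _ _ X]mulr1; exact: is_deriveZ.
Qed.

Lemma is_derive_mull (f : R -> R) (x a d : R) :
  is_derive x 1 f d -> is_derive x 1 (fun y => a * f y) (a * d).
Proof. by move=> fd; exact: is_deriveZ. Qed.

Lemma is_derive_addf (f g : R -> R) (x d e : R) :
  is_derive x 1 f d -> is_derive x 1 g e -> is_derive x 1 (fun y => f y + g y) (d + e).
Proof. by move=> fd ge; exact: is_deriveD. Qed.

Lemma is_derive_cub z : is_derive z 1 cub (cub1 z).
Proof.
pose P a := is_derive_affine (is_derive_pos3 (1 * z + a)).
have H := is_derive_mull (6^-1) (is_derive_addf (is_derive_addf (is_derive_addf
  (is_derive_addf (P 2) (is_derive_mull (-4) (P 1))) (is_derive_mull 6 (P 0)))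
  (is_derive_mull (-4) (P (-1)))) (P (-2))).
have -> : cub = (fun y => 6^-1 *
    (pos (1 * y + 2) ^+ 3 + -4 * pos (1 * y + 1) ^+ 3 + 6 * pos (1 * y + 0) ^+ 3
     + -4 * pos (1 * y - 1) ^+ 3 + pos (1 * y - 2) ^+ 3)).
  by apply/funext => y; rewrite /cub !mul1r addr0; ring.
by apply: (is_derive_eq H); rewrite /cub1 !mul1r addr0; field.
Qed.

Lemma is_derive_cub1 z : is_derive z 1 cub1 (lap 1 tent z).
Proof.
pose P a := is_derive_affine (is_derive_pos2 (1 * z + a)).
have H := is_derive_mull (2^-1) (is_derive_addf (is_derive_addf (is_derive_addf
  (is_derive_addf (P 2) (is_derive_mull (-4) (P 1))) (is_derive_mull 6 (P 0)))
  (is_derive_mull (-4) (P (-1)))) (P (-2))).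
have -> : cub1 = (fun y => 2^-1 *
    (pos (1 * y + 2) ^+ 2 + -4 * pos (1 * y + 1) ^+ 2 + 6 * pos (1 * y + 0) ^+ 2
     + -4 * pos (1 * y - 1) ^+ 2 + pos (1 * y - 2) ^+ 2)).
  by apply/funext => y; rewrite /cub1 !mul1r addr0; ring.
apply: (is_derive_eq H); rewrite /lap /tent !mul1r addr0.
rewrite (_ : z + 1 + 1 = z + 2); last ring.
rewrite (_ : z - 1 - 1 = z - 2); last ring.
by rewrite addrK subrK; field.
Qed.

Lemma measurable_pos (n : nat) (a : R) :
  measurable_fun setT (fun z => pos (z + a) ^+ n).
Proof.
apply: measurable_funX; apply: measurable_maxr => //.
by apply: measurable_funD.
Qed.

(** On each unit piece the bounds are combinations of products of powers of the distances to the two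
    knots, which are supplied to the solver as nonnegative facts. *)
Lemma cub_pos_quarter z : -2 <= z -> z <= 2 -> 0 <= cub z <= 1.
Proof.
move=> z2 z2'; rewrite /cub (pos_ge (x := z + 2)); last lra.
rewrite (pos_le (x := z - 2)) ?expr0n/=; last lra.
case: (leP z (-1)) => z1.
  rewrite (pos_le (x := z + 1)); last lra.
  rewrite (pos_le (x := z)); last lra.
  rewrite (pos_le (x := z - 1)) ?expr0n/=; last lra.
  rewrite !mulr0 subr0 addr0 subr0 addr0.
  have s0 : 0 <= z + 2 by lra.
  have s1 : 0 <= 1 - (z + 2) by lra.
  have a1 := exprn_ge0 3 s0.
  have a2 := mulr_ge0 (exprn_ge0 2 s0) s1.
  have a3 := mulr_ge0 s0 s1.
  by apply/andP; split; lra.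
rewrite (pos_ge (x := z + 1)); last lra.
case: (leP z 0) => z0.
  rewrite (pos_le z0) (pos_le (x := z - 1)) ?expr0n/=; last lra.
  have s0 : 0 <= z + 1 by lra.
  have s1 : 0 <= - z by lra.
  have a1 := exprn_ge0 3 s0.
  have a2 := mulr_ge0 (exprn_ge0 2 s0) s1.
  have a3 := mulr_ge0 s0 s1.
  have a4 := mulr_ge0 s0 (exprn_ge0 2 s1).
  have a5 := exprn_ge0 3 s1.
  by apply/andP; split; nra.
rewrite (pos_ge (ltW z0)).
case: (leP z 1) => z1'.
  rewrite (pos_le (x := z - 1)) ?expr0n/=; last lra.
  have s0 : 0 <= z by lra.
  have s1 : 0 <= 1 - z by lra.
  have a1 := exprn_ge0 3 s0.
  have a2 := mulr_ge0 (exprn_ge0 2 s0) s1.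
  have a3 := mulr_ge0 s0 s1.
  have a4 := mulr_ge0 s0 (exprn_ge0 2 s1).
  have a5 := exprn_ge0 3 s1.
  by apply/andP; split; nra.
rewrite (pos_ge (x := z - 1)); last lra.
have s0 : 0 <= 2 - z by lra.
have s1 : 0 <= z - 1 by lra.
have a1 := exprn_ge0 3 s0.
have a2 := mulr_ge0 (exprn_ge0 2 s0) s1.
have a3 := mulr_ge0 s0 s1.
by apply/andP; split; nra.
Qed.

Lemma cub_kernel : is_kernel cub.
Proof.
have off z : 2 <= `|z| -> cub z = 0.
  rewrite ler_normr => /orP[z2|z2]; rewrite /cub.
    by rewrite !pos_ge; [field|lra..].
  by rewrite !pos_le; [rewrite !expr0n/=; ring|lra..].
split => //.
- apply: measurable_funM => //; apply: measurable_funD; last exact: measurable_pos.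
  apply: measurable_funB; last by apply: measurable_funM => //; exact: measurable_pos.
  apply: measurable_funD; last first.
    apply: measurable_funM => //; have := measurable_pos 3 0.
    by under eq_fun do rewrite addr0.
  apply: measurable_funB; first exact: measurable_pos.
  by apply: measurable_funM => //; exact: measurable_pos.
- move=> z; case: (leP 2 `|z|) => [/off ->|]; first by rewrite lexx ler01.
  by rewrite ltr_norml => /andP[/ltW z1 /ltW z2]; exact: cub_pos_quarter.
- move=> z /andP[z1 z0]; rewrite /cub.
  rewrite (pos_ge (x := z - 1 + 2)); last lra.
  rewrite (pos_le (x := z - 1 + 1)); last lra.
  rewrite (pos_le (x := z - 1)); last lra.
  rewrite (pos_le (x := z - 1 - 1)); last lra.
  rewrite (pos_le (x := z - 1 - 2)); last lra.
  rewrite (pos_ge (x := z + 2)); last lra.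
  rewrite (pos_ge (x := z + 1)); last lra.
  rewrite (pos_le (x := z)); last lra.
  rewrite (pos_le (x := z - 2)); last lra.
  rewrite (pos_ge (x := z + 1 + 2)); last lra.
  rewrite (pos_ge (x := z + 1 + 1)); last lra.
  rewrite (pos_le (x := z + 1 - 1)); last lra.
  rewrite (pos_le (x := z + 1 - 2)); last lra.
  rewrite (pos_ge (x := z + 2 + 2)); last lra.
  rewrite (pos_ge (x := z + 2 + 1)); last lra.
  rewrite (pos_ge (x := z + 2 - 1)); last lra.
  rewrite (pos_le (x := z + 2 - 2)); last lra.
  by rewrite !expr0n/=; field.
Qed.

Lemma tent_kernel : is_kernel tent.
Proof.
have off z : 1 <= `|z| -> tent z = 0.
  rewrite ler_normr => /orP[z2|z2]; rewrite /tent.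
    by rewrite !pos_ge; [ring|lra..].
  by rewrite !pos_le; [ring|lra..].
split.
- rewrite /tent; apply: measurable_funD; last exact: (measurable_pos 1).
  apply: measurable_funB; first exact: (measurable_pos 1).
  apply: measurable_funM => //; have := measurable_pos 1 0.
  by under eq_fun do rewrite addr0 expr1.
- move=> z; case: (leP 1 `|z|) => [/off ->|]; first by rewrite lexx ler01.
  rewrite ltr_norml => /andP[z1 z2]; rewrite /tent (pos_ge (x := z + 1)); last lra.
  rewrite (pos_le (x := z - 1)); last lra.
  case: (leP z 0) => z0; first by rewrite pos_le//; apply/andP; split; lra.
  by rewrite (pos_ge (ltW z0)); apply/andP; split; lra.
- by move=> z z2; apply: off; lra.
- move=> z /andP[z1 z0]; rewrite (off (z - 1)); last by rewrite ler0_norm; lra.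
  rewrite (off (z + 2)); last by rewrite ger0_norm; lra.
  rewrite /tent (pos_ge (x := z + 1)); last lra.
  rewrite (pos_le z0) (pos_le (x := z - 1)); last lra.
  rewrite (pos_ge (x := z + 1 + 1)); last lra.
  rewrite (pos_le (x := z + 1 - 1)); last lra.
  ring.
Qed.

End Splines.

Arguments tent {R} _.
Arguments cub {R} _.
Arguments cub1 {R} _.

(** * The smoothed equation *)

Section Psi.
Context (R : realType).
Implicit Types (x y z h : R).

Definition psi x : R := (1 + x ^+ 2)^-1.

Lemma psi_gt0 x : 0 < psi x.
Proof. by rewrite invr_gt0 ltr_pwDl// sqr_ge0. Qed.

Lemma psi_le1 x : psi x <= 1.
Proof. by rewrite invf_le1 ?lerDl ?sqr_ge0// ltr_pwDl// sqr_ge0. Qed.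

Lemma measurable_psi : measurable_fun setT psi.
Proof.
apply: continuous_measurable_fun => x.
exact: (@continuous_oneDsqrV R x).
Qed.

Lemma bmf_psi : bmf psi.
Proof.
split; first exact: measurable_psi.
by exists 1 => x; rewrite ger0_norm ?psi_le1// ltW// psi_gt0.
Qed.

(** Clearing denominators reduces the claim to [6 * x^2 <= 3 * (1 + x^4)]; [h <= 1] gives the
    leftover terms the right sign. The constant 3 reappears in the growth rate [3 * (L + 1)]. *)
Lemma lap_psi h x : 0 < h -> h <= 1 -> lap h psi x <= 3 * h ^+ 2 * psi x.
Proof.
move=> h0 h1; rewrite /lap /psi.
have D0 : 0 < 1 + x ^+ 2 by rewrite ltr_pwDl// sqr_ge0.
have Dp : 0 < 1 + (x + h) ^+ 2 by rewrite ltr_pwDl// sqr_ge0.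
have Dm : 0 < 1 + (x - h) ^+ 2 by rewrite ltr_pwDl// sqr_ge0.
have -> : (1 + (x + h) ^+ 2)^-1 + (1 + (x - h) ^+ 2)^-1 - 2 * (1 + x ^+ 2)^-1 =
  (2 * h ^+ 2 * (3 * x ^+ 2 - 1 - h ^+ 2) / ((1 + (x + h) ^+ 2) * (1 + (x - h) ^+ 2)))
   / (1 + x ^+ 2).
  by field; rewrite !gt_eqF.
rewrite ler_wpM2r ?invr_ge0 ?(ltW D0)// ler_pdivrMr ?mulr_gt0//.
have hh0 : 0 <= h ^+ 2 by exact: sqr_ge0.
have hh1 : 0 <= 1 - h ^+ 2 by rewrite subr_ge0 expr_le1// ltW.
have xx0 : 0 <= x ^+ 2 by exact: sqr_ge0.
have : 2 * (3 * x ^+ 2 - 1 - h ^+ 2) <= 3 * ((1 + (x + h) ^+ 2) * (1 + (x - h) ^+ 2)).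
  have e : (1 + (x + h) ^+ 2) * (1 + (x - h) ^+ 2)
     = (1 + h ^+ 2) ^+ 2 + (x ^+ 2) ^+ 2 + 2 * (x ^+ 2 * (1 - h ^+ 2)) by ring.
  rewrite e; have p := mulr_ge0 xx0 hh1; have := sqr_ge0 (x ^+ 2 - 1).
  have := sqr_ge0 (h ^+ 2); lra.
by move/(ler_wpM2l hh0); lra.
Qed.

End Psi.

Arguments psi {R} _.

(** * The dual scheme on a fixed space mesh *)

Section Scheme.
Context (R : realType).
Local Notation mu := (@lebesgue_measure R).
Local Notation I := (Int (@lebesgue_measure R)).
Variables (T M L : R) (w a f : R * R -> R).
Hypotheses (T0 : 0 < T) (mw : measurable_fun setT w)
  (ma : measurable_fun setT a) (mf : measurable_fun setT f)
  (wM : forall z, `|w z| <= M) (aL : forall z, 0 <= a z <= L)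
  (fM : forall z, `|f z| <= M)
  (woff : forall x t, ~~ (0 <= t < T) -> w (x, t) = 0)
  (foff : forall x t, ~~ (0 <= t < T) -> f (x, t) = 0).
Implicit Types (h x t s : R).

Let M0 : 0 <= M. Proof. exact: le_trans (wM (0, 0)). Qed.
Let L0 : 0 <= L. Proof. by have /andP[+ ] := aL (0, 0); apply: le_trans. Qed.

(* Smoothings of [w], [a w] and [f]; [bb] is the right-hand side of the smoothed equation
   and [ww] its primitive in time. *)
Definition kw h x t := mollify cub h (fun y => w (y, t)) x.
Definition bp h x t := mollify tent h (fun y => a (y, t) * w (y, t)) x.
Definition kf h x t := mollify cub h (fun y => f (y, t)) x.
Definition bb h x t := h ^- 2 * lap h (fun y => bp h y t) x - kf h x t.
Definition ww h x t := I (fun s => seg 0 t s * bb h x s).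

Let bw : bmf w. Proof. by split => //; exists M. Qed.
Let bf : bmf f. Proof. by split => //; exists M. Qed.
Let ba : bmf a.
Proof.
by split => //; exists L => z; have /andP[a0 a1] := aL z; rewrite ger0_norm.
Qed.
Let baw : bmf (fun z => a z * w z). Proof. exact: bmfM. Qed.
Let awM z : `|a z * w z| <= L * M.
Proof.
by have /andP[a0 a1] := aL z; rewrite normrM (ger0_norm a0) ler_pM.
Qed.

Lemma bmf_kw h : 0 < h -> bmf (fun z => kw h z.1 z.2).
Proof. by move=> h0; apply: bmf_mollify2 => //; exact: cub_kernel. Qed.

Lemma bmf_kf h : 0 < h -> bmf (fun z => kf h z.1 z.2).
Proof. by move=> h0; apply: bmf_mollify2 => //; exact: cub_kernel. Qed.

Lemma bmf_bp h : 0 < h -> bmf (fun z => bp h z.1 z.2).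
Proof.
move=> h0; apply: (@bmf_mollify2 _ _ _ tent h (fun z => a z * w z)) => //.
exact: tent_kernel.
Qed.

Lemma bp_le h x t : 0 < h -> `|bp h x t| <= L * M.
Proof.
move=> h0; apply: mollify_bound => //; first exact: tent_kernel.
exact: (measurableT_comp baw.1 (pair2_measurable t)).
Qed.

Lemma kf_le h x t : 0 < h -> `|kf h x t| <= M.
Proof.
move=> h0; apply: mollify_bound => //; first exact: cub_kernel.
exact: (measurableT_comp mf (pair2_measurable t)).
Qed.

(** Four values of [bp], each at most [L * M], and one of [kf]. It is also the Lipschitz constant of
    [ww] in time, which explains why the time step must be refined after [h] is fixed. *)
Let cb h := h ^- 2 * (4 * (L * M)) + M.

Lemma bb_le h x t : 0 < h -> `|bb h x t| <= cb h.
Proof.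
move=> h0; rewrite (le_trans (ler_normB _ _))// lerD ?kf_le//.
rewrite normrM ger0_norm ?invr_ge0 ?sqr_ge0// ler_wpM2l ?invr_ge0 ?sqr_ge0//.
rewrite (le_trans (ler_normB _ _))//.
have := ler_normD (bp h (x + h) t) (bp h (x - h) t).
have := bp_le (x + h) t h0; have := bp_le (x - h) t h0; have := bp_le x t h0.
rewrite normrM ger0_norm//; lra.
Qed.

Lemma bmf_bb h : 0 < h -> bmf (fun z => bb h z.1 z.2).
Proof.
move=> h0; apply: bmfB; last exact: bmf_kf.
apply: bmfM; first exact: bmf_cst.
have sh (c : R) : bmf (fun z : R * R => bp h (z.1 + c) z.2).
  apply: (bmf_comp (bmf_bp h0) (g := fun z : R * R => (z.1 + c, z.2))).
  apply: measurable_fun_pair => //; apply: measurable_funD => //.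
apply: bmfB; last by apply: bmfM; [exact: bmf_cst|exact: bmf_bp].
by apply: bmfD; exact: sh.
Qed.

Lemma mollify0 kp h x : mollify kp h (fun=> 0) x = 0.
Proof. by rewrite -[RHS](Int0 mu); apply: eq_Int => y; rewrite mulr0. Qed.

Lemma bp_off h x t : ~~ (0 <= t < T) -> bp h x t = 0.
Proof.
move=> toff; rewrite /bp -[RHS](mollify0 tent h x); congr mollify; apply/funext => y.
by rewrite woff// mulr0.
Qed.

Lemma kf_off h x t : ~~ (0 <= t < T) -> kf h x t = 0.
Proof.
move=> toff; rewrite /kf -[RHS](mollify0 cub h x); congr mollify; apply/funext => y.
by rewrite foff.
Qed.

Lemma bb_off h x t : ~~ (0 <= t < T) -> bb h x t = 0.
Proof. by move=> to; rewrite /bb /lap !bp_off// kf_off//; ring. Qed.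

Lemma bmf_slice (g : R * R -> R) x : bmf g -> bmf (fun s => g (x, s)).
Proof. by move=> bg; apply: (bmf_comp bg); exact: pair1_measurable. Qed.

Lemma bmf_slab (g : R * R -> R) c d : bmf g ->
  bmf (fun x => I (fun s => seg c d s * g (x, s))).
Proof.
move=> bg; have [mg [C gC]] := bg; split.
  apply: (@measurable_Int1 _ _ _ _ _ mu (fun z => seg c d z.2 * g z)).
  apply: measurable_funM => //.
  exact: (measurableT_comp (measurable_seg c d) measurable_snd).
exists (I (fun s => C * seg c d s)) => x.
have ig := itg_seg_bmf c d (bmf_slice x bg).
rewrite (le_trans (Int_abs ig))//; apply: ler_Int; first exact: itg_abs.
  by apply: itgZ; exact: itg_seg.
by move=> s; rewrite normrM ger0_norm ?seg_ge0// mulrC ler_wpM2r ?seg_ge0.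
Qed.

Lemma seg_bound (g : R -> R) c d C : c <= d -> bmf g -> (forall s, `|g s| <= C) ->
  `|I (fun s => seg c d s * g s)| <= C * (d - c).
Proof.
move=> cd bg gC; have ig := itg_seg_bmf c d bg.
rewrite (le_trans (Int_abs ig))// -(Int_seg cd) -IntZ; last exact: itg_seg.
apply: ler_Int; [exact: itg_abs|by apply: itgZ; exact: itg_seg|].
by move=> s; rewrite normrM ger0_norm ?seg_ge0// mulrC ler_wpM2r ?seg_ge0.
Qed.

Lemma seg_chasles (g : R -> R) b c d : bmf g -> b <= c -> c <= d ->
  I (fun s => seg b d s * g s) = I (fun s => seg b c s * g s) + I (fun s => seg c d s * g s).
Proof.
move=> bg bc cd; rewrite -IntD; [|exact: itg_seg_bmf|exact: itg_seg_bmf].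
by apply: eq_Int => s; rewrite (@seg_split _ b c d)// mulrDl.
Qed.

Lemma bmf_ww h : 0 < h -> bmf (fun z => ww h z.1 z.2).
Proof.
move=> h0; have bbb := bmf_bb h0; split.
  apply: (@measurable_Int1 _ _ _ _ _ mu
    (fun p : (R * R) * R => seg 0 p.1.2 p.2 * bb h p.1.1 p.2)).
  have m12 : measurable_fun setT (fun p : (R * R) * R => p.1.2).
    by apply: (measurableT_comp measurable_snd); exact: measurable_fst.
  have m11 : measurable_fun setT (fun p : (R * R) * R => p.1.1).
    by apply: (measurableT_comp measurable_fst); exact: measurable_fst.
  apply: measurable_funM.
    apply: measurable_bool; apply: measurable_and.
      exact: measurable_fun_ler.
    exact: measurable_fun_ltr.
  have mp : measurable_fun setT (fun p : (R * R) * R => (p.1.1, p.2)).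
    exact: measurable_fun_pair.
  exact: (measurableT_comp bbb.1 mp).
exists (cb h * (T - 0)) => -[x t] /=; rewrite /ww.
have bx : bmf (fun s => bb h x s) by exact: (bmf_slice x bbb).
have bx' : bmf (fun s => seg 0 t s * bb h x s) by apply: bmfM => //; exact: bmf_seg.
(* As [bb] vanishes outside [[0, T)], the integral may be restricted to that interval, which makes
   the bound uniform in [t]. *)
rewrite (eq_Int mu (g := fun s => seg 0 T s * (seg 0 t s * bb h x s))).
  apply: seg_bound => //; first exact: ltW.
  move=> s; rewrite normrM (ger0_norm (seg_ge0 _ _ _)).
  by rewrite (le_trans _ (bb_le x s h0))// ler_piMl ?seg_le1.
move=> s; rewrite {2}/seg; case: (boolP (0 <= s < T)) => sT; first by rewrite mul1r.
by rewrite bb_off// !mulr0.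
Qed.

Lemma ww_split h x t s : 0 < h -> 0 <= t -> t <= s ->
  ww h x s = ww h x t + I (fun r => seg t s r * bb h x r).
Proof.
by move=> h0 t0 ts; apply: seg_chasles => //; exact: (bmf_slice x (bmf_bb h0)).
Qed.

Lemma ww_lip h x t s : 0 < h -> 0 <= t -> t <= s ->
  `|ww h x s - ww h x t| <= cb h * (s - t).
Proof.
move=> h0 t0 ts; rewrite (ww_split x h0 t0 ts) addrC addKr.
apply: seg_bound => //; first exact: (bmf_slice x (bmf_bb h0)).
by move=> r; exact: bb_le.
Qed.

(* Consistency error of the scheme with diffusivity [a + nu] *)
Definition qq h nu (z : R * R) := bp h z.1 z.2 - (a z + nu) * ww h z.1 z.2.

Lemma bmf_qq h nu : 0 < h -> bmf (qq h nu).
Proof.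
move=> h0; apply: bmfB; first exact: bmf_bp.
apply: bmfM; last exact: bmf_ww.
by apply: bmfD => //; exact: bmf_cst.
Qed.

Lemma slab_sum (g : R * R -> R) (rho : R -> R) J k N : 0 <= k -> bmf g -> bmf rho ->
  \sum_(j < N) I (fun x => seg (-J) J x *
     (I (fun s => seg (j%:R * k) (j.+1%:R * k) s * g (x, s)) * rho x)) =
  I (fun x => seg (-J) J x * (I (fun s => seg 0 (N%:R * k) s * g (x, s)) * rho x)).
Proof.
move=> k0 bg brho.
have it c d : itg mu (fun x => seg (-J) J x *
    (I (fun s => seg c d s * g (x, s)) * rho x)).
  by apply: itg_seg_bmf; apply: bmfM => //; exact: bmf_slab.
elim: N => [|N IH].
  rewrite big_ord0 -[LHS](Int0 mu); apply: eq_Int => x.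
  have -> : I (fun s => seg 0 (0%:R * k) s * g (x, s)) = 0.
    rewrite mul0r -[RHS](Int0 mu); apply: eq_Int => s.
    rewrite /seg; case: (boolP (_ && _)) => [/andP[s0 s1]|_]; last by rewrite mul0r.
    by move: (le_lt_trans s0 s1); rewrite ltxx.
  by rewrite mul0r mulr0.
rewrite big_ord_recr /= IH -IntD; [|exact: it|exact: it].
apply: eq_Int => x.
rewrite -mulrDr -mulrDl -seg_chasles//.
- exact: bmf_slice.
- by rewrite mulr_ge0.
- by rewrite ler_wpM2r// ler_nat.
Qed.

(* Young's inequality with the weights that match the energy term of
   [discrete_duality] *)
Lemma young_scaled (h mm nu q y : R) : 0 < h -> 0 < mm -> 0 < nu ->
  `|q| * `|y| <= h ^+ 2 * ((4 * mm * nu)^-1 * q ^+ 2) + mm * nu / h ^+ 2 * y ^+ 2.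
Proof.
move=> h0 mm0 nu0; rewrite -normrM.
have p0 : 0 < 4 * mm * nu by rewrite !mulr_gt0.
have hp : 0 < h ^+ 2 by exact: exprn_gt0.
have key (e : R) : 0 <= (4 * mm * nu)^-1 / h ^+ 2 *
    (h ^+ 2 * q - 2 * e * (mm * nu * y)) ^+ 2.
  by rewrite mulr_ge0 ?sqr_ge0// divr_ge0 ?invr_ge0// ltW.
have E (e : R) : e ^+ 2 = 1 -> (4 * mm * nu)^-1 / h ^+ 2 *
    (h ^+ 2 * q - 2 * e * (mm * nu * y)) ^+ 2 =
    h ^+ 2 * ((4 * mm * nu)^-1 * q ^+ 2) + mm * nu / h ^+ 2 * y ^+ 2 - e * (q * y).
  move=> e2; transitivity (h ^+ 2 * ((4 * mm * nu)^-1 * q ^+ 2) +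
     e ^+ 2 * (mm * nu / h ^+ 2 * y ^+ 2) - e * (q * y)); last by rewrite e2 mul1r.
  by field; rewrite !gt_eqF.
rewrite ler_norml; apply/andP; split.
  have := key (-1); rewrite E; [lra|ring].
have := key 1; rewrite E; [lra|ring].
Qed.

(** [discrete_duality] with [kap = mm / h ^+ 2] and time step [tau / N]. The terms on the right are,
    in order, the energy of the final datum, the consistency error together with the error of
    freezing [ww] on each slab, the flux through the ends of the window, and the source. *)
Lemma scheme_step N h J nu mm tau (chi : R -> R) m c :
  0 < h -> h <= 1 -> h <= J -> 0 < nu -> nu <= 1 -> 0 < mm -> 0 < tau ->
  (0 < N)%N -> h ^- 2 * ((L + 1) * (tau / N%:R)) <= 4^-1 ->
  0 <= m -> 0 <= c -> bmf chi -> vanish_off J chi ->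
  (forall x, `|chi x| <= m * psi x) ->
  (forall x, `|x| <= J + h -> `|chi x| <= c * (J + h - `|x|)) ->
  `|I (fun x => ww h x tau * chi x)| <= mm / h ^+ 2 * energy h chi +
    (4 * mm * nu)^-1 * (2 * I (fun x => seg (-J) J x *
        I (fun s => seg 0 tau s * qq h nu (x, s) ^+ 2)) +
      2 * ((L + 1) * (cb h * (tau / N%:R))) ^+ 2 * (tau * (2 * J))) +
    4 * tau * (L * M) * c +
    m * expR (3 * (L + 1) * tau) * I (fun x => seg (-J) J x *
        (I (fun s => seg 0 tau s * `|kf h x s|) * psi x)).
Proof.
move=> h0 h1 hJ nu0 nu1 mm0 tau0 N0 small m0 c0 bchi chioff chipsi chihat.
have L1 : 0 <= L + 1 by rewrite addr_ge0.
pose k := tau / N%:R; rewrite -/k in small *.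
have k0 : 0 < k by rewrite divr_gt0 ?ltr0n.
have Nk : N%:R * k = tau by rewrite /k mulrC divfK// pnatr_eq0 -lt0n.
have hp : 0 < h ^+ 2 by exact: exprn_gt0.
have hi : 0 < h ^- 2 by rewrite invr_gt0.
pose t j : R := j%:R * k.
have t0 j : 0 <= t j by rewrite mulr_ge0// ltW.
have tS j : t j.+1 = t j + k by rewrite /t -natr1 mulrDl mul1r.
have tle j : t j <= t j.+1 by rewrite tS lerDl ltW.
have tk j : t j.+1 - t j = k by rewrite tS addrC addKr.
have bav : bmf (fun z => a z + nu) by apply: bmfD => //; exact: bmf_cst.
pose W j x := ww h x (t j).
(* The smoothed equation is integrated exactly over each slab, so the recurrence for [W] has no
   truncation error; time discretisation enters only through [q], where [ww] is frozen at the start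
   of the slab. *)
pose G j x := h ^- 2 * I (fun s => seg (t j) (t j.+1) s * bp h x s).
pose F j x := I (fun s => seg (t j) (t j.+1) s * kf h x s).
pose q j (z : R * R) := bp h z.1 z.2 - (a z + nu) * W j z.1.
pose E j x := (4 * mm * nu)^-1 * I (fun s => seg (t j) (t j.+1) s * q j (x, s) ^+ 2).
(* [a] is only measurable in time, so its slab integral is used instead of a value. The bound
   [al <= 4^-1] is the hypothesis [small]. *)
pose al j x := seg (-J) J x * (h ^- 2 * I (fun s => seg (t j) (t j.+1) s * (a (x, s) + nu))).
have bW j : bmf (W j).
  exact: (bmf_comp (bmf_ww h0) (pair2_measurable (t j))).
have bq j : bmf (q j).
  apply: bmfB; first exact: bmf_bp.
  by apply: bmfM => //; apply: (bmf_comp (bW j)); exact: measurable_fst.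
have bG j : bmf (G j) by apply: bmfM; [exact: bmf_cst|exact: (bmf_slab _ _ (bmf_bp h0))].
have bF j : bmf (F j) by exact: (bmf_slab _ _ (bmf_kf h0)).
have bE j : bmf (E j).
  by apply: bmfM; [exact: bmf_cst|exact: (bmf_slab _ _ (bmfX 2 (bq j)))].
have bal j : bmf (al j).
  apply: bmfM; first exact: bmf_seg.
  by apply: bmfM; [exact: bmf_cst|exact: (bmf_slab _ _ bav)].
have av0 z : 0 <= a z + nu by have /andP[a0 _] := aL z; lra.
have avL z : a z + nu <= L + 1 by have /andP[_ aL'] := aL z; lra.
have Iav j x : 0 <= I (fun s => seg (t j) (t j.+1) s * (a (x, s) + nu)) <= (L + 1) * k.
  rewrite Int_ge0/=; last by move=> s; rewrite mulr_ge0 ?seg_ge0.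
  have : `|I (fun s => seg (t j) (t j.+1) s * (a (x, s) + nu))| <= (L + 1) * (t j.+1 - t j).
    apply: seg_bound => //; first exact: (bmf_slice x bav).
    by move=> s; rewrite ger0_norm.
  by rewrite tk; apply: le_trans; exact: ler_norm.
have al01 j x : 0 <= al j x <= h ^- 2 * ((L + 1) * k).
  have /andP[i0 i1] := Iav j x.
  rewrite mulr_ge0 ?seg_ge0//=; last by rewrite mulr_ge0// ltW.
  by rewrite -[leRHS]mul1r ler_pM ?seg_ge0 ?seg_le1 ?ler_wpM2l ?mulr_ge0// ltW.
have al4 j x : 0 <= al j x <= 4^-1.
  by have /andP[-> /le_trans->] := al01 j x.
have aloff j : vanish_off J (al j).
  by move=> x xo; rewrite /al /seg (negbTE xo) mul0r.
have WS j x : W j.+1 x = W j x + lap h (G j) x - F j x.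
  rewrite /W (ww_split x h0 (t0 j) (tle j)) -addrA; congr (_ + _).
  have ib y : itg mu (fun s => seg (t j) (t j.+1) s * bp h y s).
    by apply: itg_seg_bmf; exact: (bmf_slice y (bmf_bp h0)).
  have ik : itg mu (fun s => seg (t j) (t j.+1) s * kf h x s).
    by apply: itg_seg_bmf; exact: (bmf_slice x (bmf_kf h0)).
  have -> : lap h (G j) x = h ^- 2 * I (fun s => (seg (t j) (t j.+1) s * bp h (x + h) s
      + seg (t j) (t j.+1) s * bp h (x - h) s) - 2 * (seg (t j) (t j.+1) s * bp h x s)).
    rewrite IntB; [|exact: itgD|exact: itgZ].
    rewrite (IntD (ib (x + h)) (ib (x - h))).
    rewrite (IntZ 2 (ib x)).
    have gen (e A B C : R) : e * A + e * B - 2 * (e * C) = e * (A + B - 2 * C) by ring.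
    exact: gen.
  rewrite -IntZ; last by apply: itgB; [exact: itgD|exact: itgZ].
  rewrite /F -IntB//.
    by apply: eq_Int => s; rewrite /bb /lap; ring.
  by apply: itgZ; apply: itgB; [exact: itgD|exact: itgZ].
have young j x y : - J <= x < J ->
    `|G j x - al j x * W j x| * `|y| <= E j x + mm / h ^+ 2 * (al j x * y ^+ 2).
  move=> xJ.
  have -> : al j x = h ^- 2 * I (fun s => seg (t j) (t j.+1) s * (a (x, s) + nu)).
    by rewrite /al {1}/seg xJ mul1r.
  have iq : itg mu (fun s => seg (t j) (t j.+1) s * q j (x, s)).
    by apply: itg_seg_bmf; exact: (bmf_slice x (bq j)).
  have iav : itg mu (fun s => seg (t j) (t j.+1) s * (a (x, s) + nu)).
    by apply: itg_seg_bmf; exact: (bmf_slice x bav).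
  have ib : itg mu (fun s => seg (t j) (t j.+1) s * bp h x s).
    by apply: itg_seg_bmf; exact: (bmf_slice x (bmf_bp h0)).
  have i2 : itg mu (fun s => seg (t j) (t j.+1) s * q j (x, s) ^+ 2).
    by apply: itg_seg_bmf; exact: (bmf_slice x (bmfX 2 (bq j))).
  have is1 : itg mu (seg (t j) (t j.+1)) by exact: itg_seg.
  have -> : G j x - h ^- 2 * I (fun s => seg (t j) (t j.+1) s * (a (x, s) + nu)) * W j x
      = h ^- 2 * I (fun s => seg (t j) (t j.+1) s * q j (x, s)).
    rewrite /G -mulrA -mulrBr; congr (_ * _).
    rewrite mulrC -IntZ// -IntB//; last exact: itgZ.
    by apply: eq_Int => s; rewrite /q /=; ring.
  rewrite normrM (gtr0_norm hi) -[leLHS]mulrA.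
  have sc : `|I (fun s => seg (t j) (t j.+1) s * q j (x, s))| * `|y| <=
      h ^+ 2 * E j x + mm * nu / h ^+ 2 * y ^+ 2 * k.
    have -> : k = I (seg (t j) (t j.+1)).
      by rewrite Int_seg// tk.
    rewrite mulrC -normrM -IntZ// (le_trans (Int_abs (itgZ _ iq)))//.
    rewrite /E mulrA -!IntZ// -IntD; [|exact: itgZ|exact: itgZ].
    apply: ler_Int; first by apply: itg_abs; exact: itgZ.
      by apply: itgD; exact: itgZ.
    move=> s; rewrite mulrCA normrM (ger0_norm (seg_ge0 _ _ _)).
    have yq := young_scaled (q j (x, s)) y h0 mm0 nu0.
    have := ler_wpM2l (seg_ge0 (t j) (t j.+1) s) yq.
    by rewrite normrM (mulrC `|y|); lra.
  (* This lower bound on the slab integral of the diffusivity lets the quadratic term of Young's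
     inequality be absorbed by [al], even where [a] vanishes. *)
  have lo : nu * k <= I (fun s => seg (t j) (t j.+1) s * (a (x, s) + nu)).
    have -> : k = I (seg (t j) (t j.+1)).
      by rewrite Int_seg// tk.
    rewrite -IntZ//; apply: ler_Int => //; first exact: itgZ.
    by move=> s; rewrite mulrC ler_wpM2l ?seg_ge0//; have /andP[a0 _] := aL (x, s); lra.
  apply: (le_trans (ler_wpM2l (ltW hi) sc)).
  rewrite mulrDr mulKf ?gt_eqF// lerD2l.
  rewrite (_ : h ^- 2 * (mm * nu / h ^+ 2 * y ^+ 2 * k) =
     (mm / h ^+ 2 * h ^- 2 * y ^+ 2) * (nu * k)); last by field; rewrite gt_eqF.
  rewrite (_ : mm / h ^+ 2 * (h ^- 2 * _ * y ^+ 2) = (mm / h ^+ 2 * h ^- 2 * y ^+ 2) *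
     I (fun s => seg (t j) (t j.+1) s * (a (x, s) + nu))); last by ring.
  apply: ler_wpM2l => //; apply: mulr_ge0; last exact: sqr_ge0.
  by rewrite mulr_ge0// ltW// divr_gt0.
have Gb j x : `|G j x| <= h ^- 2 * (L * M * k).
  rewrite /G normrM (gtr0_norm hi) ler_wpM2l ?(ltW hi)//.
  rewrite -(tk j).
  apply: seg_bound => //; first exact: (bmf_slice x (bmf_bp h0)).
  by move=> s; exact: bp_le.
have alpsi j x : al j x * lap h psi x <= 3 * (L + 1) * k * psi x.
  have /andP[a0 a1] := al01 j x.
  rewrite (le_trans (ler_wpM2l a0 (lap_psi x h0 h1)))//.
  rewrite mulrA ler_wpM2r ?(ltW (psi_gt0 x))//.
  apply: (le_trans (ler_wpM2r _ a1)); first by rewrite mulr_ge0// ltW.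
  have -> : h ^- 2 * ((L + 1) * k) * (3 * h ^+ 2) = 3 * (L + 1) * k.
    by field; rewrite gt_eqF.
  by [].
have kap0 : 0 <= mm / h ^+ 2 by rewrite divr_ge0// ltW.
have k'0 : 0 <= 3 * (L + 1) * k by rewrite mulr_ge0 ?(ltW k0)// mulr_ge0.
have gb0 : 0 <= h ^- 2 * (L * M * k).
  by rewrite mulr_ge0 ?(ltW hi)// mulr_ge0 ?(ltW k0)// mulr_ge0.
have W0 x : W 0%N x = 0.
  rewrite /W /ww /t mulr0n mul0r -[RHS](Int0 mu); apply: eq_Int => s.
  rewrite /seg; case: (boolP (_ && _)) => [/andP[s0 s1]|_]; last by rewrite mul0r.
  by move: (le_lt_trans s0 s1); rewrite ltxx.
have := @discrete_duality R h J _ _ _ psi W G F E al h0 hJ kap0 k'0 gb0 (bmf_psi R)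
  (fun x => ltW (psi_gt0 x)) (fun j => And5 (bW j) (bG j) (bF j) (bE j) (bal j))
  W0 WS al4 aloff young Gb alpsi N chi m c m0 c0 bchi chioff chipsi chihat.
rewrite {1}/W /t Nk => DD; apply: (le_trans DD); rewrite -!addrA lerD2l.
(* Bound for the freezing error: the diffusivity times the variation of [ww] over one slab. The
   function [g] below then comes from the inequality [(b + c)^2 <= 2 * b^2 + 2 * c^2]. *)
pose D := (L + 1) * (cb h * k).
pose g (z : R * R) := 2 * qq h nu z ^+ 2 + 2 * D ^+ 2.
have bqq := bmf_qq nu h0.
have bq2 : bmf (fun z => 2 * qq h nu z ^+ 2).
  by apply: bmfM; [exact: bmf_cst|exact: bmfX].
have bg : bmf g by apply: bmfD => //; exact: bmf_cst.
have cb0 : 0 <= cb h by apply: le_trans (bb_le 0 0 h0).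
have ci : 0 <= (4 * mm * nu)^-1 by rewrite invr_ge0 !mulr_ge0// ltW.
have qg j x s : seg (t j) (t j.+1) s * q j (x, s) ^+ 2 <= seg (t j) (t j.+1) s * g (x, s).
  rewrite /seg; case: (boolP (t j <= s < t j.+1)) => [/andP[s1 s2]|_]; last by rewrite !mul0r.
  rewrite !mul1r.
  pose dd := (a (x, s) + nu) * (ww h x s - W j x).
  have -> : q j (x, s) = qq h nu (x, s) + dd by rewrite /q /qq /dd /=; ring.
  have ddD : `|dd| <= D.
    rewrite normrM (ger0_norm (av0 _)); apply: ler_pM => //.
    apply: (le_trans (ww_lip x h0 (t0 j) s1)); apply: ler_wpM2l => //.
    by rewrite -(tk j) lerD2r ltW.
  have dd2 : dd ^+ 2 <= D ^+ 2.
    rewrite -[dd ^+ 2]real_normK ?num_real// lerXn2r// nnegrE.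
    exact: le_trans ddD.
  by rewrite /g; have := sqr_ge0 (qq h nu (x, s) - dd); lra.
have SA : \sum_(j < N) I (fun x => seg (-J) J x * E j x) <= (4 * mm * nu)^-1 *
    (2 * I (fun x => seg (-J) J x * I (fun s => seg 0 tau s * qq h nu (x, s) ^+ 2)) +
      2 * D ^+ 2 * (tau * (2 * J))).
  have b1 : bmf (fun _ : R => 1 : R) by exact: bmf_cst.
  apply: (@le_trans _ _ (\sum_(j < N) (4 * mm * nu)^-1 * I (fun x => seg (-J) J x *
     (I (fun s => seg (t j) (t j.+1) s * g (x, s)) * 1)))).
    apply: ler_sum => j _.
    have iR : itg mu (fun x => seg (-J) J x *
       (I (fun s => seg (t j) (t j.+1) s * g (x, s)) * 1)).
      by apply: itg_seg_bmf; apply: bmfM => //; exact: (bmf_slab _ _ bg).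
    rewrite -(IntZ _ iR); apply: ler_Int; [exact: itg_seg_bmf|exact: itgZ|] => x.
    rewrite mulr1 [leRHS]mulrCA; apply: ler_wpM2l; first exact: seg_ge0.
    apply: ler_wpM2l => //; apply: ler_Int.
    - by apply: itg_seg_bmf; exact: (bmf_slice x (bmfX 2 (bq j))).
    - by apply: itg_seg_bmf; exact: (bmf_slice x bg).
    - by move=> s; exact: qg.
  rewrite -mulr_sumr (slab_sum _ _ (ltW k0) bg b1) Nk.
  apply: ler_wpM2l => //.
  have bQ : bmf (fun x => I (fun s => seg 0 tau s * qq h nu (x, s) ^+ 2)).
    exact: (bmf_slab 0 tau (bmfX 2 bqq)).
  have J0 : 0 <= J by lra.
  rewrite (eq_Int mu (g := fun x => 2 * (seg (-J) J x *
      I (fun s => seg 0 tau s * qq h nu (x, s) ^+ 2))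
      + 2 * D ^+ 2 * tau * seg (-J) J x)); last first.
    move=> x; rewrite mulr1.
    have iqs : itg mu (fun s => seg 0 tau s * qq h nu (x, s) ^+ 2).
      by apply: itg_seg_bmf; exact: (bmf_slice x (bmfX 2 bqq)).
    rewrite (eq_Int mu (g := fun s => 2 * (seg 0 tau s * qq h nu (x, s) ^+ 2)
       + 2 * D ^+ 2 * seg 0 tau s)); last by move=> s; rewrite /g; ring.
    rewrite IntD; [|exact: itgZ|by apply: itgZ; exact: itg_seg].
    rewrite (IntZ _ iqs) (IntZ _ (itg_seg 0 tau)) Int_seg; last exact: ltW.
    by move: (I _) => A; ring.
  rewrite IntD; [|by apply: itgZ; exact: itg_seg_bmf|by apply: itgZ; exact: itg_seg].
  rewrite (IntZ _ (itg_seg_bmf (-J) J bQ)) (IntZ _ (itg_seg (-J) J)) Int_seg; last lra.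
  by rewrite lerD2l le_eqVlt; apply/orP; left; apply/eqP; ring.
(* The factor [h ^- 2] in the bound on [G] cancels the [h ^+ 2] of the end cells, and [N * k = tau]:
   the flux term does not depend on the mesh. *)
have SB : \sum_(j < N) 4 * h ^+ 2 * (h ^- 2 * (L * M * k)) * c = 4 * tau * (L * M) * c.
  rewrite sumr_const card_ord -mulr_natl -Nk; field.
  by rewrite gt_eqF.
have bkf := bmf_abs (bmf_kf h0).
have SC : \sum_(j < N) m * (1 + 3 * (L + 1) * k) ^+ N *
    I (fun x => seg (-J) J x * (`|F j x| * psi x)) <=
    m * expR (3 * (L + 1) * tau) *
    I (fun x => seg (-J) J x * (I (fun s => seg 0 tau s * `|kf h x s|) * psi x)).
  apply: (@le_trans _ _ (\sum_(j < N) m * expR (3 * (L + 1) * tau) *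
     I (fun x => seg (-J) J x * (I (fun s => seg (t j) (t j.+1) s * `|kf h x s|) * psi x)))).
    apply: ler_sum => j _; apply: ler_pM.
    - by rewrite mulr_ge0// exprn_ge0// addr_ge0.
    - by apply: Int_ge0 => x; rewrite !mulr_ge0 ?seg_ge0// ltW// psi_gt0.
    - apply: ler_wpM2l => //.
      have -> : expR (3 * (L + 1) * tau) = expR (3 * (L + 1) * k) ^+ N.
        by rewrite -expRM_natl -Nk; congr expR; ring.
      rewrite lerXn2r ?nnegrE ?expR_ge0 ?addr_ge0//.
      exact: expR_ge1Dx.
    - apply: ler_Int.
      + by apply: itg_seg_bmf; apply: bmfM; [exact: bmf_abs|exact: bmf_psi].
      + apply: itg_seg_bmf; apply: bmfM; last exact: bmf_psi.
        exact: (bmf_slab _ _ bkf).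
      + move=> x; apply: ler_wpM2l; first exact: seg_ge0.
        apply: ler_wpM2r; first by rewrite ltW// psi_gt0.
        have ik : itg mu (fun s => seg (t j) (t j.+1) s * kf h x s).
          by apply: itg_seg_bmf; exact: (bmf_slice x (bmf_kf h0)).
        rewrite (le_trans (Int_abs ik))// (eq_Int mu (g := fun s =>
           seg (t j) (t j.+1) s * `|kf h x s|))//.
        by move=> s; rewrite normrM ger0_norm ?seg_ge0.
  by rewrite -mulr_sumr (slab_sum _ _ (ltW k0) bkf (bmf_psi R)) Nk.
rewrite !big_split /= -addrA; apply: lerD => //.
by rewrite SB; apply: lerD.
Qed.

End Scheme.

Lemma Int_ae_eq d (X : measurableType d) (R : realType)
    (mu : {measure set X -> \bar R}) (f g : X -> R) :
  measurable_fun setT f -> measurable_fun setT g ->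
  {ae mu, forall x, f x = g x} -> Int mu f = Int mu g.
Proof.
move=> mf mg fg; rewrite /Int /Rintegral; congr fine.
apply: ae_eq_integral => //; [exact/measurable_EFinP|exact/measurable_EFinP|].
by apply: filterS fg => x /= -> _.
Qed.

(** * Weight and mollifiers: integrability, Lipschitz bounds, supports *)

Section Tools.
Context (R : realType).
Local Notation mu := (@lebesgue_measure R).
Local Notation I := (Int (@lebesgue_measure R)).
Implicit Types (x y h J tau : R).

Lemma itg_psi : itg mu (@psi R).
Proof.
apply/integrableP; split; first by apply/measurable_EFinP; exact: measurable_psi.
have E : (fun x : R => `|(EFin \o psi) x|%E) = fun x => (psi x)%:E.
  by apply/funext => x; rewrite /= ger0_norm// ltW// psi_gt0.
rewrite E ge0_symfun_integralT.
- rewrite (_ : [set x | _] = `[0, +oo[%classic); last first.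
    by apply/seteqP; split => x /=; rewrite in_itv/= andbT.
  by have := integral0y_oneDsqr R; rewrite /oneDsqr => ->; rewrite -EFinM ltry.
- by move=> x; rewrite ltW// psi_gt0.
- exact: continuous_oneDsqrV.
- by move=> x; rewrite /= /psi sqrrN.
Qed.

(** The difference factors through [(x + (x + h)) * (psi (x + h) * psi x)], which is at most 1 in
    absolute value because the product of [|y|] and [psi y] never exceeds one half. *)
Lemma psi_lip x h : `|psi (x + h) - psi x| <= `|h|.
Proof.
have D0 : 0 < 1 + x ^+ 2 by rewrite ltr_pwDl// sqr_ge0.
have Dp : 0 < 1 + (x + h) ^+ 2 by rewrite ltr_pwDl// sqr_ge0.
have -> : psi (x + h) - psi x =
    - h * ((x + (x + h)) * (psi (x + h) * psi x)).
  by rewrite /psi; field; rewrite !gt_eqF.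
rewrite normrM normrN -[leRHS]mulr1 ler_wpM2l//.
have half (y : R) : `|y| * psi y <= 2^-1.
  have Dy : 0 < 1 + y ^+ 2 by rewrite ltr_pwDl// sqr_ge0.
  rewrite /psi ler_pdivrMr// -[y ^+ 2]real_normK ?num_real//.
  have := sqr_ge0 (`|y| - 1); lra.
rewrite normrM (ger0_norm (x := psi _ * _)); last by rewrite mulr_ge0// ltW// psi_gt0.
rewrite (le_trans (ler_wpM2r _ (ler_normD _ _)))//.
  by rewrite mulr_ge0// ltW// psi_gt0.
have := ler_wpM2r (ltW (psi_gt0 (x + h))) (half x).
have := ler_wpM2r (ltW (psi_gt0 x)) (half (x + h)).
have := psi_le1 x; have := psi_le1 (x + h); have := psi_gt0 x; have := psi_gt0 (x + h).
lra.
Qed.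

Lemma pos_lip x y : `|pos x - pos y| <= `|x - y|.
Proof.
case: (leP 0 x) => x0; case: (leP 0 y) => y0.
- by rewrite !pos_ge.
- by rewrite (pos_ge x0) (pos_le (ltW y0)) subr0 ger0_norm// ger0_norm; lra.
- by rewrite (pos_ge y0) (pos_le (ltW x0)) sub0r normrN ger0_norm// ler0_norm; lra.
- by rewrite (pos_le (ltW x0)) (pos_le (ltW y0)) subrr normr0.
Qed.

Lemma tent_lip x y : `|tent x - tent y| <= 4 * `|x - y|.
Proof.
have p (c : R) : `|pos (x + c) - pos (y + c)| <= `|x - y|.
  by rewrite (le_trans (pos_lip _ _))//; have -> : x + c - (y + c) = x - y by ring.
have := p 1; have := p (-1); have := p 0; rewrite !addr0 => p0 pm p1.
have -> : tent x - tent y = (pos (x + 1) - pos (y + 1)) + (pos (x - 1) - pos (y - 1))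
   - 2 * (pos x - pos y) by rewrite /tent; ring.
rewrite (le_trans (ler_normB _ _))// normrM (ger0_norm (x := 2))//.
rewrite (le_trans (lerD (ler_normD _ _) (lexx _)))//; lra.
Qed.

Lemma mollify_lip r (g : R -> R) J x h : 0 < r -> 0 <= J -> measurable_fun setT g ->
  (forall y, `|g y| <= seg (-J) J y) ->
  `|mollify tent r g (x + h) - mollify tent r g x| <= 8 * J * r ^- 2 * `|h|.
Proof.
move=> r0 J0 mg gJ.
have bg : bmf g.
  by split => //; exists 1 => y; rewrite (le_trans (gJ y))// seg_le1.
have i1 y := itgM (itg_kernel y (tent_kernel R) r0) bg.
rewrite /mollify -IntB; [|exact: i1|exact: i1].
rewrite (le_trans (Int_abs (itgB (i1 _) (i1 _))))//.
have -> : 8 * J * r ^- 2 * `|h| = I (fun y => 4 * r ^- 2 * `|h| * seg (-J) J y).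
  by rewrite (IntZ _ (itg_seg _ _)) Int_seg; [ring|lra].
apply: ler_Int; first by apply: itg_abs; apply: itgB; exact: i1.
  by apply: itgZ; exact: itg_seg.
move=> y; rewrite -mulrBl -mulrBr normrM.
apply: ler_pM => //; rewrite normrM gtr0_norm ?invr_gt0//.
apply: (le_trans (ler_wpM2l _ (tent_lip _ _))); first by rewrite invr_ge0 ltW.
rewrite (_ : (x + h - y) / r - (x - y) / r = h / r); last by field; rewrite gt_eqF.
rewrite normrM (gtr0_norm (x := r^-1)) ?invr_gt0//.
by rewrite le_eqVlt; apply/orP; left; apply/eqP; field; rewrite gt_eqF.
Qed.

(** The kernel vanishes at distance [2 * r <= 2]; enlarging the window by 3 leaves room for its
    half-open ends. *)
Lemma mollify_off r (g : R -> R) J : 0 < r -> r <= 1 ->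
  vanish_off J g -> vanish_off (J + 3) (mollify tent r g).
Proof.
move=> r0 r1 goff x xo; rewrite -[RHS](Int0 mu); apply: eq_Int => y.
case: (boolP (-J <= y < J)) => [/andP[y1 y2]|yo]; last by rewrite (goff y yo) mulr0.
have [_ _ koff _] := tent_kernel R; rewrite koff ?mulr0 ?mul0r//.
rewrite normrM (gtr0_norm (x := r^-1)) ?invr_gt0// ler_pdivlMr//.
move: xo; rewrite negb_and -ltNge -leNgt ler_normr => /orP[xo|xo]; apply/orP.
  by right; lra.
by left; lra.
Qed.

(** Dominated convergence is applied in time, with the space integral inside; the scheme integrates
    in the opposite order, and Fubini on the box exchanges the two. *)
Lemma mollify_L1_xs kp (g : R * R -> R) J tau : is_kernel kp -> bmf g ->
  I (fun x => seg (-J) J x * I (fun s => seg 0 tau s *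
    `|mollify kp n.+1%:R^-1 (fun y => g (y, s)) x - g (x, s)|)) @[n --> \oo] --> 0.
Proof.
move=> kk bg.
rewrite [X in X @ _ --> _](_ : _ = (fun n => I (fun t => seg 0 tau t * I (fun x => seg (-J) J x *
    `|mollify kp n.+1%:R^-1 (fun y => g (y, t)) x - g (x, t)|)))); last first.
  apply/funext => n.
  have n0 : 0 < n.+1%:R^-1 :> R by rewrite invr_gt0.
  pose d (z : R * R) := `|mollify kp n.+1%:R^-1 (fun y => g (y, z.2)) z.1 - g z|.
  have bd : bmf d by apply: bmf_abs; apply: bmfB => //; exact: bmf_mollify2.
  have [md [C dC]] := bd.
  pose G (z : R * R) := seg (-J) J z.1 * seg 0 tau z.2 * d z.
  have mG : measurable_fun setT G.
    apply: measurable_funM => //; apply: measurable_funM.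
      exact: (measurableT_comp (measurable_seg _ _) measurable_fst).
    exact: (measurableT_comp (measurable_seg _ _) measurable_snd).
  have iG : itg (mu \x mu)%E G.
    apply: (@itg_prod _ _ _ _ _ mu mu (fun x => C * seg (-J) J x) (seg 0 tau)) => //.
    - by apply: itgZ; exact: itg_seg.
    - exact: itg_seg.
    - move=> z; rewrite /G !normrM !(ger0_norm (seg_ge0 _ _ _)) mulrC mulrA.
      by rewrite ler_wpM2r ?seg_ge0// ler_wpM2r ?seg_ge0.
  have bx x : bmf (fun s => d (x, s)) by exact: (bmf_comp bd (pair1_measurable x)).
  have bs s : bmf (fun x => d (x, s)) by exact: (bmf_comp bd (pair2_measurable s)).
  have [|_ e1] := fubini_iter1 iG.
    move=> x; apply: eq_itg (itgZ (seg (-J) J x) (itg_seg_bmf 0 tau (bx x))) => s.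
    by rewrite /G mulrA.
  have [|_ e2] := fubini_iter2 iG.
    move=> s; apply: eq_itg (itgZ (seg 0 tau s) (itg_seg_bmf (-J) J (bs s))) => x.
    by rewrite /G mulrA (mulrC (seg 0 tau s)).
  transitivity (I (fun x => I (fun s => G (x, s)))).
    apply: eq_Int => x; rewrite -IntZ; last exact: (itg_seg_bmf 0 tau (bx x)).
    by apply: eq_Int => s; rewrite /G mulrA.
  rewrite e1 -e2; apply: eq_Int => s.
  rewrite -IntZ; last exact: (itg_seg_bmf (-J) J (bs s)).
  by apply: eq_Int => x; rewrite /G mulrA (mulrC (seg 0 tau s)).
exact: mollify_cvg_L1_2.
Qed.

End Tools.

(** * Passage to the limit *)

Lemma sqr_sub_le (R : realFieldType) (r q b c : R) : r ^+ 2 <= b -> q ^+ 2 <= c ->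
  0 <= (r + q) ^+ 2 -> (r - q) ^+ 2 <= 2 * c + 2 * b.
Proof. by lra. Qed.

(** The final bookkeeping of [dual_bound0], with each integral replaced by a variable, so that only
    linear arithmetic remains. *)
Lemma collect_errors (R : realFieldType) (X1 X2 X3 X4 X5 c E F Z b d e q k : R) :
  X2 + c * b + E * d <= e -> X3 <= q + c * X4 + k + E * X5 ->
  c * X4 <= c * (Z + b) -> E * X5 <= E * (F + d) -> X1 <= X3 + X2 ->
  X1 <= e + (q + c * Z + k + E * F).
Proof. by lra. Qed.

Section Limits.
Context (R : realType).
Local Notation mu := (@lebesgue_measure R).
Local Notation I := (Int (@lebesgue_measure R)).
Variables (T M L : R) (w a f : R * R -> R).
Hypotheses (T0 : 0 < T) (mw : measurable_fun setT w)
  (ma : measurable_fun setT a) (mf : measurable_fun setT f)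
  (wM : forall z, `|w z| <= M) (aL : forall z, 0 <= a z <= L)
  (fM : forall z, `|f z| <= M)
  (woff : forall x t, ~~ (0 <= t < T) -> w (x, t) = 0)
  (foff : forall x t, ~~ (0 <= t < T) -> f (x, t) = 0).
Implicit Types (h x t s : R).

Let M0 : 0 <= M. Proof. exact: le_trans (wM (0, 0)). Qed.
Let L0 : 0 <= L. Proof. by have /andP[+ ] := aL (0, 0); apply: le_trans. Qed.
Let bw : bmf w. Proof. by split => //; exists M. Qed.
Let bf : bmf f. Proof. by split => //; exists M. Qed.
Let ba : bmf a.
Proof.
by split => //; exists L => z; have /andP[a0 a1] := aL z; rewrite ger0_norm.
Qed.
Let baw : bmf (fun z => a z * w z). Proof. exact: bmfM. Qed.

Let bkw h : 0 < h -> bmf (fun z => kw w h z.1 z.2). Proof. exact: bmf_kw. Qed.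
Let bkf h : 0 < h -> bmf (fun z => kf f h z.1 z.2). Proof. exact: bmf_kf. Qed.
Let bbp h : 0 < h -> bmf (fun z => bp w a h z.1 z.2).
Proof. exact: (bmf_bp mw ma wM aL). Qed.
Let bww h : 0 < h -> bmf (fun z => ww w a f h z.1 z.2).
Proof. exact: (bmf_ww T0 mw ma mf wM aL fM woff foff). Qed.

(** Increments are at most [l * h] and, as [h <= 1], live in a window of length [2 * J0 + 2]. The
    factor [h ^+ 2] cancels the denominator of the weight [mm / h ^+ 2]. *)
Lemma energy_lip h (chi : R -> R) J0 l : 0 < h -> h <= 1 -> 0 <= J0 ->
  bmf chi -> vanish_off J0 chi ->
  (forall x, `|chi (x + h) - chi x| <= l * h) ->
  energy h chi <= h ^+ 2 * (l ^+ 2 * (2 * J0 + 2)).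
Proof.
move=> h0 h1 J00 bchi chioff lip.
have -> : h ^+ 2 * (l ^+ 2 * (2 * J0 + 2)) =
    I (fun x => (l * h) ^+ 2 * seg (- (J0 + 1)) (J0 + 1) x).
  by rewrite (IntZ _ (itg_seg _ _)) Int_seg; [ring|lra].
have b2 : bmf (fun x => (chi (x + h) - chi x) ^+ 2).
  by apply: bmfX; apply: bmfB => //; exact: bmf_shift.
have pt x : (chi (x + h) - chi x) ^+ 2 <= (l * h) ^+ 2 * seg (- (J0 + 1)) (J0 + 1) x.
  rewrite /seg; case: (boolP (- (J0 + 1) <= x < J0 + 1)) => [_|xo].
    rewrite mulr1 -[leLHS]real_normK ?num_real// lerXn2r ?nnegrE//.
    exact: le_trans (lip x).
  rewrite mulr0 (chioff x) ?(chioff (x + h)) ?subrr ?expr0n//.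
    move: xo; rewrite !negb_and -!ltNge -!leNgt => /orP[xo|xo]; apply/orP.
      by left; lra.
    by right; lra.
  move: xo; rewrite !negb_and -!ltNge -!leNgt => /orP[xo|xo]; apply/orP.
    by left; lra.
  by right; lra.
apply: ler_Int => //; last by apply: itgZ; exact: itg_seg.
apply: itg_le (itgZ ((l * h) ^+ 2) (itg_seg (- (J0 + 1)) (J0 + 1))).
  exact: b2.1.
by move=> x; rewrite ger0_norm ?sqr_ge0.
Qed.

(** With [h] fixed, a large number of time steps meets the stability condition and removes the
    freezing error; the other terms do not depend on that number. *)
Lemma scheme_limit h J J0 nu mm tau (chi : R -> R) l :
  0 < h -> h <= 1 -> 0 <= J0 -> J0 < J -> 1 <= J -> 0 < nu -> nu <= 1 -> 0 < mm ->
  0 < tau -> bmf chi -> vanish_off J0 chi ->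
  (forall x, `|chi (x + h) - chi x| <= l * h) ->
  (forall x, `|chi x| <= psi x) ->
  `|I (fun x => ww w a f h x tau * chi x)| <= mm * (l ^+ 2 * (2 * J0 + 2)) +
    (2 * mm * nu)^-1 * I (fun x => seg (-J) J x *
        I (fun s => seg 0 tau s * qq w a f h nu (x, s) ^+ 2)) +
    4 * tau * (L * M) / (J - J0) +
    expR (3 * (L + 1) * tau) * I (fun x => seg (-J) J x *
        (I (fun s => seg 0 tau s * `|kf f h x s|) * psi x)).
Proof.
move=> h0 h1 J00 J0J J1 nu0 nu1 mm0 tau0 bchi chioff lip chipsi.
have en := energy_lip h0 h1 J00 bchi chioff lip.
have chioffJ : vanish_off J chi.
  move=> x xo; apply: chioff; move: xo; rewrite !negb_and -!ltNge -!leNgt => /orP[xo|xo].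
    by apply/orP; left; lra.
  by apply/orP; right; lra.
have JJ0 : 0 < J - J0 by lra.
(* On the support of [chi] the hat of slope [(J - J0)^-1] is at least 1, whereas [chi] is bounded by
   [psi <= 1]. *)
have hat x : `|x| <= J + h -> `|chi x| <= (J - J0)^-1 * (J + h - `|x|).
  move=> xJ; case: (leP `|x| J0) => xJ0.
    rewrite (le_trans (chipsi x))// (le_trans (psi_le1 x))// mulrC ler_pdivlMr//; lra.
  rewrite chioff ?normr0; first by rewrite mulr_ge0 ?invr_ge0 ?(ltW JJ0)//; lra.
  move: xJ0; rewrite ltr_normr !negb_and -!ltNge -!leNgt => /orP[xo|xo]; apply/orP.
    by right; lra.
  by left; lra.
apply/ler_addgt0Pl => e e0.
set Q := I (fun x => seg (-J) J x * I (fun s => _ * _ ^+ 2)).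
set K := I (fun x => seg (-J) J x * (_ * psi x)).
pose cb := h ^- 2 * (4 * (L * M)) + M.
pose X := (4 * mm * nu)^-1 * (2 * ((L + 1) * (cb * tau)) ^+ 2 * (tau * (2 * J))).
pose Y := h ^- 2 * ((L + 1) * tau).
have X0 : 0 <= X.
  rewrite /X; apply: mulr_ge0; first by rewrite invr_ge0 !mulr_ge0// ltW.
  apply: mulr_ge0; first by apply: mulr_ge0 => //; exact: sqr_ge0.
  by apply: mulr_ge0; [exact: ltW|lra].
have Y0 : 0 <= Y by rewrite /Y !mulr_ge0 ?addr_ge0 ?invr_ge0 ?sqr_ge0// ltW.
(* The freezing error is [X / N^2], so [N >= X / e] makes it at most [e]; [N >= 4 * Y] is the
   stability condition. *)
pose N := (Num.truncn (X / e + 4 * Y)).+1.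
have NX : X / e + 4 * Y <= N%:R by rewrite ltW// truncnS_gt.
have XE : 0 <= X / e by rewrite divr_ge0// ltW.
have N0 : 0 < N%:R :> R by rewrite ltr0n.
have N1 : 1 <= N%:R :> R by rewrite ler1n.
have small : h ^- 2 * ((L + 1) * (tau / N%:R)) <= 4^-1.
  have -> : h ^- 2 * ((L + 1) * (tau / N%:R)) = Y / N%:R by rewrite /Y; ring.
  rewrite ler_pdivrMr//; lra.
have chi1 x : `|chi x| <= 1 * psi x by rewrite mul1r.
have c0 : 0 <= (J - J0)^-1 by rewrite invr_ge0 ltW.
have hJ : h <= J by lra.
have := scheme_step T0 mw ma mf wM aL fM woff foff h0 h1 hJ nu0 nu1 mm0 tau0
  (isT : (0 < N)%N) small ler01 c0 bchi chioffJ chi1 hat.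
rewrite mul1r -/Q -/K -/cb => st; apply: (le_trans st).
have E1 : mm / h ^+ 2 * energy h chi <= mm * (l ^+ 2 * (2 * J0 + 2)).
  rewrite -mulrA ler_wpM2l ?(ltW mm0)// mulrC ler_pdivrMr ?exprn_gt0//.
  by rewrite mulrC.
have E2 : (4 * mm * nu)^-1 * (2 * ((L + 1) * (cb * (tau / N%:R))) ^+ 2 * (tau * (2 * J))) <= e.
  rewrite (_ : _ * _ = X / N%:R ^+ 2); last first.
    by rewrite /X; field; rewrite !gt_eqF.
  rewrite ler_pdivrMr ?exprn_gt0//.
  have : X <= e * N%:R by rewrite mulrC -ler_pdivrMr//; lra.
  move/le_trans; apply; rewrite ler_wpM2l ?(ltW e0)// expr2 ler_peMl//; exact: ltW.
have E3 : (4 * mm * nu)^-1 * (2 * Q) = (2 * mm * nu)^-1 * Q.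
  by field; rewrite !gt_eqF.
rewrite mulrDr E3; lra.
Qed.

Hypothesis kwE : forall h x, 0 < h ->
  {ae mu, forall t, 0 < t < T -> kw w h x t = ww w a f h x t}.

Let hn n : R := n.+1%:R^-1.
Let hn0 n : 0 < hn n. Proof. by rewrite invr_gt0. Qed.
Let hn1 n : hn n <= 1. Proof. by rewrite invf_le1 ?ler1n. Qed.

(** [kwE] fixes [x] and discards a null set of times, but duality works at a fixed time. Fubini for
    the difference, weighted by [psi] to be integrable, exchanges the roles; the radii [hn n] are
    countable, so one null set serves them all. *)
Lemma good_times : {ae mu, forall tau, 0 < tau < T ->
  forall n, {ae mu, forall x, kw w (hn n) x tau = ww w a f (hn n) x tau}}.
Proof.
suff H n : {ae mu, forall tau, 0 < tau < T ->
    {ae mu, forall x, kw w (hn n) x tau = ww w a f (hn n) x tau}}.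
  by apply: ae_imp (ae_all H) => tau h tT n; exact: h.
pose d (z : R * R) := `|kw w (hn n) z.1 z.2 - ww w a f (hn n) z.1 z.2|.
have bd : bmf d by apply/bmf_abs/bmfB; [exact: bkw|exact: bww].
have [md [C dC]] := bd.
pose G (z : R * R) := psi z.1 * seg 0 T z.2 * d z.
have mG : measurable_fun setT G.
  apply: measurable_funM => //; apply: measurable_funM.
    exact: (bmf_comp (bmf_psi R) measurable_fst).1.
  exact: (measurableT_comp (measurable_seg _ _) measurable_snd).
have p0 x : 0 <= psi x :> R by rewrite ltW// psi_gt0.
have G0 z : 0 <= G z.
  by apply: mulr_ge0; [apply: mulr_ge0; [exact: p0|exact: seg_ge0]|exact: normr_ge0].
have iG : itg (mu \x mu)%E G.
  apply: (@itg_prod _ _ _ _ _ mu mu (fun x => C * psi x) (seg 0 T)) => //.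
  - by apply: itgZ; exact: itg_psi.
  - exact: itg_seg.
  - move=> z; rewrite /G !normrM (ger0_norm (seg_ge0 _ _ _)) (ger0_norm (p0 _)).
    by rewrite mulrC mulrA ler_wpM2r ?seg_ge0// ler_wpM2r.
have bx x : bmf (fun s => d (x, s)) by exact: (bmf_comp bd (pair1_measurable x)).
have bs s : bmf (fun x => d (x, s)) by exact: (bmf_comp bd (pair2_measurable s)).
have ip s : itg mu (fun x => psi x * d (x, s)).
  by apply: itgM; [exact: itg_psi|exact: bs].
have [|_ e1] := fubini_iter1 iG.
  move=> x; apply: eq_itg (itgZ (psi x) (itg_seg_bmf 0 T (bx x))) => s.
  by rewrite /G mulrA.
have i2 s : itg mu (fun x => G (x, s)).
  by apply: eq_itg (itgZ (seg 0 T s) (ip s)) => x; rewrite /G mulrA (mulrC (seg 0 T s)).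
have [i2' e2] := fubini_iter2 iG i2.
have Z : Int (mu \x mu)%E G = 0.
  rewrite -e1 -[RHS](Int0 mu); apply: eq_Int => x.
  rewrite -[RHS](Int0 mu); apply: Int_ae_eq.
  - exact: (measurableT_comp mG (pair1_measurable x)).
  - exact: measurable_cst.
  (* Time 0 belongs to the support of [seg 0 T] but is not covered by [kwE]. *)
  - have n00 : {ae mu, forall t : R, t != 0}.
      exists [set 0]; split => //; first exact: lebesgue_measure_set1.
      by move=> t /= /negP; rewrite negbK => /eqP.
    apply: ae_imp (ae_and (kwE x (hn0 n)) n00) => t [kt t0].
    rewrite /G /d /= /seg; case: (boolP (0 <= t < T)) => [/andP[t1 t2]|_].
      by rewrite kt ?subrr ?normr0 ?mulr0// t2 lt_neqAle eq_sym t0 t1.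
    by rewrite mulr0 mul0r.
have {Z} : Int mu (fun s => `|Int mu (fun x => G (x, s))|) = 0.
  apply: (etrans _ (etrans e2 Z)); apply: eq_Int => s.
  apply: ger0_norm; apply: Int_ge0 => x.
  exact: G0.
move/(Int_eq0 i2'); apply: ae_imp => tau Gt /andP[t1 t2].
have : Int mu (fun x => `|G (x, tau)|) = 0.
  by apply: (etrans _ Gt); apply: eq_Int => x; apply: ger0_norm; exact: G0.
move/(Int_eq0 (i2 tau)); apply: ae_imp => x.
rewrite /G /d /= /seg (ltW t1) t2 mulr1 => /eqP.
rewrite mulf_eq0 gt_eqF ?psi_gt0//= normr_eq0 subr_eq0 => /eqP.
exact.
Qed.

Definition fpsi tau := I (fun x => I (fun s => seg 0 tau s * `|f (x, s)|) * psi x).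

Let bslab_f tau : bmf (fun x => I (fun s => seg 0 tau s * `|f (x, s)|)).
Proof. exact: (bmf_slab 0 tau (bmf_abs bf)). Qed.

Let itg_fpsi tau : itg mu (fun x => I (fun s => seg 0 tau s * `|f (x, s)|) * psi x).
Proof. by apply: itgMl; [exact: itg_psi|exact: bslab_f]. Qed.

Lemma dbl_itg J tau (g : R * R -> R) : bmf g ->
  itg mu (fun x => seg (-J) J x * I (fun s => seg 0 tau s * g (x, s))).
Proof. by move=> bg; apply: itg_seg_bmf; exact: (bmf_slab 0 tau bg). Qed.

Definition dbl J tau (g : R * R -> R) :=
  I (fun x => seg (-J) J x * I (fun s => seg 0 tau s * g (x, s))).

Lemma dblD J tau g1 g2 : bmf g1 -> bmf g2 ->
  dbl J tau (fun z => g1 z + g2 z) = dbl J tau g1 + dbl J tau g2.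
Proof.
move=> b1 b2; rewrite /dbl -IntD; [|exact: dbl_itg|exact: dbl_itg].
apply: eq_Int => x; rewrite -mulrDr -IntD.
- by congr (_ * _); apply: eq_Int => s; rewrite mulrDr.
- by apply: itg_seg_bmf; exact: bmf_slice.
- by apply: itg_seg_bmf; exact: bmf_slice.
Qed.

Lemma dblZ J tau c g : bmf g -> dbl J tau (fun z => c * g z) = c * dbl J tau g.
Proof.
move=> bg; rewrite /dbl -IntZ; last exact: dbl_itg.
apply: eq_Int => x; have ig := itg_seg_bmf 0 tau (bmf_slice x bg).
rewrite mulrCA -(IntZ c ig); congr (_ * _).
by apply: eq_Int => s; rewrite mulrCA.
Qed.

Lemma dbl_cst J tau c : 0 <= J -> 0 <= tau ->
  dbl J tau (fun=> c) = c * (tau * (2 * J)).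
Proof.
move=> J0 t0; transitivity (I (fun x => c * tau * seg (-J) J x)).
  apply: eq_Int => x; rewrite (eq_Int mu (g := fun s => c * seg 0 tau s)).
    by rewrite (IntZ _ (itg_seg 0 tau)) Int_seg//; ring.
  by move=> s; rewrite mulrC.
by rewrite (IntZ _ (itg_seg (-J) J)) Int_seg; [ring|lra].
Qed.

Lemma ler_dbl J tau g1 g2 : bmf g1 -> bmf g2 -> (forall z, g1 z <= g2 z) ->
  dbl J tau g1 <= dbl J tau g2.
Proof.
move=> b1 b2 g12; apply: ler_Int; [exact: dbl_itg|exact: dbl_itg|] => x.
apply: ler_wpM2l; first exact: seg_ge0.
apply: ler_Int; [apply: itg_seg_bmf; exact: bmf_slice|apply: itg_seg_bmf; exact: bmf_slice|].
by move=> s; apply: ler_wpM2l; [exact: seg_ge0|exact: g12].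
Qed.

Let bmoll kp h (g : R * R -> R) : is_kernel kp -> 0 < h -> bmf g ->
  bmf (fun z => `|mollify kp h (fun y => g (y, z.2)) z.1 - g z|).
Proof. by move=> kk h0 bg; apply/bmf_abs/bmfB; [exact: bmf_mollify2|]. Qed.

Definition moll_err J tau kp h (g : R * R -> R) :=
  dbl J tau (fun z => `|mollify kp h (fun y => g (y, z.2)) z.1 - g z|).

Lemma pairing_err h J0 tau (chi : R -> R) : 0 < h -> bmf chi -> vanish_off J0 chi ->
  (forall x, `|chi x| <= 1) ->
  {ae mu, forall x, kw w h x tau = ww w a f h x tau} ->
  `|I (fun x => w (x, tau) * chi x)| <= `|I (fun x => ww w a f h x tau * chi x)| +
    I (fun x => seg (-J0) J0 x * `|mollify cub h (fun y => w (y, tau)) x - w (x, tau)|).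
Proof.
move=> h0 bchi chioff chi1 good.
have bwt : bmf (fun x => w (x, tau)) by exact: (bmf_comp bw (pair2_measurable tau)).
have bkt : bmf (fun x => kw w h x tau) by exact: (bmf_comp (bkw h0) (pair2_measurable tau)).
have bwwt : bmf (fun x => ww w a f h x tau).
  exact: (bmf_comp (bww h0) (pair2_measurable tau)).
have ichi := itg_vanish bchi chioff.
have -> : I (fun x => ww w a f h x tau * chi x) = I (fun x => kw w h x tau * chi x).
  apply: Int_ae_eq; [exact: (bmfM bwwt bchi).1|exact: (bmfM bkt bchi).1|].
  by apply: ae_imp good => x ->.
rewrite (eq_Int mu (g := fun x => kw w h x tau * chi x -
    (kw w h x tau - w (x, tau)) * chi x)); last by move=> x; ring.
have i1 := itgMl ichi bkt; have i2 := itgMl ichi (bmfB bkt bwt).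
rewrite (IntB i1 i2); apply: (le_trans (ler_normB _ _)); rewrite lerD2l.
apply: (le_trans (Int_abs i2)); apply: ler_Int; first exact: itg_abs.
  by apply: itg_seg_bmf; apply/bmf_abs; exact: (bmfB bkt bwt).
move=> x; rewrite -(vanish_off_seg x chioff) !normrM (ger0_norm (seg_ge0 _ _ _)).
rewrite mulrCA; apply: ler_wpM2l; first exact: seg_ge0.
by rewrite -[leRHS]mulr1; apply: ler_wpM2l; [exact: normr_ge0|exact: chi1].
Qed.

(** Uniform bound for the smoothing part of [qk], used to trade a square for a first power. *)
Let B := 2 * (L * M) + (L + 1) * (2 * M).

(** [qq] with the primitive [ww] replaced by the mollification [kw]: almost everywhere the same on
    the time interval, but its limit as [h] tends to 0 is known. *)
Let qk h nu (z : R * R) := bp w a h z.1 z.2 - (a z + nu) * kw w h z.1 z.2.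

Let bqk h nu : 0 < h -> bmf (qk h nu).
Proof.
move=> h0; apply: bmfB; first exact: bbp.
by apply: bmfM; [apply: bmfD; [exact: ba|exact: bmf_cst]|exact: bkw].
Qed.

Lemma qq_kw h nu J tau : 0 < h -> tau < T ->
  I (fun x => seg (-J) J x * I (fun s => seg 0 tau s * qq w a f h nu (x, s) ^+ 2)) =
  dbl J tau (fun z => qk h nu z ^+ 2).
Proof.
move=> h0 tauT.
have bqq : bmf (qq w a f h nu).
  apply: bmfB; first exact: bbp.
  by apply: bmfM; [apply: bmfD; [exact: ba|exact: bmf_cst]|exact: bww].
rewrite /dbl; apply: eq_Int => x; congr (_ * _); apply: Int_ae_eq.
- exact: (bmfM (bmf_seg _ _) (bmf_slice x (bmfX 2 bqq))).1.
- exact: (bmfM (bmf_seg _ _) (bmf_slice x (bmfX 2 (bqk nu h0)))).1.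
have n00 : {ae mu, forall t : R, t != 0}.
  exists [set 0]; split => //; first exact: lebesgue_measure_set1.
  by move=> t /= /negP; rewrite negbK => /eqP.
apply: ae_imp (ae_and (kwE x h0) n00) => t [kt t0].
rewrite /seg; case: (boolP (0 <= t < tau)) => [/andP[t1 t2]|_]; last by rewrite !mul0r.
rewrite /qk /qq /= kt; first by [].
by rewrite lt_neqAle eq_sym t0 t1/=; exact: lt_trans tauT.
Qed.

(** [qk] is a smoothing error [r] minus the viscosity error [nu * w]. Since [r] is bounded by [B],
    its square is at most [B] times the smoothing errors in absolute value, and L1 convergence of
    the mollifications is enough. *)
Lemma qk_le h nu z : 0 < h -> 0 < nu -> nu <= 1 ->
  qk h nu z ^+ 2 <= 2 * (nu * M) ^+ 2 + 2 * B *
    (`|bp w a h z.1 z.2 - a z * w z| + (L + 1) * `|kw w h z.1 z.2 - w z|).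
Proof.
move=> h0 nu0 nu1.
set P1 := `|bp _ _ _ _ _ - _|; set P2 := `|kw _ _ _ _ - _|.
have /andP[a0 a1] := aL z.
have L1 : 0 <= L + 1 by apply: addr_ge0.
pose r := (bp w a h z.1 z.2 - a z * w z) - (a z + nu) * (kw w h z.1 z.2 - w z).
have -> : qk h nu z = r - nu * w z by rewrite /qk /r; ring.
have ru : `|r| <= P1 + (L + 1) * P2.
  rewrite /r; apply: (le_trans (ler_normB _ _)); rewrite lerD2l.
  rewrite normrM; apply: ler_wpM2r; first exact: normr_ge0.
  by rewrite ger0_norm; [exact: lerD|apply: addr_ge0 => //; exact: ltW].
have uB : P1 + (L + 1) * P2 <= B.
  have awM z' : `|a z' * w z'| <= L * M.
    by have /andP[b0 b1] := aL z'; rewrite normrM (ger0_norm b0) ler_pM.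
  rewrite /B; apply: lerD.
    rewrite /P1; apply: (le_trans (ler_normB _ _)).
    by rewrite mulr2n mulrDl mul1r; apply: lerD => //; exact: (bp_le mw ma wM aL).
  apply: ler_wpM2l => //; rewrite /P2; apply: (le_trans (ler_normB _ _)).
  by rewrite mulr2n mulrDl mul1r; apply: lerD => //; exact: (kf_le mw wM).
have u0 : 0 <= P1 + (L + 1) * P2 by apply: le_trans ru.
have r2 : r ^+ 2 <= B * (P1 + (L + 1) * P2).
  rewrite -[r ^+ 2]real_normK ?num_real// expr2; apply: ler_pM => //.
  exact: le_trans uB.
have nw2 : (nu * w z) ^+ 2 <= (nu * M) ^+ 2.
  rewrite -[(nu * w z) ^+ 2]real_normK ?num_real// lerXn2r ?nnegrE//.
    by rewrite mulr_ge0// ltW.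
  by rewrite normrM (gtr0_norm nu0) ler_wpM2l// ltW.
by rewrite -mulrA; exact: (sqr_sub_le r2 nw2 (sqr_ge0 _)).
Qed.

Lemma qq_err h nu J tau : 0 < h -> 0 < nu -> nu <= 1 -> 0 <= J -> 0 <= tau -> tau < T ->
  I (fun x => seg (-J) J x * I (fun s => seg 0 tau s * qq w a f h nu (x, s) ^+ 2))
  <= 2 * (nu * M) ^+ 2 * (tau * (2 * J)) +
    2 * B * (moll_err J tau tent h (fun z => a z * w z) + (L + 1) * moll_err J tau cub h w).
Proof.
move=> h0 nu0 nu1 J0 tau0 tauT; rewrite qq_kw//.
have b1 := bmoll (tent_kernel R) h0 baw.
have b2 := bmoll (cub_kernel R) h0 bw.
have b3 := bmfM (bmf_cst (R * R)%type (L + 1)) b2.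
have b4 := bmfD b1 b3.
have b5 := bmfM (bmf_cst (R * R)%type (2 * B)) b4.
have bc := bmf_cst (R * R)%type (2 * (nu * M) ^+ 2).
have <- : dbl J tau (fun z => 2 * (nu * M) ^+ 2 + 2 * B *
   (`|mollify tent h (fun y => a (y, z.2) * w (y, z.2)) z.1 - a z * w z| +
    (L + 1) * `|mollify cub h (fun y => w (y, z.2)) z.1 - w z|)) =
   2 * (nu * M) ^+ 2 * (tau * (2 * J)) +
    2 * B * (moll_err J tau tent h (fun z => a z * w z) + (L + 1) * moll_err J tau cub h w).
  apply: (etrans (dblD J tau bc b5)); congr (_ + _); first exact: dbl_cst.
  apply: (etrans (dblZ J tau (2 * B) b4)); congr (_ * _).
  apply: (etrans (dblD J tau b1 b3)); congr (_ + _).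
  exact: (dblZ J tau (L + 1) b2).
apply: ler_dbl; first exact: (bmfX 2 (bqk nu h0)).
  exact: (bmfD (bmf_cst (R * R)%type _) b5).
by move=> z; exact: qk_le.
Qed.

Lemma kf_err h J tau : 0 < h ->
  I (fun x => seg (-J) J x * (I (fun s => seg 0 tau s * `|kf f h x s|) * psi x))
  <= fpsi tau + moll_err J tau cub h f.
Proof.
move=> h0; have bm3 := bmoll (cub_kernel R) h0 bf.
have id := dbl_itg J tau bm3.
have bk := bmf_abs (bkf h0).
rewrite /fpsi -(IntD (itg_fpsi tau) id); apply: ler_Int.
- by apply: itg_seg_bmf; apply: bmfM; [exact: (bmf_slab 0 tau bk)|exact: bmf_psi].
- by apply: itgD; [exact: itg_fpsi|exact: id].
move=> x.
pose U := I (fun s => seg 0 tau s * `|f (x, s)|).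
pose V := I (fun s => seg 0 tau s * `|mollify cub h (fun y => f (y, s)) x - f (x, s)|).
have iU : itg mu (fun s => seg 0 tau s * `|f (x, s)|).
  by apply: itg_seg_bmf; exact: (bmf_slice x (bmf_abs bf)).
have iV : itg mu (fun s => seg 0 tau s *
    `|mollify cub h (fun y => f (y, s)) x - f (x, s)|).
  by apply: itg_seg_bmf; exact: (bmf_slice x bm3).
have UV : I (fun s => seg 0 tau s * `|kf f h x s|) <= U + V.
  rewrite /U /V -(IntD iU iV); apply: ler_Int.
  - by apply: itg_seg_bmf; exact: (bmf_slice x bk).
  - exact: itgD.
  move=> s; rewrite -mulrDr; apply: ler_wpM2l; first exact: seg_ge0.
  by rewrite addrC -[X in `|X| <= _](subrK (f (x, s))); exact: ler_normD.
have U0 : 0 <= U by apply: Int_ge0 => s; rewrite mulr_ge0 ?seg_ge0.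
have V0 : 0 <= V by apply: Int_ge0 => s; rewrite mulr_ge0 ?seg_ge0.
have p0 := ltW (psi_gt0 x); have p1 := psi_le1 x.
have s0 := seg_ge0 (-J) J x; have s1 := seg_le1 (-J) J x.
rewrite -/U -/V; apply: (@le_trans _ _ (seg (-J) J x * ((U + V) * psi x))).
  by apply: ler_wpM2l => //; exact: ler_wpM2r.
rewrite mulrDl mulrDr; apply: lerD.
  by rewrite ler_piMl// mulr_ge0.
by apply: ler_wpM2l => //; rewrite ler_piMr.
Qed.

(** Here [h] tends to 0 through the [hn n], all other parameters being fixed: every smoothing error
    disappears. In what remains of the consistency term, [nu] occurs squared over [nu]. *)
Lemma dual_bound0 tau J J0 nu mm (chi : R -> R) l :
  0 < tau < T ->
  (forall n, {ae mu, forall x, kw w (hn n) x tau = ww w a f (hn n) x tau}) ->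
  0 <= J0 -> J0 < J -> 1 <= J -> 0 < nu -> nu <= 1 -> 0 < mm ->
  bmf chi -> vanish_off J0 chi ->
  (forall h x, 0 < h -> `|chi (x + h) - chi x| <= l * h) ->
  (forall x, `|chi x| <= psi x) ->
  `|I (fun x => w (x, tau) * chi x)| <= mm * (l ^+ 2 * (2 * J0 + 2)) +
    (2 * mm * nu)^-1 * (2 * (nu * M) ^+ 2 * (tau * (2 * J))) +
    4 * tau * (L * M) / (J - J0) + expR (3 * (L + 1) * tau) * fpsi tau.
Proof.
move=> /andP[tau0 tauT] good J00 J0J J1 nu0 nu1 mm0 bchi chioff lip chipsi.
have chi1 x : `|chi x| <= 1 := le_trans (chipsi x) (psi_le1 x).
have c1 : 0 <= (2 * mm * nu)^-1 by rewrite invr_ge0 !mulr_ge0// ltW.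
have c2 : 0 <= expR (3 * (L + 1) * tau) by exact: expR_ge0.
have J0' : 0 <= J by exact: le_trans (ltW J0J).
apply/ler_addgt0Pl => e e0.
have [n en] : exists n, I (fun x => seg (-J0) J0 x *
       `|mollify cub (hn n) (fun y => w (y, tau)) x - w (x, tau)|) +
    (2 * mm * nu)^-1 * (2 * B * (moll_err J tau tent (hn n) (fun z => a z * w z)
      + (L + 1) * moll_err J tau cub (hn n) w)) +
    expR (3 * (L + 1) * tau) * moll_err J tau cub (hn n) f <= e.
  pose er n : R := I (fun x => seg (-J0) J0 x *
       `|mollify cub (hn n) (fun y => w (y, tau)) x - w (x, tau)|) +
    (2 * mm * nu)^-1 * (2 * B * (moll_err J tau tent (hn n) (fun z => a z * w z)
      + (L + 1) * moll_err J tau cub (hn n) w)) +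
    expR (3 * (L + 1) * tau) * moll_err J tau cub (hn n) f.
  have er0 : er n @[n --> \oo] --> 0.
    have z : (0 + (2 * mm * nu)^-1 * (2 * B * (0 + (L + 1) * 0)) +
      expR (3 * (L + 1) * tau) * 0 : R) = 0 by rewrite !(mulr0, addr0).
    have bwt : bmf (fun x => w (x, tau)) by exact: (bmf_comp bw (pair2_measurable tau)).
    rewrite -[X in _ --> X]z; apply: cvgD; first apply: cvgD.
    - exact: (mollify_cvg_L1 J0 (cub_kernel R) bwt).
    - apply: cvgMr; apply: cvgMr; apply: cvgD; last apply: cvgMr.
        exact: (mollify_L1_xs J tau (tent_kernel R) baw).
      exact: (mollify_L1_xs J tau (cub_kernel R) bw).
    - by apply: cvgMr; exact: (mollify_L1_xs J tau (cub_kernel R) bf).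
  move/cvgr0Pnorm_le: er0 => /(_ _ e0)[n _ /(_ n (leqnn n)) /= Ene].
  by exists n; exact: le_trans (ler_norm _) Ene.
have h0 := hn0 n; have h1 := hn1 n.
apply: (collect_errors en (scheme_limit h0 h1 J00 J0J J1 nu0 nu1 mm0 tau0 bchi chioff
  (fun x => lip _ x h0) chipsi) (ler_wpM2l c1 (qq_err h0 nu0 nu1 J0' (ltW tau0) tauT))
  (ler_wpM2l c2 (kf_err J tau h0))).
exact: pairing_err.
Qed.

End Limits.

(** * Choice of the parameters and the weighted L1 bound *)

Section Weighted.
Context (R : realType).
Local Notation mu := (@lebesgue_measure R).
Local Notation I := (Int (@lebesgue_measure R)).
Variables (T M L : R) (w a f : R * R -> R).
Hypotheses (T0 : 0 < T) (mw : measurable_fun setT w)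
  (ma : measurable_fun setT a) (mf : measurable_fun setT f)
  (wM : forall z, `|w z| <= M) (aL : forall z, 0 <= a z <= L)
  (fM : forall z, `|f z| <= M)
  (woff : forall x t, ~~ (0 <= t < T) -> w (x, t) = 0)
  (foff : forall x t, ~~ (0 <= t < T) -> f (x, t) = 0).
Implicit Types (h x t s : R).
Hypothesis kwE : forall h x, 0 < h ->
  {ae mu, forall t, 0 < t < T -> kw w h x t = ww w a f h x t}.

Let M0 : 0 <= M. Proof. exact: le_trans (wM (0, 0)). Qed.
Let L0 : 0 <= L. Proof. by have /andP[+ ] := aL (0, 0); apply: le_trans. Qed.
Let bw : bmf w. Proof. by split => //; exists M. Qed.

(** Each of three errors gets [e / 3]: [mm] is fixed from the energy of [chi], then [J] from the
    flux through the ends, and last [nu], whose condition involves [J] and [mm]. *)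
Lemma dual_bound tau J0 (chi : R -> R) l :
  0 < tau < T ->
  (forall n, {ae mu, forall x, kw w n.+1%:R^-1 x tau = ww w a f n.+1%:R^-1 x tau}) ->
  0 <= J0 -> bmf chi -> vanish_off J0 chi ->
  (forall h x, 0 < h -> `|chi (x + h) - chi x| <= l * h) ->
  (forall x, `|chi x| <= psi x) ->
  `|I (fun x => w (x, tau) * chi x)| <= expR (3 * (L + 1) * tau) * fpsi f tau.
Proof.
move=> tauT good J00 bchi chioff lip chipsi.
have /andP[tau0 _] := tauT.
apply/ler_addgt0Pl => e e0.
have e3 : 0 < e / 3 by rewrite divr_gt0.
pose X := l ^+ 2 * (2 * J0 + 2); pose mm := (e / 3) / (X + 1).
have X0 : 0 <= X by rewrite mulr_ge0 ?sqr_ge0// addr_ge0// mulr_ge0.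
have X1 : 0 < X + 1 by rewrite ltr_wpDl.
have mm0 : 0 < mm by rewrite divr_gt0.
pose Y := 4 * tau * (L * M).
have Y0 : 0 <= Y by rewrite !mulr_ge0// ltW.
pose J := J0 + 1 + Y / (e / 3).
have Ye : 0 <= Y / (e / 3) by rewrite divr_ge0// ltW.
have J0J : J0 < J by rewrite /J; move: (Y / (e / 3)) Ye => u; lra.
have J1 : 1 <= J by rewrite /J; move: (Y / (e / 3)) Ye => u; lra.
pose Z := M ^+ 2 * (tau * (2 * J)) / mm.
have Z0 : 0 <= Z.
  rewrite /Z mulr_ge0 ?invr_ge0 ?(ltW mm0)// mulr_ge0 ?sqr_ge0//.
  by rewrite mulr_ge0 ?(ltW tau0)// mulr_ge0// (le_trans J00)// ltW.
pose nu := (1 + Z / (e / 3))^-1.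
have Zd : 0 <= Z / (e / 3) by rewrite divr_ge0// ltW.
have Zp : 0 < 1 + Z / (e / 3) by rewrite ltr_pwDl.
have nu0 : 0 < nu by rewrite invr_gt0.
have nu1 : nu <= 1 by rewrite invf_le1// lerDl.
have := dual_bound0 T0 mw ma mf wM aL fM woff foff kwE tauT good J00 J0J J1 nu0 nu1 mm0
  bchi chioff lip chipsi.
move/le_trans; apply; rewrite lerD2r.
have p1 : mm * (l ^+ 2 * (2 * J0 + 2)) <= e / 3.
  by rewrite -/X /mm mulrAC ler_pdivrMr// ler_wpM2l ?(ltW e3)// lerDl.
have p2 : (2 * mm * nu)^-1 * (2 * (nu * M) ^+ 2 * (tau * (2 * J))) <= e / 3.
  have -> : (2 * mm * nu)^-1 * (2 * (nu * M) ^+ 2 * (tau * (2 * J))) = Z * nu.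
    by rewrite /Z; field; rewrite (gt_eqF mm0) (gt_eqF nu0).
  rewrite /nu ler_pdivrMr// mulrDr mulr1 [X in _ + X]mulrC divfK ?gt_eqF// lerDr; exact: ltW.
have p3 : 4 * tau * (L * M) / (J - J0) <= e / 3.
  have JJ : 0 < J - J0 by rewrite subr_gt0.
  rewrite ler_pdivrMr// -/Y mulrC -ler_pdivrMr//.
  by rewrite /J; move: (Y / (e / 3)) => u; lra.
by move: p1 p2 p3; set u := mm * _; set v := _^-1 * _; set q := _ / (J - J0); lra.
Qed.

(** The ideal test function, [psi] times the sign of [w] on the window, is not Lipschitz. A tent
    mollification of the sign is, and since [w] is bounded the replacement costs at most [M + 1]
    times an L1 distance that can be made small. *)
Lemma weighted_L1_loc tau J1 : 0 < tau < T ->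
  (forall n, {ae mu, forall x, kw w n.+1%:R^-1 x tau = ww w a f n.+1%:R^-1 x tau}) ->
  0 <= J1 ->
  I (fun x => seg (-J1) J1 x * (`|w (x, tau)| * psi x)) <=
  expR (3 * (L + 1) * tau) * fpsi f tau.
Proof.
move=> tauT good J10.
have bwt : bmf (fun x => w (x, tau)) by exact: (bmf_comp bw (pair2_measurable tau)).
pose sg x := seg (-J1) J1 x * Num.sg (w (x, tau)).
have sgE x : w (x, tau) * sg x = seg (-J1) J1 x * `|w (x, tau)|.
  by rewrite /sg mulrCA [in RHS]normrEsg (mulrC (w _)).
have sg1 x : `|sg x| <= seg (-J1) J1 x.
  rewrite normrM (ger0_norm (seg_ge0 _ _ _)) -[leRHS]mulr1.
  by apply: ler_wpM2l; [exact: seg_ge0|rewrite normr_sg lern1 leq_b1].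
have msg : measurable_fun setT sg.
  apply: measurable_funM; first exact: measurable_seg.
  have -> : (fun x => Num.sg (w (x, tau))) =
     (fun x => (0 < w (x, tau))%R%:R - (w (x, tau) < 0)%R%:R).
    by apply/funext => x; case: (sgrP (w (x, tau))) => wx;
      rewrite ?ltxx ?wx ?(lt_gtF wx) ?subrr ?subr0 ?sub0r.
  apply: measurable_funB; apply: measurable_bool; apply: measurable_fun_ltr => //.
    exact: bwt.1.
  exact: bwt.1.
have bsg : bmf sg.
  by split => //; exists 1 => x; exact: le_trans (sg1 x) (seg_le1 _ _ _).
have sgoff : vanish_off J1 sg by move=> x xo; rewrite /sg /seg (negbTE xo) mul0r.
apply/ler_addgt0Pl => e e0.
have M1 : 0 < M + 1 by rewrite ltr_wpDl.
have [n en] : exists n, I (fun x => seg (- (J1 + 3)) (J1 + 3) x *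
    `|mollify tent n.+1%:R^-1 sg x - sg x|) <= e / (M + 1).
  have := mollify_cvg_L1 (J1 + 3) (tent_kernel R) bsg.
  move/cvgr0Pnorm_le => /(_ (e / (M + 1))); rewrite divr_gt0// => /(_ isT).
  move=> [n _ /(_ n (leqnn n)) /= H]; exists n; exact: le_trans (ler_norm _) H.
have r0 : 0 < n.+1%:R^-1 :> R by rewrite invr_gt0.
have r1 : n.+1%:R^-1 <= 1 :> R by rewrite invf_le1 ?ler1n.
set r := n.+1%:R^-1 in en r0 r1.
pose k := mollify tent r sg.
have bk : bmf k by apply: bmf_mollify => //; exact: tent_kernel.
have k1 x : `|k x| <= 1.
  apply: mollify_bound => //; first exact: tent_kernel.
  by move=> y; exact: le_trans (sg1 y) (seg_le1 _ _ _).
have koff : vanish_off (J1 + 3) k by exact: mollify_off.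
pose chi x := psi x * k x.
have bchi : bmf chi by apply: bmfM => //; exact: bmf_psi.
have chioff : vanish_off (J1 + 3) chi by exact: vanish_offM.
have chipsi x : `|chi x| <= psi x.
  rewrite normrM (ger0_norm (ltW (psi_gt0 x))) -[leRHS]mulr1.
  by apply: ler_wpM2l => //; exact: ltW (psi_gt0 x).
have lip h x : 0 < h -> `|chi (x + h) - chi x| <= (1 + 8 * J1 * r ^- 2) * h.
  move=> h0.
  have -> : chi (x + h) - chi x = (psi (x + h) - psi x) * k (x + h) + psi x * (k (x + h) - k x).
    by rewrite /chi; ring.
  apply: (le_trans (ler_normD _ _)); rewrite [leRHS]mulrDl mul1r !normrM; apply: lerD.
    rewrite -[leRHS]mulr1; apply: ler_pM => //.
    by rewrite -[leRHS](gtr0_norm h0); exact: psi_lip.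
  rewrite (ger0_norm (ltW (psi_gt0 x))) -[leRHS]mul1r.
  apply: ler_pM => //; [exact: ltW (psi_gt0 x)|exact: psi_le1|].
  by rewrite -[X in _ <= _ * X](gtr0_norm h0); exact: mollify_lip.
have J3 : 0 <= J1 + 3 by rewrite addr_ge0.
have db := dual_bound tauT good J3 bchi chioff lip chipsi.
have ipw : itg mu (fun x => w (x, tau) * psi x) by apply: itgMl => //; exact: itg_psi.
have i1 : itg mu (fun x => w (x, tau) * chi x).
  by apply: eq_itg (itgM ipw bk) => x; rewrite /chi mulrA.
have bd : bmf (fun x => k x - sg x) by exact: bmfB.
have i2 : itg mu (fun x => w (x, tau) * psi x * (k x - sg x)) by exact: itgM.
have -> : I (fun x => seg (-J1) J1 x * (`|w (x, tau)| * psi x)) =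
   I (fun x => w (x, tau) * chi x) - I (fun x => w (x, tau) * psi x * (k x - sg x)).
  rewrite -IntB//; apply: eq_Int => x; rewrite mulrA -sgE /chi; ring.
have d : `|I (fun x => w (x, tau) * psi x * (k x - sg x))| <= e.
  apply: (le_trans (Int_abs i2)).
  apply: (@le_trans _ _ (I (fun x => (M + 1) * (seg (- (J1 + 3)) (J1 + 3) x * `|k x - sg x|)))).
    have i3 := itg_seg_bmf (- (J1 + 3)) (J1 + 3) (bmf_abs bd).
    apply: ler_Int; [exact: itg_abs|exact: itgZ|] => x.
    have doff : vanish_off (J1 + 3) (fun x => k x - sg x).
      move=> y yo; rewrite koff// sgoff ?subrr//.
      move: yo; rewrite !negb_and -!ltNge -!leNgt => /orP[yo|yo]; apply/orP.
        by left; lra.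
      by right; lra.
    rewrite -[in leLHS](vanish_off_seg x doff) normrM (normrM (seg _ _ _)).
    rewrite (ger0_norm (seg_ge0 _ _ _)).
    apply: ler_wpM2r; first by rewrite mulr_ge0 ?seg_ge0.
    rewrite normrM (ger0_norm (ltW (psi_gt0 x))) -[leRHS]mulr1.
    apply: ler_pM => //; [exact: ltW (psi_gt0 x)| |exact: psi_le1].
    by apply: (le_trans (wM _)); rewrite lerDl.
  rewrite IntZ; last by apply: itg_seg_bmf; exact: bmf_abs.
  by rewrite mulrC -ler_pdivlMr.
apply: (le_trans (ler_norm _)); apply: (le_trans (ler_normB _ _)).
by rewrite addrC; apply: lerD.
Qed.

(** The windows [[-n, n)] exhaust the line by dominated convergence, and [tau <= T] makes the
    constant independent of [tau]. *)
Lemma weighted_L1 : {ae mu, forall tau, 0 < tau < T ->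
  I (fun x => `|w (x, tau)| * psi x) <= expR (3 * (L + 1) * T) * fpsi f tau}.
Proof.
apply: ae_imp (good_times T0 mw ma mf wM aL fM woff foff kwE) => tau good tauT.
have /andP[tau0 tauT'] := tauT.
have bwt : bmf (fun x => w (x, tau)) by exact: (bmf_comp bw (pair2_measurable tau)).
have iw : itg mu (fun x => `|w (x, tau)| * psi x).
  by apply: itgMl; [exact: itg_psi|exact: bmf_abs].
have F0 : 0 <= fpsi f tau.
  apply: Int_ge0 => x; rewrite mulr_ge0 ?(ltW (psi_gt0 x))//.
  by apply: Int_ge0 => s; rewrite mulr_ge0 ?seg_ge0.
apply: (@le_trans _ _ (expR (3 * (L + 1) * tau) * fpsi f tau)); last first.
  apply: ler_wpM2r => //; rewrite ler_expR; apply: ler_wpM2l; last exact: ltW.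
  by rewrite mulr_ge0// addr_ge0.
have bound n := weighted_L1_loc tauT (good tauT) (ler0n R n).
have cv : I (fun x => seg (- n%:R) n%:R x * (`|w (x, tau)| * psi x)) @[n --> \oo]
    --> I (fun x => `|w (x, tau)| * psi x).
  apply: (@Int_cvg _ (measurableTypeR R) R mu _ _ (fun x : R => `|w (x, tau)| * psi x)).
  - move=> n; apply: measurable_funM; first exact: measurable_seg.
    exact: itg_meas iw.
  - exact: iw.
  - move=> n x; rewrite normrM (ger0_norm (seg_ge0 _ _ _)).
    rewrite ger0_norm; first by rewrite ler_piMl ?seg_le1// mulr_ge0// ltW// psi_gt0.
    by rewrite mulr_ge0// ltW// psi_gt0.
  - exact: itg_meas iw.
  - apply: aeW => x; apply: cvg_near_cst.
    near=> n; have xn : `|x| < n%:R by near: n; exact: nbhs_infty_gtr.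
    rewrite /seg (_ : (_ && _) = true) ?mul1r//.
    by move: xn; rewrite ltr_norml => /andP[/ltW -> ->].
rewrite -(cvg_lim _ cv)//; apply: limr_le; first by apply/cvg_ex; eexists; exact: cv.
exact: nearW.
Unshelve. all: by end_near. Qed.

End Weighted.

(** * Time cutoffs and weak primitives *)

Section Step.
Context (R : realType).
Local Notation mu := (@lebesgue_measure R).
Local Notation I := (Int (@lebesgue_measure R)).
Implicit Types (x z h r t tau : R).

(** The primitive of [tent]: the second difference of halved truncated squares, rising from 0 at -1
    to 1 at 1. *)
Definition step z : R := (pos (z + 1) ^+ 2 - 2 * pos z ^+ 2 + pos (z - 1) ^+ 2) / 2.

Lemma is_derive_step z : is_derive z 1 step (tent z).
Proof.
pose P a := is_derive_affine (is_derive_pos2 (1 * z + a)).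
have H := is_derive_mull (2^-1) (is_derive_addf
  (is_derive_addf (P 1) (is_derive_mull (-2) (P 0))) (P (-1))).
have -> : step = (fun y => 2^-1 *
    (pos (1 * y + 1) ^+ 2 + -2 * pos (1 * y + 0) ^+ 2 + pos (1 * y - 1) ^+ 2)).
  by apply/funext => y; rewrite /step !mul1r addr0; ring.
by apply: (is_derive_eq H); rewrite /tent !mul1r addr0; field.
Qed.

Lemma step_le z : z <= -1 -> step z = 0.
Proof. by move=> z1; rewrite /step !pos_le; [rewrite !expr0n/=; ring|lra..]. Qed.

Lemma step_ge z : 1 <= z -> step z = 1.
Proof. by move=> z1; rewrite /step !pos_ge; [field|lra..]. Qed.

Lemma step_01 z : 0 <= step z <= 1.
Proof.
case: (leP z (-1)) => z1; first by rewrite step_le// lexx ler01.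
case: (leP 1 z) => z2; first by rewrite step_ge// lexx ler01.
rewrite /step (pos_ge (x := z + 1)); last lra.
rewrite (pos_le (x := z - 1)) ?expr0n/=; last lra.
case: (leP 0 z) => z0.
  by rewrite pos_ge//; apply/andP; split; nra.
by rewrite (pos_le (ltW z0)) expr0n/=; apply/andP; split; nra.
Qed.

Lemma measurable_step : measurable_fun setT step.
Proof.
apply: measurable_funM => //; apply: measurable_funD; last exact: measurable_pos.
apply: measurable_funB; first exact: measurable_pos.
apply: measurable_funM => //; have := measurable_pos 2 (0 : R).
by under eq_fun do rewrite addr0.
Qed.

Lemma bmf_step tau r : bmf (fun t => step ((tau - t) / r)).
Proof.
have bs : bmf step.
  split; first exact: measurable_step.
  by exists 1 => z; have /andP[s0 s1] := step_01 z; rewrite ger0_norm.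
apply: (bmf_comp bs); apply: measurable_funM => //; exact: measurable_funB.
Qed.

Lemma ae_neq tau : {ae mu, forall t : R, t != tau}.
Proof.
exists [set tau]; split => //; first exact: lebesgue_measure_set1.
by move=> t /= /negP; rewrite negbK => /eqP.
Qed.

(* Testing with [t |-> step ((tau - t) / r)], which decreases from 1 to 0 around [tau],
   recovers the value at [tau] of a weak primitive as [r] tends to 0. *)
Lemma weak_primitive (T : R) (W B : R -> R) : bmf W -> bmf B ->
  (forall t, ~~ (0 <= t < T) -> B t = 0) ->
  (forall tau r, 0 < tau -> 0 < r -> tau + r <= T ->
    mollify tent r W tau = I (fun t => B t * step ((tau - t) / r))) ->
  {ae mu, forall tau, 0 < tau < T -> W tau = I (fun s => seg 0 tau s * B s)}.
Proof.
move=> bW bB Boff H.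
apply: ae_imp (mollify_cvg (tent_kernel R) bW) => tau cW /andP[t0 tT].
have cI : I (fun t => B t * step ((tau - t) / n.+1%:R^-1)) @[n --> \oo] -->
    I (fun s => seg 0 tau s * B s).
  have [mB [C BC]] := bB.
  apply: (@Int_cvg _ (measurableTypeR R) R mu _ _ (fun s : R => C * seg 0 T s)).
  - by move=> n; exact: (bmfM bB (bmf_step tau _)).1.
  - by apply: itgZ; exact: itg_seg.
  - move=> n s; have /andP[s0 s1] := step_01 ((tau - s) / n.+1%:R^-1).
    rewrite normrM (ger0_norm s0) /seg.
    case: (boolP (0 <= s < T)) => sT; last by rewrite Boff// normr0 mul0r mulr0.
    by apply: ler_pM.
  - exact: (bmfM (bmf_seg 0 tau) bB).1.
  (* At [s = tau] the cutoff keeps the value one half for every [n]; this single point is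
     discarded. *)
  apply: ae_imp (ae_neq tau) => s stau; rewrite mulrC.
  case: (boolP (0 <= s < T)) => [/andP[s0 sT]|sT]; last first.
    by rewrite Boff// mul0r; under eq_fun do rewrite mul0r; exact: cvg_cst.
  apply: cvgMr.
  apply: cvg_near_cst; near=> n.
  have d0 : 0 < `|tau - s| by rewrite normr_gt0 subr_eq0 eq_sym.
  have nd : `|tau - s|^-1 < n%:R by near: n; exact: nbhs_infty_gtr.
  have n1 : 1 <= `|tau - s| / n.+1%:R^-1.
    rewrite invrK -ler_pdivrMl// mulr1 (le_trans (ltW nd))// ler_nat; exact: leqnSn.
  case: (ltP s tau) => st.
    rewrite step_ge; first by rewrite /seg s0 st.
    by move: n1; rewrite gtr0_norm ?subr_gt0.
  rewrite step_le; first by rewrite /seg s0 ltNge st.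
  by move: n1; rewrite ler0_norm ?subr_le0// mulNr lerNr.
have near_eq : \forall n \near \oo, mollify tent n.+1%:R^-1 W tau =
    I (fun t => B t * step ((tau - t) / n.+1%:R^-1)).
  near=> n; apply: H => //.
  have Tt : 0 < T - tau by rewrite subr_gt0.
  have nd : (T - tau)^-1 < n%:R by near: n; exact: nbhs_infty_gtr.
  rewrite -lerBrDl -[leRHS]invrK lef_pV2 ?posrE ?ltr0n ?invr_gt0//.
  by rewrite (le_trans (ltW nd))// ler_nat; exact: leqnSn.
have cW' : mollify tent n.+1%:R^-1 W tau @[n --> \oo] --> I (fun s => seg 0 tau s * B s).
  by apply: cvg_trans cI; apply: near_eq_cvg; apply: filterS near_eq => n ->.
exact: (cvg_unique _ cW cW').
Unshelve. all: by end_near. Qed.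

End Step.

(** * The weak formulation *)

Section TestFunctions.
Context (R : realType).
Implicit Types (x y z h r t tau : R).

Lemma is_derive_derivable (f : R -> R) x d : is_derive x 1 f d -> derivable f x 1.
Proof. by case. Qed.

Lemma is_derive_continuous (f g : R -> R) : (forall x, is_derive x 1 f (g x)) ->
  continuous f.
Proof.
move=> fg x; apply/differentiable_continuous/derivable1_diffP.
exact: is_derive_derivable (fg x).
Qed.

Lemma continuous_tent : continuous (@tent R).
Proof.
move=> x; apply/cvgrPdist_le => e e0.
have e4 : 0 < e / 4 by rewrite divr_gt0.
apply/nbhs_ballP; exists (e / 4) => //= z xz.
by rewrite (le_trans (tent_lip _ _))// mulrC -ler_pdivlMr// ltW.
Qed.

Lemma closure_sub_closed (T : topologicalType) (A D : set T) : closed D ->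
  A `<=` D -> closure A `<=` D.
Proof. by move=> cD AD; rewrite closureE; exact: smallest_sub. Qed.

(** The cubic spline centred at [y], followed by its first two derivatives in [x]; the sign in [kk1]
    comes from the argument [y - x]. *)
Definition kk y h x := h^-1 * cub ((y - x) / h).
Definition kk1 y h x := - h ^- 2 * cub1 ((y - x) / h).
Definition kk2 y h x := h ^- 3 * lap 1 tent ((y - x) / h).
Definition et tau r t := step ((tau - t) / r).
Definition et1 tau r t := - r^-1 * tent ((tau - t) / r).

Lemma is_derive_rescale (f : R -> R) y h x d : is_derive ((y - x) / h) 1 f d ->
  is_derive x 1 (fun z => f ((y - z) / h)) (- h^-1 * d).
Proof.
move=> fd; have e z : (y - z) / h = - h^-1 * z + y / h by rewrite mulrBl; ring.
rewrite (_ : (fun z => _) = (fun z => f (- h^-1 * z + y / h))); last first.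
  by apply/funext => z; rewrite e.
rewrite [X in is_derive _ _ _ X]mulrC; have fd' : is_derive (- h^-1 * x + y / h) 1 f d by rewrite -e.
exact: is_derive_affine fd'.
Qed.

Lemma is_derive_kk y h x : is_derive x 1 (kk y h) (kk1 y h x).
Proof.
have H := is_derive_mull h^-1 (is_derive_rescale (is_derive_cub ((y - x) / h))).
by apply: (is_derive_eq H); rewrite /kk1 -exprVn; ring.
Qed.

Lemma is_derive_kk1 y h x : is_derive x 1 (kk1 y h) (kk2 y h x).
Proof.
have H := is_derive_mull (- h ^- 2) (is_derive_rescale (is_derive_cub1 ((y - x) / h))).
by apply: (is_derive_eq H); rewrite /kk2 -!exprVn; ring.
Qed.

Lemma is_derive_et tau r t : is_derive t 1 (et tau r) (et1 tau r t).
Proof. exact: is_derive_rescale (is_derive_step _). Qed.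

Lemma continuous_rescale (f : R -> R) y h : continuous f ->
  continuous (fun z => f ((y - z) / h)).
Proof.
move=> cf x; apply: continuous_comp; last exact: cf.
by apply: cvgMl; apply: cvgB; [exact: cvg_cst|exact: cvg_id].
Qed.

Lemma continuous_kk y h : continuous (kk y h).
Proof. exact: is_derive_continuous (is_derive_kk y h). Qed.

Lemma continuous_kk1 y h : continuous (kk1 y h).
Proof. exact: is_derive_continuous (is_derive_kk1 y h). Qed.

Lemma continuous_kk2 y h : continuous (kk2 y h).
Proof.
move=> x; apply: cvgMr; apply: (@continuous_rescale (lap 1 tent)) => {}x.
have sh (c : R) : tent (u + c) @[u --> x] --> tent (x + c).
  apply: (@continuous_comp _ _ _ (fun u : R => u + c) tent); last exact: continuous_tent.
  by apply: cvgD; [exact: cvg_id|exact: cvg_cst].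
rewrite /lap; apply: cvgB; last by apply: cvgMr; exact: continuous_tent.
by apply: cvgD; exact: sh.
Qed.

Lemma continuous_et tau r : continuous (et tau r).
Proof. exact: is_derive_continuous (is_derive_et tau r). Qed.

Lemma continuous_et1 tau r : continuous (et1 tau r).
Proof.
by move=> t; apply: cvgMr; apply: (@continuous_rescale tent); exact: continuous_tent.
Qed.

Lemma cub1_off z : 2 <= `|z| -> cub1 z = 0.
Proof.
rewrite ler_normr => /orP[z2|z2]; rewrite /cub1.
  by rewrite !pos_ge; [field|lra..].
by rewrite !pos_le; [rewrite !expr0n/=; ring|lra..].
Qed.

Lemma rescale_off (f : R -> R) y h x : 0 < h -> (forall z, 2 <= `|z| -> f z = 0) ->
  f ((y - x) / h) != 0 -> `|x| <= `|y| + 2 * h.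
Proof.
move=> h0 foff; apply: contraNT; rewrite -ltNge => hx; apply/eqP; apply: foff.
rewrite normrM (gtr0_norm (x := h^-1)) ?invr_gt0// ler_pdivlMr//.
have := ler_normB x (x - y); rewrite opprB addrC subrK distrC.
have := ler_normD y (x - y); rewrite addrC subrK (distrC x y); lra.
Qed.

Lemma kk_off y h x : 0 < h -> kk y h x != 0 -> `|x| <= `|y| + 2 * h.
Proof.
move=> h0; rewrite /kk mulf_eq0 negb_or => /andP[_]; apply: rescale_off => //.
by case: (cub_kernel R).
Qed.

Lemma kk1_off y h x : 0 < h -> kk1 y h x != 0 -> `|x| <= `|y| + 2 * h.
Proof.
move=> h0; rewrite /kk1 mulf_eq0 negb_or => /andP[_]; apply: rescale_off => //.
exact: cub1_off.
Qed.

Lemma kk2_off y h x : 0 < h -> kk2 y h x != 0 -> `|x| <= `|y| + 2 * h.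
Proof.
move=> h0; rewrite /kk2 mulf_eq0 negb_or => /andP[_]; apply: rescale_off => // z z2.
have [_ _ _ _] := tent_kernel R.
have toff u : 1 <= `|u| -> tent u = 0.
  rewrite ler_normr => /orP[u1|u1]; rewrite /tent.
    by rewrite !pos_ge; [ring|lra..].
  by rewrite !pos_le; [ring|lra..].
move: z2; rewrite ler_normr /lap => /orP[z2|z2].
  by rewrite !toff; [ring|rewrite ger0_norm; lra..].
by rewrite !toff; [ring|rewrite ler0_norm; lra..].
Qed.

Lemma derive1_is (f : R -> R) x d : is_derive x 1 f d -> derive1 f x = d.
Proof. by move=> [_ <-]; rewrite derive1E. Qed.

(** The derivative of the spatial test function has itself to be a C1 test function for the weak
    derivative of [phi(u)]. This asks for a C2 spline, and the cubic one has the least degree. *)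
Lemma C1c_kk1 y h J : 0 < h -> `|y| + 2 * h < J -> C1c J (kk1 y h).
Proof.
move=> h0 yJ; split.
  have e : derive1 (kk1 y h) = kk2 y h.
    by apply/funext => x; apply: derive1_is; exact: is_derive_kk1.
  split.
    move=> m; rewrite ltnS leqn0 => /eqP -> x.
    exact: is_derive_derivable (is_derive_kk1 y h x).
  by rewrite /= e; exact: continuous_kk2.
pose D : set R := `[- (`|y| + 2 * h), `|y| + 2 * h]%classic.
have cD : closed D by exact: itv_closed.
apply: (@subset_trans _ D).
  apply: closure_sub_closed => // x /= /kk1_off xy.
  by rewrite /D /= in_itv /= -ler_norml xy.
by move=> x; rewrite /D /= !in_itv /= => /andP[x1 x2]; apply/andP; split; lra.
Qed.

Definition test y h tau r (z : R * R) := kk y h z.1 * et tau r z.2.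

Lemma dx_test y h tau r (z : R * R) : dx (test y h tau r) z = kk1 y h z.1 * et tau r z.2.
Proof.
rewrite /dx; apply: derive1_is; rewrite /test /= mulrC.
rewrite (_ : (fun x => _) = (fun x => et tau r z.2 * kk y h x)).
  exact: (is_derive_mull (et tau r z.2) (is_derive_kk y h z.1)).
by apply/funext => x; rewrite mulrC.
Qed.

Lemma dt_test y h tau r (z : R * R) : dt (test y h tau r) z = kk y h z.1 * et1 tau r z.2.
Proof.
by rewrite /dt; apply: derive1_is; exact: (is_derive_mull (kk y h z.1) (is_derive_et tau r z.2)).
Qed.

Lemma continuous_prod (f g : R -> R) : continuous f -> continuous g ->
  continuous (fun z : R * R => f z.1 * g z.2).
Proof.
move=> cf cg z; apply: cvgM.
  by apply: (@continuous_comp _ _ _ fst f); [exact: cvg_fst|exact: cf].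
by apply: (@continuous_comp _ _ _ snd g); [exact: cvg_snd|exact: cg].
Qed.

(** [tau + r <= T] makes the cutoff vanish at time [T]; at time 0 test functions are free, so small
    [tau] causes no difficulty. *)
Lemma test_fun_test (T : R) y h tau r : 0 < h -> 0 < r -> tau + r <= T ->
  test_fun T (test y h tau r).
Proof.
move=> h0 r0 tT; split.
- split.
  + apply: continuous_subspaceT; apply: continuous_prod.
      exact: continuous_kk.
    exact: continuous_et.
  + move=> z _; split.
      have d : is_derive z.1 1 (fun x => test y h tau r (x, z.2)) (kk1 y h z.1 * et tau r z.2).
        rewrite mulrC (_ : (fun x => _) = (fun x => et tau r z.2 * kk y h x)).
          exact: (is_derive_mull (et tau r z.2) (is_derive_kk y h z.1)).
        by apply/funext => x; rewrite /test /= mulrC.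
      exact: is_derive_derivable d.
    have d : is_derive z.2 1 (fun t => test y h tau r (z.1, t)) (kk y h z.1 * et1 tau r z.2).
      exact: (is_derive_mull (kk y h z.1) (is_derive_et tau r z.2)).
    exact: is_derive_derivable d.
  + exists (fun z : R * R => kk1 y h z.1 * et tau r z.2), (fun z : R * R => kk y h z.1 * et1 tau r z.2).
    split.
    * apply: continuous_subspaceT; apply: continuous_prod.
        exact: continuous_kk1.
      exact: continuous_et.
    * apply: continuous_subspaceT; apply: continuous_prod.
        exact: continuous_kk.
      exact: continuous_et1.
    * by move=> z _; rewrite dx_test dt_test.
- move=> x; rewrite /test /= /et step_le ?mulr0// ler_pdivrMr//; lra.
- exists (`|y| + 2 * h + 1); first by rewrite ltr_wpDl// addr_ge0// mulr_ge0// ltW.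
  set J := `|y| + 2 * h + 1.
  have cD : closed (`[- J, J]%classic `*` `[0, T]%classic : set (R * R)).
    have c1 : closed (fst @^-1` `[- J, J]%classic : set (R * R)).
      by apply: preimage_closed; [move=> p _; exact: cvg_fst|exact: itv_closed].
    have c2 : closed (snd @^-1` `[0, T]%classic : set (R * R)).
      by apply: preimage_closed; [move=> p _; exact: cvg_snd|exact: itv_closed].
    exact: closedI c1 c2.
  apply: closure_sub_closed => // z /= [[_ zT] zn0].
  split => //; move: zn0; rewrite /test mulf_eq0 negb_or => /andP[/kk_off zy _].
  rewrite in_itv /= -ler_norml (le_trans (zy h0))// lerDl//.
Qed.

End TestFunctions.

(** * Slices of null sets and bounded representatives *)

Section Slicing.
Context d1 d2 (X : measurableType d1) (Y : measurableType d2) (R : realType).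
Variables (m1 : {sigma_finite_measure set X -> \bar R})
  (m2 : {sigma_finite_measure set Y -> \bar R}).

(** The product measure of a set is the integral of the measures of its sections; if it is zero,
    almost every section is null. *)
Lemma ae_slice (P : X * Y -> Prop) : {ae (m1 \x m2)%E, forall z, P z} ->
  {ae m2, forall y, {ae m1, forall x, P (x, y)}}.
Proof.
move=> [A [mA A0 subA]].
pose f (z : X * Y) : \bar R := (\1_A z)%:E.
have mf : measurable_fun setT f.
  by apply/measurable_EFinP; exact: measurable_indic.
have f0 z : (0 <= f z)%E by rewrite lee_fin.
have GE : fubini_G m1 f = m1 \o ysection A by exact: indic_fubini_tonelli_GE.
have I0 : (\int[m2]_y `|(fubini_G m1 f) y| = 0)%E.
  transitivity (\int[m2]_y (fubini_G m1 f) y)%E.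
    by apply: eq_integral => y _; rewrite gee0_abs// GE.
  by rewrite -fubini_tonelli2// integral_indic// setIT.
have mG : measurable_fun setT (fubini_G m1 f).
  exact: measurable_fun_fubini_tonelli_G.
have := (ae_eq_integral_abs m2 measurableT mG).1 I0.
apply: ae_imp => y /(_ I); rewrite GE /= => Ay.
exists (ysection A y); split => //; first exact: measurable_ysection.
by move=> x /= nP; rewrite /ysection /= inE; exact: subA.
Qed.

End Slicing.

Section Representative.
Context d (X : measurableType d) (R : realType).
Variable mu : {measure set X -> \bar R}.

(** Values above a finite essential bound are set to 0, which changes [u] on a null set only and
    yields a bound valid everywhere. *)
Lemma bounded_representative (D : set X) (u : X -> R) : Lp_on mu +oo%E D u ->
  exists uh, [/\ bmf uh, (forall z, ~ D z -> uh z = 0) &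
    {ae mu, forall z, D z -> u z = uh z}].
Proof.
move=> Du; have := sub_Lfun_mfun Du; have := sub_Lfun_finLfun Du.
rewrite /finLfun !inE /= /finite_norm unlock => fin mf.
have {}mf : measurable_fun setT (u \_ D) by exact: mf.
have offD z : ~ D z -> (u \_ D) z = 0 by move=> nD; rewrite patchE memNset.
have onD z : D z -> (u \_ D) z = u z by move=> Dz; rewrite patchE mem_set.
(* The sup norm takes a default value when the whole space is null; in that case every property
   holds almost everywhere. *)
move: fin; case: ifPn => mu0 fin; last first.
  exists (fun=> 0); split => //; first exact: bmf_cst.
  exists setT; split => //; apply/eqP; move: mu0; rewrite lt0e negb_and negbK.
  by rewrite measure_ge0 orbF.
have [M uM] : exists M : R, {ae mu, forall z, `|(u \_ D) z| <= M}.
  have sup := ess_sup_ge mu (abse \o (EFin \o (u \_ D))).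
  have supfin : ess_sup mu (abse \o (EFin \o (u \_ D))) \is a fin_num \/
     ess_sup mu (abse \o (EFin \o (u \_ D))) = -oo%E.
    by move: fin; case: (ess_sup _ _) => [r||]; [left|..|right].
  case: supfin => [sf|se].
    exists (fine (ess_sup mu (abse \o (EFin \o (u \_ D))))).
    by apply: ae_imp sup => z; rewrite -[X in (_ <= X)%E](fineK sf) /= lee_fin.
  by exists 0; apply: ae_imp sup => z; rewrite se.
exists (fun z => if `|(u \_ D) z| <= M then (u \_ D) z else 0); split.
- split.
    apply: measurable_fun_ifT => //; apply: measurable_fun_ler => //.
    exact: measurableT_comp.
  exists `|M| => z; case: ifPn => [uz|_]; last by rewrite normr0.
  exact: (le_trans uz (ler_norm _)).
- by move=> z /offD ->; rewrite if_same.
- by apply: ae_imp uM => z + Dz; rewrite onD// => ->.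
Qed.

End Representative.

Section IteratedIntegral.
Context d1 d2 (X : measurableType d1) (Y : measurableType d2) (R : realType).
Variables (m1 : {sigma_finite_measure set X -> \bar R})
  (m2 : {sigma_finite_measure set Y -> \bar R}).

(** A form of Fubini with slices integrable only almost everywhere: it is meant for the weak
    derivative [p], about whose individual slices nothing is known. *)
Lemma Int_iter2 (g : X * Y -> R) : itg (m1 \x m2)%E g ->
  Int (m1 \x m2)%E g = Int m2 (fun y => Int m1 (fun x => g (x, y))).
Proof.
move=> ig; have mg := itg_meas ig.
have mE : measurable_fun setT (EFin \o g) by exact/measurable_EFinP.
rewrite {1}/Int /Rintegral -integral21_prod_meas1//.
rewrite [RHS]/Int /Rintegral; congr fine.
apply: ae_eq_integral => //.
- exact: (measurable_fubini_G ig).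
- by apply/measurable_EFinP; exact: measurable_Int2.
apply: ae_imp (ae_integrable2 ig) => y iy _ /=.
by rewrite EFin_Int.
Qed.

End IteratedIntegral.

Section CompactSupport.
Context (R : realType).
Local Notation mu := (@lebesgue_measure R).
Local Notation mu2 := ((@lebesgue_measure R) \x (@lebesgue_measure R))%E.
Implicit Types (f g : R * R -> R) (J T t : R).

Lemma itg2_off J T f : bmf f ->
  (forall z, f z != 0 -> `|z.1| <= J /\ 0 < z.2 < T) -> itg mu2 f.
Proof.
move=> [mf [C fC]] foff.
apply: (@itg_prod _ _ _ _ R mu mu (fun x => C * seg (- (J + 1)) (J + 1) x) (seg 0 T)) => //.
- by apply: itgZ; exact: itg_seg.
- exact: itg_seg.
move=> z; case: (eqVneq (f z) 0) => [->|/[dup] fz /foff [zJ /andP[z0 zT]]].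
  rewrite normr0 !mulr_ge0 ?seg_ge0//; exact: le_trans (fC z).
rewrite /seg (ltW z0) zT.
have /andP[J1 J2] : - (J + 1) < z.1 < J + 1.
  by rewrite -ltr_norml (le_lt_trans zJ)// ltrDl.
by rewrite (ltW J1) J2 !mulr1.
Qed.

Lemma itg_off_slice J f t : bmf f ->
  (forall z, f z != 0 -> `|z.1| <= J) -> itg mu (fun x => f (x, t)).
Proof.
move=> bf foff.
have b := bmf_comp bf (pair2_measurable t).
have := itg_seg_bmf (- (J + 1)) (J + 1) b; apply: eq_itg => x.
case: (eqVneq (f (x, t)) 0) => [->|/foff /= xJ]; first by rewrite mulr0.
have /andP[J1 J2] : - (J + 1) < x < J + 1.
  by rewrite -ltr_norml (le_lt_trans xJ)// ltrDl.
by rewrite /seg (ltW J1) J2 mul1r.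
Qed.

End CompactSupport.

(** * Integration by parts against the spline *)

Section Parts.
Context (R : realType).
Local Notation mu := (@lebesgue_measure R).
Local Notation mu2 := ((@lebesgue_measure R) \x (@lebesgue_measure R))%E.
Implicit Types (f p F : R * R -> R) (J T y h tau r t : R).

Lemma bmf_kk1 y h : 0 < h -> bmf (kk1 y h).
Proof.
move=> h0; split; first by apply: continuous_measurable_fun; exact: continuous_kk1 y h.
have c : {within `[- (`|y| + 2 * h), `|y| + 2 * h], continuous (fun x => `|kk1 y h x|)}.
  apply: continuous_subspaceT => x; apply: cvg_norm; exact: continuous_kk1.
have le : - (`|y| + 2 * h) <= `|y| + 2 * h.
  by rewrite ge0_cp// addr_ge0// mulr_ge0// ltW.
have [m _ mM] := EVT_max le c.
exists `|kk1 y h m| => x; case: (eqVneq (kk1 y h x) 0) => [->|/(kk1_off h0) xy].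
  by rewrite normr0.
by apply: mM; rewrite in_itv /= -ler_norml.
Qed.

Lemma bmf_kk2 y h : 0 < h -> bmf (kk2 y h).
Proof.
move=> h0; split; first by apply: continuous_measurable_fun; exact: continuous_kk2 y h.
exists (`|h ^- 3| * 4) => x; rewrite /kk2 normrM ler_wpM2l// /lap.
have t01 z : 0 <= @tent R z <= 1 by case: (tent_kernel R).
set a := tent _; set b := tent _; set c := tent _.
have : 0 <= a <= 1 by exact: t01.
have : 0 <= b <= 1 by exact: t01.
have : 0 <= c <= 1 by exact: t01.
by rewrite ler_norml => /andP[c0 c1] /andP[b0 b1] /andP[a0 a1]; apply/andP; split; lra.
Qed.

Lemma bmf_kk y h : 0 < h -> bmf (kk y h).
Proof. by move=> h0; apply: bmf_kernel => //; exact: cub_kernel. Qed.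

Lemma bmf_et tau r : bmf (et tau r).
Proof. exact: bmf_step. Qed.

Definition box J T : set (R * R) := `]- J, J[ `*` `]0, T[.

Lemma measurable_box J T : measurable (box J T).
Proof. exact: measurableX. Qed.

(** For almost every time, the definition of the weak derivative is applied to [kk1], whose
    derivative is [kk2] and whose support stays inside [(-J, J)]. *)
Lemma parts_slice T J f p F y h : 0 < h -> `|y| + 2 * h < J -> L2W12 T J f p ->
  bmf F -> {ae mu2, forall z, QT T z -> f z = F z} ->
  {ae mu, forall t, 0 < t < T ->
    Int mu (fun x => (p \_ (box J T)) (x, t) * kk1 y h x) =
    - Int mu (fun x => F (x, t) * kk2 y h x)}.
Proof.
move=> h0 yJ [mf mp W _] bF fF.
have := ae_and W (ae_slice fF); apply: ae_imp => t [Wt fFt] tT.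
have tin : t \in `]0, T[ by rewrite in_itv.
have [/sub_Lfun_mfun + _ /(_ _ (C1c_kk1 h0 yJ))] := Wt tin.
rewrite !inE /= => mft.
have d1 : derive1 (kk1 y h) = kk2 y h.
  by apply/funext => x; apply: derive1_is; exact: is_derive_kk1.
rewrite d1 [X in X = _ -> _]Rintegral_mkcond [X in _ = - X -> _]Rintegral_mkcond => E.
have Jx (x : R) : (x \in `]- J, J[%classic) = (- J < x < J).
  by apply/idP/idP; rewrite inE /= in_itv.
have off x : ~~ (- J < x < J) -> (kk1 y h x = 0) * (kk2 y h x = 0).
  move=> xJ; split; apply/eqP; apply: contraNT xJ; [move/(kk1_off h0)|move/(kk2_off h0)] => xy;
    by rewrite -ltr_norml (le_lt_trans xy).
transitivity (- - Int mu ((fun x => p (x, t) * kk1 y h x) \_ `]- J, J[)).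
  rewrite opprK; apply: eq_Int => x; rewrite !patchE Jx.
  have -> : ((x, t) \in box J T) = (- J < x < J).
    apply/idP/idP => [|xJ]; first by rewrite inE => -[] /=; rewrite in_itv.
    by apply/mem_set; split => //=; rewrite in_itv.
  by case: ifPn => // xJ; rewrite (off _ xJ).1 mulr0.
congr (- _); apply: (etrans (esym E)); apply: Int_ae_eq.
- rewrite (_ : _ \_ _ = fun x => ((fun x => f (x, t)) \_ `]- J, J[) x * kk2 y h x); last first.
    by apply/funext => x; rewrite !patchE; case: ifPn => //; rewrite mul0r.
  by apply: measurable_funM; [exact: mft|exact: (bmf_kk2 y h0).1].
- apply: measurable_funM; last exact: (bmf_kk2 y h0).1.
  exact: (bmf_comp bF (pair2_measurable t)).1.
apply: ae_imp fFt => x Fx; rewrite patchE Jx; case: ifPn => xJ.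
  by rewrite Fx//; split => //=; rewrite in_itv.
by rewrite (off _ xJ).2 mulr0.
Qed.

(** On a box, which has finite measure, [|p| <= 1 + p^2] turns the finite iterated integral of
    squares into integrability. *)
Lemma itg_box T J f p : 0 < J -> 0 < T -> L2W12 T J f p -> itg mu2 (p \_ (box J T)).
Proof.
move=> J0 T0 [mf mp _ fin].
pose q : R * R -> R := (fun z => f z ^+ 2 + p z ^+ 2) \_ (box J T).
have restr (g : measurableTypeR R * measurableTypeR R -> R) :
    measurable_fun (box J T) g -> measurable_fun setT (g \_ (box J T)).
  by move=> mg; apply/(measurable_restrictT g (measurable_box J T)).
have mq : measurable_fun setT q.
  apply: restr; apply: (@measurable_funD _ (measurableTypeR R * measurableTypeR R)%type R (box J T)
    (fun z => f z ^+ 2) (fun z => p z ^+ 2)); exact: measurable_funX.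
have q0 z : 0 <= q z.
  by rewrite /q patchE; case: ifPn => // _; rewrite addr_ge0// sqr_ge0.
have iq : itg mu2 q.
  apply: (@integrable21ltyP _ _ _ _ _ mu mu _ _).2; first exact/measurable_EFinP.
  apply: le_lt_trans fin; rewrite le_eqVlt; apply/orP; left; apply/eqP.
  rewrite [RHS]integral_mkcond; apply: eq_integral => t _.
  rewrite patchE; case: ifPn => tT.
    rewrite [RHS]integral_mkcond; apply: eq_integral => x _ /=.
    rewrite ger0_norm// /q !patchE.
    have -> : ((x, t) \in box J T) = (x \in `]- J, J[%classic).
      by apply/idP/idP; rewrite !inE; [case|split => //; move: tT; rewrite inE].
    by case: ifPn.
  rewrite -[RHS](integral0 mu setT); apply: eq_integral => x _ /=.
  rewrite /q patchE ifN ?normr0//; apply: contra tT; rewrite !inE; by case.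
have i1 : itg mu2 (\1_(box J T) : R * R -> R).
  apply: (@itg_prod _ _ _ _ R mu mu (seg (- J) J) (seg 0 T)).
  - by apply: measurable_indic; exact: measurable_box.
  - exact: itg_seg.
  - exact: itg_seg.
  move=> z; rewrite indicE ger0_norm//; case: (boolP (z \in _)) => [|_]; last first.
    by rewrite mulr_ge0 ?seg_ge0.
  rewrite inE => -[] /=; rewrite !in_itv /= => /andP[a b] /andP[c e].
  by rewrite /seg (ltW a) b (ltW c) e mulr1.
apply: (itg_le _ _ (itgD i1 iq)); first exact: restr.
move=> z; rewrite /q !patchE indicE; case: ifPn => _; last by rewrite normr0 addr0.
have := sqr_ge0 (`|p z| - 1); have := sqr_ge0 (f z); rewrite -[p z ^+ 2]real_normK ?num_real//.
have := normr_ge0 (p z); rewrite /=; nra.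
Qed.

(** [p] is controlled on boxes only, so it is first cut to a box containing the support of the
    spline; Fubini then reduces the claim to single times. *)
Lemma parts_term T J f p F y h tau r : 0 < T -> 0 < h -> `|y| + 2 * h < J -> L2W12 T J f p ->
  bmf F -> (forall z, ~ QT T z -> F z = 0) -> {ae mu2, forall z, QT T z -> f z = F z} ->
  \int[leb2]_(z in QT T) (p z * dx (test y h tau r) z) =
  - Int mu2 (fun z => F z * (kk2 y h z.1 * et tau r z.2)).
Proof.
move=> T0 h0 yJ fp bF Foff fF.
have J0 : 0 < J by apply: le_lt_trans yJ; rewrite addr_ge0// mulr_ge0// ltW.
have ip := itg_box J0 T0 fp.
have bk1 := bmf_comp (bmf_kk1 y h0) (@measurable_fst _ _ R R).
have bet := bmf_comp (bmf_et tau r) (@measurable_snd _ _ R R).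
pose G (z : R * R) := (p \_ (box J T)) z * (kk1 y h z.1 * et tau r z.2).
transitivity (Int mu2 G).
  rewrite Rintegral_mkcond; apply: eq_Int => z; rewrite /G !patchE dx_test.
  case: (eqVneq (kk1 y h z.1) 0) => [->|zk].
    by case: ifPn; case: ifPn; rewrite !(mul0r,mulr0).
  have zJ : - J < z.1 < J by rewrite -ltr_norml (le_lt_trans (kk1_off h0 zk)).
  have -> : (z \in box J T) = (z \in QT T).
    apply/idP/idP; rewrite !inE; first by case.
    by move=> [_ ?]; split => //=; rewrite in_itv.
  by case: ifPn => //; rewrite mul0r.
have iG : itg mu2 G by apply: itgM => //; exact: bmfM.
have iF : itg mu2 (fun z => F z * (kk2 y h z.1 * et tau r z.2)).
  apply: (@itg2_off R (`|y| + 2 * h) T).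
    apply: bmfM => //; apply: bmfM => //.
    exact: bmf_comp (bmf_kk2 y h0) (@measurable_fst _ _ R R).
  move=> z; rewrite mulf_eq0 (mulf_eq0 (kk2 _ _ _)) !negb_or => /and3P[zF zk _]; split; first exact: kk2_off h0 zk.
  case: (boolP (0 < z.2 < T)) => // zT; move/eqP: zF; case.
  by apply: Foff => -[_] /=; rewrite in_itv; apply/negP.
rewrite -(IntN iF) (Int_iter2 iG) (Int_iter2 (itgN iF)).
apply: Int_ae_eq.
- exact: measurable_Int2 (itg_meas iG).
- exact: measurable_Int2 (itg_meas (itgN iF)).
have := ae_and (parts_slice h0 yJ fp bF fF) (ae_integrable2 ip).
apply: ae_imp => t [E it]; rewrite /G /=.
have iFt : itg mu (fun x => F (x, t) * kk2 y h x).
  apply: (@itg_off_slice R (`|y| + 2 * h) (fun z => F z * kk2 y h z.1)).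
    apply: bmfM => //; exact: bmf_comp (bmf_kk2 y h0) (@measurable_fst _ _ R R).
  by move=> z; rewrite mulf_eq0 negb_or => /andP[_]; exact: kk2_off.
case: (boolP (0 < t < T)) => tT.
  transitivity (et tau r t * Int mu (fun x => (p \_ (box J T)) (x, t) * kk1 y h x)).
    rewrite -IntZ; last by apply: itgM; [exact: it|exact: bmf_kk1].
    by apply: eq_Int => x; ring.
  rewrite (E tT) -(IntN iFt) -IntZ; last exact: itgN.
  by apply: eq_Int => x; ring.
have F0 x : F (x, t) = 0.
  by apply: Foff => -[_] /=; rewrite in_itv; apply/negP.
transitivity (Int mu (fun=> 0)).
  apply: eq_Int => x; rewrite patchE ifN ?mul0r//.
  by apply: contra tT; rewrite inE => -[_] /=; rewrite in_itv.
by apply: eq_Int => x; rewrite F0 mul0r oppr0.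
Qed.

End Parts.

(** * The smoothed equation for the difference of two solutions *)

Section Component.
Context (R : realType).
Local Notation mu := (@lebesgue_measure R).
Local Notation mu2 := ((@lebesgue_measure R) \x (@lebesgue_measure R))%E.
Implicit Types (J T y h tau r t : R).

Lemma Int_kk2 (g : R -> R) y h : 0 < h -> bmf g ->
  Int mu (fun x => g x * kk2 y h x) = h ^- 2 * lap h (mollify tent h g) y.
Proof.
move=> h0 bg; have it z : itg mu (fun x => h^-1 * tent ((z - x) / h) * g x).
  by apply: itgM => //; apply: itg_kernel => //; exact: tent_kernel.
rewrite /lap /mollify -IntZ// -IntD// -IntB//; [|exact: itgD|exact: itgZ].
rewrite -IntZ; last by apply: itgB; [exact: itgD|exact: itgZ].
apply: eq_Int => x; rewrite /kk2 /lap.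
have hE : h != 0 by rewrite gt_eqF.
rewrite (_ : (y - x) / h + 1 = (y + h - x) / h); last by field.
rewrite (_ : (y - x) / h - 1 = (y - h - x) / h); last by field.
by rewrite -!exprVn; ring.
Qed.

Lemma bmf_et1 tau r : bmf (et1 tau r).
Proof.
split; first by apply: continuous_measurable_fun; exact: continuous_et1.
exists `|- r^-1| => t; rewrite normrM ler_piMr//.
have [_ /(_ ((tau - t) / r)) /andP[t0 t1] _ _] := tent_kernel R.
by rewrite ger0_norm.
Qed.

Lemma itg_test T (g : R * R -> R) (e K : R -> R) J : bmf g -> bmf e -> bmf K ->
  (forall z, ~ QT T z -> g z = 0) -> (forall x, K x != 0 -> `|x| <= J) ->
  itg mu2 (fun z => g z * (K z.1 * e z.2)).
Proof.
move=> bg be bK goff Koff.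
have b1 := bmf_comp bK (@measurable_fst _ _ R R).
have b2 := bmf_comp be (@measurable_snd _ _ R R).
apply: (@itg2_off R J T); first by apply: bmfM => //; exact: bmfM.
move=> z; rewrite mulf_eq0 (mulf_eq0 (K _)) !negb_or => /and3P[zg zk _].
split; first exact: Koff.
case: (boolP (0 < z.2 < T)) => // zT; move/eqP: zg; case.
by apply: goff => -[_] /=; rewrite in_itv; apply/negP.
Qed.

Lemma iterate_test T (g : R * R -> R) (e K : R -> R) J : bmf g -> bmf e -> bmf K ->
  (forall z, ~ QT T z -> g z = 0) -> (forall x, K x != 0 -> `|x| <= J) ->
  Int mu2 (fun z => g z * (K z.1 * e z.2)) =
  Int mu (fun t => e t * Int mu (fun x => g (x, t) * K x)) /\
  itg mu (fun t => e t * Int mu (fun x => g (x, t) * K x)).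
Proof.
move=> bg be bK goff Koff.
have b1 := bmf_comp bK (@measurable_fst _ _ R R).
have b2 := bmf_comp be (@measurable_snd _ _ R R).
have i := itg_test bg be bK goff Koff.
have it t : itg mu (fun x => g (x, t) * K x).
  apply: (@itg_off_slice R J (fun z => g z * K z.1)); first exact: bmfM.
  by move=> z; rewrite mulf_eq0 negb_or => /andP[_]; exact: Koff.
have E t : Int mu (fun x => g (x, t) * (K x * e t)) = e t * Int mu (fun x => g (x, t) * K x).
  by rewrite -IntZ//; apply: eq_Int => x; ring.
have it' t : itg mu (fun x => g (x, t) * (K x * e t)).
  by have := itgZ (e t) (it t); apply: eq_itg => x; ring.
have [i1 <-] := @fubini_iter2 _ _ _ _ _ mu mu _ i it'.
split; first exact: eq_Int.
by apply: eq_itg i1.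
Qed.

Variables (T M L : R) (w a f : R * R -> R).
Hypotheses (mw : measurable_fun setT w) (ma : measurable_fun setT a)
  (mf : measurable_fun setT f) (wM : forall z, `|w z| <= M)
  (aL : forall z, 0 <= a z <= L) (fM : forall z, `|f z| <= M).
Hypotheses (woff : forall z, ~ QT T z -> w z = 0) (foff : forall z, ~ QT T z -> f z = 0).
Hypothesis weakE : forall y h tau r, 0 < h -> 0 < r -> tau + r <= T ->
  Int mu2 (fun z => w z * (kk y h z.1 * et1 tau r z.2)) =
  - Int mu2 (fun z => (a z * w z) * (kk2 y h z.1 * et tau r z.2))
  + Int mu2 (fun z => f z * (kk y h z.1 * et tau r z.2)).

(** For fixed [y] and [h], [weakE] says that [bb] is the weak time derivative of [kw]. Since [et1]
    is minus a rescaled tent, the left side of [weakE] is minus the tent mollification of [kw] in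
    time, as [weak_primitive] requires. *)
Lemma component_kwE h y : 0 < h -> {ae mu, forall tau, 0 < tau < T ->
  kw w h y tau = ww w a f h y tau}.
Proof.
move=> h0.
have bw : bmf w by split => //; exists M.
have bf : bmf f by split => //; exists M.
have ba : bmf a.
  by split => //; exists L => z; have /andP[a0 a1] := aL z; rewrite ger0_norm.
have baw : bmf (fun z => a z * w z) by exact: bmfM.
have awoff z : ~ QT T z -> a z * w z = 0 by move=> nz; rewrite woff// mulr0.
have bW : bmf (fun t => kw w h y t).
  by apply: (@bmf_slice R (fun z => kw w h z.1 z.2)); exact: (bmf_kw mw wM h0).
have bB : bmf (fun t => bb w a f h y t).
  by apply: (@bmf_slice R (fun z => bb w a f h z.1 z.2)); exact: (bmf_bb mw ma mf wM aL fM h0).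
have kkoff := fun x => @kk_off R y h x h0.
have kk2off := fun x => @kk2_off R y h x h0.
have nQT x t : ~~ (0 <= t < T) -> ~ QT T (x, t).
  by move=> tT [_] /=; rewrite in_itv /= => /andP[t0 t1]; rewrite (ltW t0) t1 in tT.
apply: (@weak_primitive R T (fun t => kw w h y t) (fun t => bb w a f h y t)) => //.
  by move=> t tT; apply: (@bb_off R T) => // x s sT; [apply: woff|apply: foff]; exact: nQT.
move=> tau r tau0 r0 tT.
have := weakE y h0 r0 tT.
have be1 := bmf_et1 tau r.
have [-> i1] := iterate_test bw be1 (bmf_kk y h0) woff kkoff.
have [-> i2] := iterate_test baw (bmf_et tau r) (bmf_kk2 y h0) awoff kk2off.
have [-> i3] := iterate_test bf (bmf_et tau r) (bmf_kk y h0) foff kkoff.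
rewrite -IntN// -IntD; [|exact: itgN|exact: i3] => E.
transitivity (- Int mu (fun t => et1 tau r t * Int mu (fun x => w (x, t) * kk y h x))).
  rewrite -IntN//; apply: eq_Int => t; rewrite /et1 !mulNr opprK; congr (_ * _).
  by apply: eq_Int => x; rewrite mulrC.
rewrite E -IntN; last by apply: itgD => //; exact: itgN.
apply: eq_Int => t; rewrite (Int_kk2 y h0 (bmf_comp baw (pair2_measurable t))).
have -> : Int mu (fun x => f (x, t) * kk y h x) = kf f h y t.
  by apply: eq_Int => x; rewrite mulrC.
by rewrite -/(bp w a h y t) /bb /bp /et; ring.
Qed.

End Component.

(** * Uniqueness *)

(** The minimum of [f] and [g] equals [f] almost everywhere and lies below [g] everywhere. *)
Lemma ler_Int_ae d (X : measurableType d) (R : realType)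
    (mu : {measure set X -> \bar R}) (f g : X -> R) : itg mu f -> itg mu g ->
  {ae mu, forall x, f x <= g x} -> Int mu f <= Int mu g.
Proof.
move=> itf itgg fg.
have mm : measurable_fun setT (fun x => Num.min (f x) (g x)).
  by apply: measurable_minr; [exact: itg_meas itf|exact: itg_meas itgg].
have im : itg mu (fun x => Num.min (f x) (g x)).
  apply: (itg_le mm _ (itgD (itg_abs itf) (itg_abs itgg))) => x.
  by rewrite minEle; case: ifPn => _; rewrite ?lerDl ?lerDr.
apply: (@le_trans _ _ (Int mu (fun x => Num.min (f x) (g x)))).
  rewrite le_eqVlt; apply/orP; left; apply/eqP; apply: Int_ae_eq => //.
    exact: itg_meas itf.
  by apply: ae_imp fg => x fgx; rewrite minEle fgx.
by apply: ler_Int => // x; rewrite ge_min lexx orbT.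
Qed.

(** * Gronwall's lemma with zero initial value *)

Section Gronwall.
Context (R : realType).
Local Notation mu := (@lebesgue_measure R).
Implicit Types (C d tau : R).

(** With [C * d <= 2^-1], the integral [J] of [y] over an interval of length [d] that starts where
    the primitive still vanishes satisfies [J <= J / 2]. Finitely many such intervals reach [T]. *)
Lemma gronwall0 (y : R -> R) C : bmf y -> (forall t, 0 <= y t) -> 0 <= C ->
  {ae mu, forall tau, y tau <= C * Int mu (fun s => seg 0 tau s * y s)} ->
  forall T, Int mu (fun s => seg 0 T s * y s) = 0.
Proof.
move=> by_ y0 C0 H T.
pose d := (2 * (C + 1))^-1.
have d0 : 0 < d by rewrite invr_gt0 mulr_gt0// ltr_wpDl.
have Cd : C * d <= 2^-1.
  rewrite /d invfM mulrCA ler_piMr ?invr_ge0// ler_pdivrMr ?ltr_wpDl// mul1r.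
  by rewrite lerDl.
pose m t := Int mu (fun s => seg 0 t s * y s).
have m_ge0 b c : 0 <= Int mu (fun s => seg b c s * y s).
  by apply: Int_ge0 => s; rewrite mulr_ge0 ?seg_ge0.
have its b c : itg mu (fun s => seg b c s * y s) by exact: itg_seg_bmf.
have mn n : m (n%:R * d) = 0.
  elim: n => [|n IH].
    rewrite /m mul0r -[RHS](Int0 mu); apply: eq_Int => s; rewrite /seg.
    by case: (lerP 0 s) => s0; rewrite ?mul0r//= ltNge s0 mul0r.
  pose c := n%:R * d; have c0 : 0 <= c by rewrite mulr_ge0// ltW.
  have Sc : n.+1%:R * d = c + d by rewrite -natr1 mulrDl mul1r.
  have cd : c <= c + d by rewrite lerDl ltW.
  pose J := Int mu (fun s => seg c (c + d) s * y s).
  have mJ : m (c + d) = J by rewrite /m (seg_chasles by_ c0 cd) -/(m c) IH add0r.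
  have : J <= C * d * J.
    rewrite -[in leRHS](addrK c d) (addrC d) -(Int_seg cd) mulrAC -IntZ; last exact: itg_seg.
    have iz : itg mu (fun s => C * J * seg c (c + d) s) by apply: itgZ; exact: itg_seg.
    apply: ler_Int_ae => //.
    apply: ae_imp H => t yt; rewrite /seg; case: (boolP (_ && _)) => [/andP[ct tcd]|_]; last first.
      by rewrite mul0r mulr0.
    rewrite mul1r mulr1 (le_trans yt)// ler_wpM2l// -mJ.
    rewrite /m (@seg_chasles R y 0 t (c + d))// ?lerDl//; [exact: le_trans ct|exact: ltW].
  have J0 : 0 <= J by exact: m_ge0.
  rewrite Sc mJ => JJ; apply/eqP; rewrite eq_le J0 andbT.
  have := ler_wpM2r J0 Cd; lra.
pose n := (Num.truncn (T / d)).+1.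
have Tn : T <= n%:R * d by rewrite -ler_pdivrMr// ltW// /n; exact: truncnS_gt.
case: (leP 0 T) => T0.
  apply/eqP; rewrite eq_le m_ge0 andbT; apply: (@le_trans _ _ (m (n%:R * d))).
    by rewrite /m (@seg_chasles R y 0 T (n%:R * d))// lerDl.
  by rewrite mn.
rewrite -[RHS](Int0 mu); apply: eq_Int => s; rewrite /seg.
case: (lerP 0 s) => s0; rewrite ?mul0r//=.
by rewrite ltNge (le_trans (ltW T0) s0) mul0r.
Qed.

End Gronwall.

(** * The difference quotient of [phi] *)

Section Coefficient.
Context (R : realType).
Implicit Types (M L c x y : R).

Lemma Cn1_continuous n (phi : R -> R) : Cn n.+1 phi -> continuous phi.
Proof.
move=> [d _] x; apply/differentiable_continuous/derivable1_diffP.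
exact: (d 0%N).
Qed.

Lemma Cn2_lipschitz (phi : R -> R) M : Cn 2 phi -> 0 <= M -> exists2 L, 0 <= L &
  forall x y, `|x| <= M -> `|y| <= M -> `|phi x - phi y| <= L * `|x - y|.
Proof.
move=> phi2 M0; have cphi := Cn1_continuous phi2; have [d _] := phi2.
have cd : continuous (derive1 phi).
  move=> x; apply/differentiable_continuous/derivable1_diffP; exact: (d 1%N).
have MM : - M <= M by rewrite ge0_cp.
have cn : {within `[- M, M], continuous (fun x => `|derive1 phi x|)}.
  apply: continuous_subspaceT => x; apply: cvg_norm; exact: cd.
have [m _ mM] := EVT_max MM cn.
have lip x y : `|x| <= M -> `|y| <= M -> x <= y ->
    `|phi y - phi x| <= `|derive1 phi m| * `|y - x|.
  move=> xM yM xy; have /andP[x1 _] : - M <= x <= M by rewrite -ler_norml.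
  have /andP[_ y2] : - M <= y <= M by rewrite -ler_norml.
  have [||z] := @MVT_segment R phi (derive1 phi) x y xy.
  - by move=> z _; apply: DeriveDef; [exact: (d 0%N)|rewrite derive1E].
  - exact: continuous_subspaceT.
  rewrite in_itv /= => /andP[z1 z2] ->.
  rewrite normrM ler_wpM2r//; apply: mM; rewrite in_itv /=.
  by rewrite (le_trans x1 z1) (le_trans z2 y2).
exists `|derive1 phi m| => // x y xM yM.
case: (leP x y) => xy; last exact/lip/ltW.
by rewrite distrC (distrC x) lip.
Qed.

(** The quotient is built from absolute values and the power -1, whose measurability is known;
    strict monotonicity of [phi] makes the signs of numerator and denominator agree. Where [u1 = u2]
    the inverse of 0 is 0 and both sides of the identity vanish. *)
Lemma coefficient d (X : measurableType d) (phi : R -> R) c (u1 u2 : X -> R) :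
  Cn 2 phi -> {homo phi : x y / x < y} -> 0 <= c -> bmf u1 -> bmf u2 ->
  exists a : X -> R, exists2 L, measurable_fun setT a /\ (forall z, 0 <= a z <= L) &
  forall z, a z * (u1 z - u2 z) = c * (phi (u1 z) - phi (u2 z)).
Proof.
move=> phi2 inc c0 [m1 [M1 uM1]] [m2 [M2 uM2]].
have mphi : measurable_fun setT phi.
  by apply: continuous_measurable_fun; exact: Cn1_continuous phi2.
have [L L0 lip] := @Cn2_lipschitz phi `|Num.max M1 M2| phi2 (normr_ge0 _).
have l1 z : `|u1 z| <= `|Num.max M1 M2|.
  by rewrite (le_trans (uM1 z))// (le_trans _ (ler_norm _))// le_max lexx.
have l2 z : `|u2 z| <= `|Num.max M1 M2|.
  by rewrite (le_trans (uM2 z))// (le_trans _ (ler_norm _))// le_max lexx orbT.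
have inv z : `|u1 z - u2 z| `^ (-1) = `|u1 z - u2 z|^-1 by rewrite powR_inv1.
exists (fun z => c * (`|phi (u1 z) - phi (u2 z)| * `|u1 z - u2 z| `^ (-1))), (c * L).
  split.
    apply: measurable_funM => //; apply: measurable_funM.
      apply: measurableT_comp => //; apply: measurable_funB; exact: measurableT_comp.
    apply: (@measurableT_comp _ _ _ _ _ _ (fun r : R => r `^ (-1))); first exact: measurable_powR.
    apply: measurableT_comp => //; exact: measurable_funB.
  move=> z; rewrite inv mulr_ge0 ?divr_ge0//= ler_wpM2l//.
  case: (eqVneq (u1 z) (u2 z)) => [->|ne]; first by rewrite subrr normr0 mul0r.
  by rewrite ler_pdivrMr ?lip// normr_gt0 subr_eq0.
move=> z; rewrite inv -mulrA; congr (_ * _).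
case: (ltgtP (u1 z) (u2 z)) => [lt|lt|->]; last by rewrite !subrr mulr0.
  have a : u1 z - u2 z < 0 by rewrite subr_lt0.
  have b : phi (u1 z) - phi (u2 z) < 0 by rewrite subr_lt0 inc.
  by rewrite !ltr0_norm//; field; rewrite lt_eqF.
have a : 0 < u1 z - u2 z by rewrite subr_gt0.
have b : 0 < phi (u1 z) - phi (u2 z) by rewrite subr_gt0 inc.
by rewrite !gtr0_norm//; field; rewrite gt_eqF.
Qed.

End Coefficient.

(** * Coupling of the two components *)

Section Contraction.
Context (R : realType).
Local Notation mu := (@lebesgue_measure R).
Local Notation mu2 := ((@lebesgue_measure R) \x (@lebesgue_measure R))%E.
Implicit Types (f g w : R * R -> R) (tau T A K : R).

Lemma seg_psi_fubini f tau : bmf f ->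
  [/\ itg mu2 (fun z => seg 0 tau z.2 * (`|f z| * psi z.1)),
    fpsi f tau = Int mu2 (fun z => seg 0 tau z.2 * (`|f z| * psi z.1)) &
    Int mu (fun s => seg 0 tau s * Int mu (fun x => `|f (x, s)| * psi x)) =
    Int mu2 (fun z => seg 0 tau z.2 * (`|f z| * psi z.1))].
Proof.
move=> bf; have [mf [M fM]] := bf.
pose G (z : R * R) := seg 0 tau z.2 * (`|f z| * psi z.1).
have bG : bmf G.
  apply: bmfM; first exact: (bmf_comp (bmf_seg 0 tau) (@measurable_snd _ _ R R)).
  apply: bmfM; first exact: bmf_abs.
  exact: (bmf_comp (bmf_psi R) (@measurable_fst _ _ R R)).
have iG : itg mu2 G.
  apply: (@itg_prod _ _ _ _ R mu mu (fun x => M * psi x) (seg 0 tau)).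
  - exact: bG.1.
  - by apply: itgZ; exact: itg_psi.
  - exact: itg_seg.
  move=> z; rewrite /G normrM (ger0_norm (seg_ge0 _ _ _)) mulrC ler_wpM2r ?seg_ge0//.
  rewrite normrM normr_id (ger0_norm (ltW (psi_gt0 _))) ler_wpM2r//.
  exact: ltW (psi_gt0 _).
have b1 (x : R) : bmf (fun s => `|f (x, s)|).
  exact: (bmf_comp (bmf_abs bf) (pair1_measurable x)).
have b2 (s : R) : bmf (fun x => `|f (x, s)|).
  exact: (bmf_comp (bmf_abs bf) (pair2_measurable s)).
have i1 (x : R) : itg mu (fun s => G (x, s)).
  have := itgZ (psi x) (itg_seg_bmf 0 tau (b1 x)).
  by apply: eq_itg => s; rewrite /G /=; ring.
have i2 (s : R) : itg mu (fun x => `|f (x, s)| * psi x).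
  by apply: itgMl; [exact: itg_psi|exact: b2].
have i3 (s : R) : itg mu (fun x => G (x, s)).
  by have := itgZ (seg 0 tau s) (i2 s); apply: eq_itg => x.
have [_ E1] := @fubini_iter1 _ _ _ _ _ mu mu _ iG i1.
have [_ E2] := @fubini_iter2 _ _ _ _ _ mu mu _ iG i3.
split => //; rewrite -/G.
  rewrite -E1; apply: eq_Int => x; rewrite mulrC -IntZ; last exact: itg_seg_bmf.
  by apply: eq_Int => s; rewrite /G /=; ring.
by rewrite -E2; apply: eq_Int => s; rewrite -IntZ.
Qed.

(** The source involves both differences, so only the sum of their weighted norms satisfies a closed
    inequality. Positivity of [psi] turns a vanishing weighted integral into vanishing almost
    everywhere. *)
Lemma contraction_zero T A K w1 w2 f : bmf w1 -> bmf w2 -> bmf f -> 0 <= A -> 0 <= K ->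
  (forall z, ~ QT T z -> w1 z = 0) -> (forall z, ~ QT T z -> w2 z = 0) ->
  (forall z, `|f z| <= K * (`|w1 z| + `|w2 z|)) ->
  {ae mu, forall tau, 0 < tau < T ->
    Int mu (fun x => `|w1 (x, tau)| * psi x) <= A * fpsi f tau} ->
  {ae mu, forall tau, 0 < tau < T ->
    Int mu (fun x => `|w2 (x, tau)| * psi x) <= A * fpsi f tau} ->
  {ae mu2, forall z, w1 z = 0 /\ w2 z = 0}.
Proof.
move=> b1 b2 bf A0 K0 w1off w2off fK h1 h2.
pose g (z : R * R) := `|w1 z| + `|w2 z|.
have bg : bmf g by apply: bmfD; exact: bmf_abs.
have g0 z : `|g z| = g z by rewrite ger0_norm// addr_ge0.
pose y (s : R) := Int mu (fun x => `|g (x, s)| * psi x).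
have sl (w : R * R -> R) (s : R) : bmf w -> itg mu (fun x => `|w (x, s)| * psi x).
  move=> bw; apply: itgMl; first exact: itg_psi.
  exact: (bmf_comp (bmf_abs bw) (pair2_measurable s)).
have y0 t : 0 <= y t.
  by apply: Int_ge0 => x; rewrite mulr_ge0// ltW// psi_gt0.
have by_ : bmf y.
  have [mg [M gM]] := bg; split.
    apply: (@measurable_Int2 _ _ _ _ _ mu (fun z : R * R => `|g z| * psi z.1)).
    apply: measurable_funM; first exact: measurableT_comp.
    exact: (measurableT_comp (@measurable_psi R) measurable_fst).
  exists (Int mu (fun x => M * psi x)) => s; rewrite ger0_norm//.
  apply: ler_Int; [exact: sl|by apply: itgZ; exact: itg_psi|] => x.
  by rewrite ler_wpM2r// ltW// psi_gt0.
have yle : {ae mu, forall tau, y tau <= 2 * A * K * Int mu (fun s => seg 0 tau s * y s)}.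
  have := ae_and h1 h2; apply: ae_imp => tau [l1 l2].
  (* Gronwall asks for the inequality at almost every real [tau]; outside [(0, T)] both functions
     vanish. *)
  case: (boolP (0 < tau < T)) => tT; last first.
    have gz x : g (x, tau) = 0.
      have nq : ~ QT T (x, tau) by move=> [_] /=; rewrite in_itv; apply/negP.
      by rewrite /g w1off// w2off// normr0 addr0.
    rewrite {1}/y; under eq_Int do rewrite gz normr0 mul0r.
    by rewrite Int0 !mulr_ge0// Int_ge0// => s; rewrite mulr_ge0 ?seg_ge0.
  have yE : y tau = Int mu (fun x => `|w1 (x, tau)| * psi x) + Int mu (fun x => `|w2 (x, tau)| * psi x).
    by rewrite -IntD; [apply: eq_Int => x; rewrite g0 mulrDl|exact: sl|exact: sl].
  have fle : fpsi f tau <= K * Int mu (fun s => seg 0 tau s * y s).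
    have [i1 -> _] := seg_psi_fubini tau bf.
    have [i2 _ ->] := seg_psi_fubini tau bg.
    rewrite -IntZ//; apply: ler_Int => //; first exact: itgZ.
    move=> z; rewrite [leRHS]mulrCA ler_wpM2l ?seg_ge0// [leRHS]mulrA ler_wpM2r ?(ltW (psi_gt0 _))//.
    by rewrite g0.
  have := ler_wpM2l A0 fle; rewrite yE.
  have := l1 tT; have := l2 tT; set Y := Int _ _; set W := Int _ _; lra.
have AK0 : 0 <= 2 * A * K by rewrite !mulr_ge0.
have yT := gronwall0 by_ y0 AK0 yle T.
have [iG _ EG] := seg_psi_fubini T bg.
have G0 z : `|seg 0 T z.2 * (`|g z| * psi z.1)| = seg 0 T z.2 * (`|g z| * psi z.1).
  by rewrite ger0_norm// !mulr_ge0 ?seg_ge0// ltW// psi_gt0.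
have I0 : Int mu2 (fun z => `|seg 0 T z.2 * (`|g z| * psi z.1)|) = 0.
  rewrite -[RHS]yT EG; apply: eq_Int => z; exact: G0.
apply: ae_imp (Int_eq0 iG I0) => z; rewrite g0.
case: (pselect (QT T z)) => [[_ /=]|nq]; last by rewrite w1off// w2off.
rewrite in_itv /= /seg => /andP[t0 tT]; rewrite (ltW t0) tT mul1r => /eqP.
rewrite mulf_eq0 [X in _ || X]gt_eqF ?psi_gt0// orbF paddr_eq0//.
by rewrite !normr_eq0 => /andP[/eqP -> /eqP ->].
Qed.

End Contraction.

(** * From weak solutions to bounded representatives *)

Section WeakSolution.
Context (R : realType).
Local Notation mu := (@lebesgue_measure R).
Local Notation mu2 := ((@lebesgue_measure R) \x (@lebesgue_measure R))%E.
Implicit Types (T J c h k tau r y : R) (u v p f g : R * R -> R).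

(** [u] is arbitrary outside [QT T], so measurability is recorded for its restriction; it is needed
    to compare integrals through equality almost everywhere. *)
Definition represents T u uh := [/\ measurable_fun setT (u \_ (QT T)), bmf uh,
  forall z, ~ QT T z -> uh z = 0 & {ae mu2, forall z, QT T z -> u z = uh z}].

Lemma Linfty_representative T u : Lp_on leb2 +oo%E (QT T) u ->
  exists uh, represents T u uh.
Proof.
move=> Lu; have [uh [buh off uae]] := bounded_representative Lu.
exists uh; split => //; have := sub_Lfun_mfun Lu; rewrite inE /=.
exact.
Qed.

Lemma representsM T u uh v vh : represents T u uh -> represents T v vh ->
  represents T (fun z => u z * v z) (fun z => uh z * vh z).
Proof.
move=> [mu_ bu uoff uae] [mv bv voff vae]; split.
- have -> : (fun z => u z * v z) \_ (QT T) = fun z => (u \_ (QT T)) z * (v \_ (QT T)) z.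
    by apply/funext => z; rewrite !patchE; case: ifPn => //; rewrite mul0r.
  exact: measurable_funM.
- exact: bmfM.
- by move=> z nz; rewrite uoff// mul0r.
by apply: ae_imp (ae_and uae vae) => z [uz vz] Qz; rewrite uz// vz.
Qed.

Lemma bmf_continuous_comp (phi : R -> R) u : continuous phi -> bmf u ->
  bmf (fun z => phi (u z)).
Proof.
move=> cphi [mu_ [M uM]]; split.
  by apply: measurableT_comp => //; apply: continuous_measurable_fun.
have M0 : 0 <= M by exact: le_trans (uM (0, 0)).
have MM : - M <= M by rewrite ge0_cp.
have cn : {within `[- M, M], continuous (fun x => `|phi x|)}.
  apply: continuous_subspaceT => x; apply: cvg_norm; exact: cphi.
have [m _ mM] := EVT_max MM cn.
by exists `|phi m| => z; apply: mM; rewrite in_itv /= -ler_norml.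
Qed.

Lemma Rintegral_representative T g gh (K : R * R -> R) : represents T g gh -> bmf K ->
  \int[leb2]_(z in QT T) (g z * K z) = Int mu2 (fun z => gh z * K z).
Proof.
move=> [mg [mgh _] off ggh] [mK _].
transitivity (Int mu2 (fun z => (g \_ (QT T)) z * K z)).
  rewrite Rintegral_mkcond; apply: eq_Int => z; rewrite !patchE.
  by case: ifPn => //; rewrite mul0r.
apply: Int_ae_eq; [exact: measurable_funM|exact: measurable_funM|].
apply: ae_imp ggh => z gz; rewrite patchE; case: ifPn => zQ.
  by rewrite gz//; move: zQ; rewrite inE.
by rewrite off// => Qz; rewrite mem_set in zQ.
Qed.

(** Rewrites one weak equation in terms of representatives and moves the derivative from [p] to the
    spline. [I0] stands for the initial term. *)
Lemma component_identity (T c k I0 y h tau r : R) (phi : R -> R) u uh p g gh :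
  0 < T -> 0 <= c -> 0 < h -> 0 < r -> tau + r <= T ->
  continuous phi -> phi 0 = 0 ->
  represents T u uh -> represents T g gh ->
  (0 < c -> forall J, 0 < J -> L2W12 T J (phi \o u) p) ->
  I0 + \int[leb2]_(z in QT T) (u z * dt (test y h tau r) z) =
    c * \int[leb2]_(z in QT T) (p z * dx (test y h tau r) z)
    + k * \int[leb2]_(z in QT T) (g z * test y h tau r z) ->
  I0 + Int mu2 (fun z => uh z * (kk y h z.1 * et1 tau r z.2)) =
    - c * Int mu2 (fun z => phi (uh z) * (kk2 y h z.1 * et tau r z.2))
    + k * Int mu2 (fun z => gh z * (kk y h z.1 * et tau r z.2)).
Proof.
move=> T0 c0 h0 r0 tT cphi phi0 urep grep W.
have [mu_ buh uoff uae] := urep; have bF := bmf_continuous_comp cphi buh.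
have b1 := bmf_comp (bmf_kk y h0) (@measurable_fst _ _ R R).
have b2 := bmf_comp (bmf_et tau r) (@measurable_snd _ _ R R).
have b3 := bmf_comp (bmf_et1 tau r) (@measurable_snd _ _ R R).
have -> : \int[leb2]_(z in QT T) (u z * dt (test y h tau r) z) =
    Int mu2 (fun z => uh z * (kk y h z.1 * et1 tau r z.2)).
  rewrite -(Rintegral_representative urep (bmfM b1 b3)).
  by apply: eq_Rintegral => z _; rewrite dt_test.
rewrite (Rintegral_representative grep (bmfM b1 b2)) => ->; congr (_ + _).
(* For [c = 0] nothing is known about [p], but both terms carry the factor 0. *)
case: (ltgtP 0 c) c0 => // [cp|<-] _; last by rewrite oppr0 !mul0r.
rewrite mulNr -mulrN; congr (_ * _).
pose J := `|y| + 2 * h + 1.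
have yJ : `|y| + 2 * h < J by rewrite ltrDl.
have J0 : 0 < J by apply: le_lt_trans yJ; rewrite addr_ge0// mulr_ge0// ltW.
apply: (parts_term tau r T0 h0 yJ (W cp J J0) bF).
  by move=> z nz; rewrite uoff.
by apply: ae_imp uae => z uz /uz /= ->.
Qed.

(** [I0] depends on the test function only, so the initial terms cancel in the difference. The
    diffusion constant [c] is absorbed into [a], which treats both equations, and [c = 0], at
    once. *)
Lemma component_contraction (T c k : R) (phi : R -> R) (I0 : (R * R -> R) -> R)
    u1 uh1 u2 uh2 p1 p2 g1 gh1 g2 gh2 : 0 < T -> 0 <= c -> 0 <= k ->
  Cn 2 phi -> {homo phi : x y / x < y} -> phi 0 = 0 ->
  represents T u1 uh1 -> represents T u2 uh2 ->
  represents T g1 gh1 -> represents T g2 gh2 ->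
  (0 < c -> forall J, 0 < J -> L2W12 T J (phi \o u1) p1) ->
  (0 < c -> forall J, 0 < J -> L2W12 T J (phi \o u2) p2) ->
  (forall Psi, test_fun T Psi -> I0 Psi + \int[leb2]_(z in QT T) (u1 z * dt Psi z) =
    c * \int[leb2]_(z in QT T) (p1 z * dx Psi z)
    + k * \int[leb2]_(z in QT T) (g1 z * Psi z)) ->
  (forall Psi, test_fun T Psi -> I0 Psi + \int[leb2]_(z in QT T) (u2 z * dt Psi z) =
    c * \int[leb2]_(z in QT T) (p2 z * dx Psi z)
    + k * \int[leb2]_(z in QT T) (g2 z * Psi z)) ->
  exists2 A, 0 <= A & {ae mu, forall tau, 0 < tau < T ->
    Int mu (fun x => `|uh1 (x, tau) - uh2 (x, tau)| * psi x) <=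
    A * fpsi (fun z => k * (gh1 z - gh2 z)) tau}.
Proof.
move=> T0 c0 k0 phi2 inc phi0 r1 r2 s1 s2 W1 W2 E1 E2.
have cphi := Cn1_continuous phi2.
have [_ bu1 uoff1 _] := r1; have [_ bu2 uoff2 _] := r2.
have [_ bg1 goff1 _] := s1; have [_ bg2 goff2 _] := s2.
have [a [L [ma aL] aE]] := coefficient phi2 inc c0 bu1 bu2.
pose w z := uh1 z - uh2 z; pose f z := k * (gh1 z - gh2 z).
have aE' z : a z * w z = c * (phi (uh1 z) - phi (uh2 z)) by exact: aE.
have bw : bmf w by exact: bmfB.
have bf : bmf f by apply: bmfM; [exact: bmf_cst|exact: bmfB].
have woff z : ~ QT T z -> w z = 0 by move=> nz; rewrite /w uoff1// uoff2// subr0.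
have foff z : ~ QT T z -> f z = 0 by move=> nz; rewrite /f goff1// goff2// subr0 mulr0.
have [mw [Mw wM]] := bw; have [mf [Mf fM]] := bf.
have wM' z : `|w z| <= Num.max Mw Mf by rewrite le_max wM.
have fM' z : `|f z| <= Num.max Mw Mf by rewrite le_max fM orbT.
have b1 := bmf_continuous_comp cphi bu1; have b2 := bmf_continuous_comp cphi bu2.
have o1 z : ~ QT T z -> phi (uh1 z) = 0 by move=> nz; rewrite uoff1.
have o2 z : ~ QT T z -> phi (uh2 z) = 0 by move=> nz; rewrite uoff2.
have weakE y h tau r : 0 < h -> 0 < r -> tau + r <= T ->
    Int mu2 (fun z => w z * (kk y h z.1 * et1 tau r z.2)) =
    - Int mu2 (fun z => (a z * w z) * (kk2 y h z.1 * et tau r z.2))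
    + Int mu2 (fun z => f z * (kk y h z.1 * et tau r z.2)).
  move=> h0 r0 tT; have tst := test_fun_test y h0 r0 tT.
  have kkoff := fun x => @kk_off R y h x h0.
  have kk2off := fun x => @kk2_off R y h x h0.
  have := component_identity T0 c0 h0 r0 tT cphi phi0 r1 s1 W1 (E1 _ tst).
  have := component_identity T0 c0 h0 r0 tT cphi phi0 r2 s2 W2 (E2 _ tst).
  have i1 := itg_test bu1 (bmf_et1 tau r) (bmf_kk y h0) uoff1 kkoff.
  have i2 := itg_test bu2 (bmf_et1 tau r) (bmf_kk y h0) uoff2 kkoff.
  have i3 := itg_test b1 (bmf_et tau r) (bmf_kk2 y h0) o1 kk2off.
  have i4 := itg_test b2 (bmf_et tau r) (bmf_kk2 y h0) o2 kk2off.
  have i5 := itg_test bg1 (bmf_et tau r) (bmf_kk y h0) goff1 kkoff.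
  have i6 := itg_test bg2 (bmf_et tau r) (bmf_kk y h0) goff2 kkoff.
  have -> : Int mu2 (fun z => w z * (kk y h z.1 * et1 tau r z.2)) =
      Int mu2 (fun z => uh1 z * (kk y h z.1 * et1 tau r z.2)) -
      Int mu2 (fun z => uh2 z * (kk y h z.1 * et1 tau r z.2)).
    by rewrite -IntB//; apply: eq_Int => z; rewrite mulrBl.
  have -> : Int mu2 (fun z => (a z * w z) * (kk2 y h z.1 * et tau r z.2)) =
      c * (Int mu2 (fun z => phi (uh1 z) * (kk2 y h z.1 * et tau r z.2)) -
      Int mu2 (fun z => phi (uh2 z) * (kk2 y h z.1 * et tau r z.2))).
    rewrite -IntB// -IntZ; last exact: itgB.
    by apply: eq_Int => z; rewrite aE'; ring.
  have -> : Int mu2 (fun z => f z * (kk y h z.1 * et tau r z.2)) =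
      k * (Int mu2 (fun z => gh1 z * (kk y h z.1 * et tau r z.2)) -
      Int mu2 (fun z => gh2 z * (kk y h z.1 * et tau r z.2))).
    rewrite -IntB// -IntZ; last exact: itgB.
    by apply: eq_Int => z; rewrite /f; ring.
  set X1 := Int _ _; set X2 := Int _ _; set X3 := Int _ _; set X4 := Int _ _.
  set X5 := Int _ _; set X6 := Int _ _; lra.
have nQT x t : ~~ (0 <= t < T) -> ~ QT T (x, t).
  by move=> tT [_] /=; rewrite in_itv /= => /andP[t0 t1]; rewrite (ltW t0) t1 in tT.
exists (expR (3 * (L + 1) * T)); first exact: expR_ge0.
apply: (@weighted_L1 R T (Num.max Mw Mf) L w a f) => //.
- by move=> x t tT; apply: woff; exact: nQT.
- by move=> x t tT; apply: foff; exact: nQT.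
by move=> h y h0; exact: (component_kwE mw ma mf wM' aL fM' woff foff weakE).
Qed.

End WeakSolution.

Theorem corollary5p3 (R : realType) (T U0 V0 : R) (phi : R -> R)
    (u0 v0 : R -> R -> R) (eps k : R) (u1 v1 u2 v2 : R * R -> R)
    (T_gt0 : 0 < T) (U0_gt0 : 0 < U0) (V0_gt0 : 0 < V0)
    (phiP : phi_assumption phi)
    (data : initial_data U0 V0 u0 v0)
    (eps_ge0 : 0 <= eps) (k_gt0 : 0 < k)
    (sol1 : weak_solution phi T eps k (u0 k) (v0 k) u1 v1)
    (sol2 : weak_solution phi T eps k (u0 k) (v0 k) u2 v2) :
  {ae leb2, forall z, QT T z -> u1 z = u2 z /\ v1 z = v2 z}.
Proof.
have [phi2 inc _ _ [phi0 _]] := phiP.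
have [Lu1 Lv1 [p1 [q1 [Wu1 Wv1 E1]]]] := sol1.
have [Lu2 Lv2 [p2 [q2 [Wu2 Wv2 E2]]]] := sol2.
have [uh1 ru1] := Linfty_representative Lu1.
have [vh1 rv1] := Linfty_representative Lv1.
have [uh2 ru2] := Linfty_representative Lu2.
have [vh2 rv2] := Linfty_representative Lv2.
have g1 := representsM ru1 rv1; have g2 := representsM ru2 rv2.
have sw (Psi u v : R * R -> R) : \int[leb2]_(z in QT T) (Psi z * u z * v z) =
    \int[leb2]_(z in QT T) (u z * v z * Psi z).
  by apply: eq_Rintegral => z _; rewrite -mulrA mulrC.
have [A A0 cu] : exists2 A, 0 <= A & {ae leb, forall tau, 0 < tau < T ->
    Int leb (fun x => `|uh1 (x, tau) - uh2 (x, tau)| * psi x) <=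
    A * fpsi (fun z => k * (uh1 z * vh1 z - uh2 z * vh2 z)) tau}.
  apply: (@component_contraction R T 1 k phi
    (fun Psi => \int[leb]_x (u0 k x * Psi (x, 0))) u1 uh1 u2 uh2 p1 p2 _ _ _ _
    T_gt0 ler01 (ltW k_gt0) phi2 inc phi0 ru1 ru2 g1 g2) => //.
  - by move=> Psi tst; rewrite mul1r -sw; exact: (E1 _ tst).1.
  - by move=> Psi tst; rewrite mul1r -sw; exact: (E2 _ tst).1.
(* The same lemma with [c = eps]; if [eps = 0] its premises on [q1] and [q2] hold vacuously. *)
have [B B0 cv] : exists2 B, 0 <= B & {ae leb, forall tau, 0 < tau < T ->
    Int leb (fun x => `|vh1 (x, tau) - vh2 (x, tau)| * psi x) <=
    B * fpsi (fun z => k * (uh1 z * vh1 z - uh2 z * vh2 z)) tau}.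
  apply: (@component_contraction R T eps k phi
    (fun Psi => \int[leb]_x (v0 k x * Psi (x, 0))) v1 vh1 v2 vh2 q1 q2 _ _ _ _
    T_gt0 eps_ge0 (ltW k_gt0) phi2 inc phi0 rv1 rv2 g1 g2) => //.
  - by move=> Psi tst; rewrite -sw; exact: (E1 _ tst).2.
  - by move=> Psi tst; rewrite -sw; exact: (E2 _ tst).2.
have [_ bu1 uoff1 uae1] := ru1; have [_ bu2 uoff2 uae2] := ru2.
have [_ bv1 voff1 vae1] := rv1; have [_ bv2 voff2 vae2] := rv2.
pose f z := k * (uh1 z * vh1 z - uh2 z * vh2 z).
have fpsi0 tau : 0 <= fpsi f tau.
  apply: Int_ge0 => x; rewrite mulr_ge0 ?(ltW (psi_gt0 x))//.
  by apply: Int_ge0 => s; rewrite mulr_ge0 ?seg_ge0.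
have [C1 vC] := bv1.2; have [C2 uC] := bu2.2.
have C10 : 0 <= C1 by exact: le_trans (vC (0, 0)).
have C20 : 0 <= C2 by exact: le_trans (uC (0, 0)).
have bf : bmf f by apply: bmfM; [exact: bmf_cst|apply: bmfB; exact: bmfM].
have woff z : ~ QT T z -> uh1 z - uh2 z = 0 by move=> nz; rewrite uoff1// uoff2// subr0.
have zoff z : ~ QT T z -> vh1 z - vh2 z = 0 by move=> nz; rewrite voff1// voff2// subr0.
(* The difference of products is split with [vh1] and [uh2] as coefficients, bounded by [C1] and
   [C2]; their sum serves both terms. *)
have fle z : `|f z| <= k * (C1 + C2) * (`|uh1 z - uh2 z| + `|vh1 z - vh2 z|).
  have -> : f z = k * ((uh1 z - uh2 z) * vh1 z + uh2 z * (vh1 z - vh2 z)) by rewrite /f; ring.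
  rewrite normrM (gtr0_norm k_gt0) -mulrA ler_pM2l//.
  apply: (le_trans (ler_normD _ _)); rewrite !normrM.
  have := ler_wpM2l (normr_ge0 (uh1 z - uh2 z)) (vC z).
  have := ler_wpM2r (normr_ge0 (vh1 z - vh2 z)) (uC z).
  have := mulr_ge0 C10 (normr_ge0 (vh1 z - vh2 z)).
  have := mulr_ge0 C20 (normr_ge0 (uh1 z - uh2 z)).
  rewrite mulrDr !mulrDl; lra.
have zero := @contraction_zero R T (A + B) (k * (C1 + C2)) (fun z => uh1 z - uh2 z)
  (fun z => vh1 z - vh2 z) f (bmfB bu1 bu2) (bmfB bv1 bv2) bf (addr_ge0 A0 B0)
  (mulr_ge0 (ltW k_gt0) (addr_ge0 C10 C20)) woff zoff fle.
(* Both estimates are put under the common constant [A + B] that [contraction_zero] expects. *)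
have uAB : {ae leb, forall tau, 0 < tau < T ->
    Int leb (fun x => `|uh1 (x, tau) - uh2 (x, tau)| * psi x) <= (A + B) * fpsi f tau}.
  apply: ae_imp cu => tau + tT => /(_ tT) /le_trans; apply.
  by rewrite ler_wpM2r// lerDl.
have vAB : {ae leb, forall tau, 0 < tau < T ->
    Int leb (fun x => `|vh1 (x, tau) - vh2 (x, tau)| * psi x) <= (A + B) * fpsi f tau}.
  apply: ae_imp cv => tau + tT => /(_ tT) /le_trans; apply.
  by rewrite ler_wpM2r// lerDr.
have := ae_and (zero uAB vAB) (ae_and (ae_and uae1 uae2) (ae_and vae1 vae2)).
apply: ae_imp => z [[zu zv] [[e1 e2] [e3 e4]]] Qz.
by rewrite e1// e2// e3// e4//; split; apply/eqP; rewrite -subr_eq0 ?zu ?zv.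
Qed.
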